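(* Let $\mathcal{M},\mathcal{N}$ be von Neumann algebras and let $\Phi,\Psi,\Phi_i,\Psi_i\in\mathrm{CP}(\mathcal{M},\mathcal{N})$ for $i=1,2$. Then: (1) if $\Phi_1\le_{\mathrm{cp}}\Phi_2$ and $\Psi_1\le_{\mathrm{cp}}\Psi_2$, then $\Phi_1\#\Psi_1\le_{\mathrm{cp}}\Phi_2\#\Psi_2$; (2) for any von Neumann algebra $\mathcal{P}$ and $\Xi\in\mathrm{CP}(\mathcal{N},\mathcal{P})$, $\;\Xi\circ(\Phi\#\Psi)\le_{\mathrm{cp}}(\Xi\circ\Phi)\#(\Xi\circ\Psi)$; (3) for any von Neumann algebra $\mathcal{L}$ and $\Xi\in\mathrm{CP}(\mathcal{L},\mathcal{M})$, $\;(\Phi\#\Psi)\circ\Xi\le_{\mathrm{cp}}(\Phi\circ\Xi)\#(\Psi\circ\Xi)$; (4) if $(\Phi_n)_{n\ge1},(\Psi_n)_{n\ge1}$ are sequences in $\mathrm{CP}(\mathcal{M},\mathcal{N})$ with $\Phi_n\downarrow\Phi$ and $\Psi_n\downarrow\Psi$, then $\Phi_n\#\Psi_n\downarrow\Phi\#\Psi$. Here $\Phi_n\downarrow\Phi$ means that $\Phi_1\ge_{\mathrm{cp}}\Phi_2\ge_{\mathrm{cp}}\cdots$ and $\Phi_n(x)\to\Phi(x)$ ultraweakly for each $x\in\mathcal{M}^+$.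
   Context: $\mathrm{CP}(\mathcal{M},\mathcal{N})$ is the set of all completely positive (CP) maps $\mathcal{M}\to\mathcal{N}$ (not assumed normal). $\Phi\le_{\mathrm{cp}}\Psi$ means $\Psi-\Phi$ is CP. Forms: for a complex vector space $\mathcal{V}$, $F_+(\mathcal{V})$ is the set of positive sesquilinear forms on $\mathcal{V}$ (linear in the first variable). A compatible representation of $\alpha,\beta\in F_+(\mathcal{V})$ consists of a linear map $h$ from $\mathcal{V}$ onto a dense subspace of a Hilbert space $\mathcal{H}$ and commuting positive $A,B\in\mathbb{B}(\mathcal{H})$ with $\alpha(x,y)=\langle Ah(x),h(y)\rangle$, $\beta(x,y)=\langle Bh(x),h(y)\rangle$. By Pusz–Woronowicz such representations always exist, and for a homogeneous locally bounded Borel function $f$ on $[0,\infty)^2$ the form $f(\alpha,\beta)(x,y):=\langle f(A,B)h(x),h(y)\rangle$ does not depend on the choice. The geometric mean is $\alpha\#\beta:=f(\alpha,\beta)$ with $f(r,s)=\sqrt{rs}$. CP maps: $L^2(\mathcal{N})$ is the standard form Hilbert space of $\mathcal{N}$. For $\Phi\in\mathrm{CP}(\mathcal{M},\mathcal{N})$, $s_\Phi$ is the positive sesquilinear form on the algebraic tensor product $\mathcal{M}\odot L^2(\mathcal{N})$ given by $s_\Phi(x\otimes\xi,y\otimes\eta)=\langle\Phi(y^*x)\xi,\eta\rangle$. The geometric mean $\Phi\#\Psi\in\mathrm{CP}(\mathcal{M},\mathcal{N})$ is the unique CP map with $\langle(\Phi\#\Psi)(y^*x)\xi,\eta\rangle=(s_\Phi\#s_\Psi)(x\otimes\xi,y\otimes\eta)$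 for all $x,y\in\mathcal{M}$, $\xi,\eta\in L^2(\mathcal{N})$. *)

(* Defs.v *)
From HB Require Import structures.
From mathcomp Require Import all_boot all_order all_algebra.
From mathcomp Require Import sesquilinear complex.
From mathcomp Require Import all_classical all_reals all_analysis.

Set Implicit Arguments.
Unset Strict Implicit.
Unset Printing Implicit Defensive.

Import Order.TTheory GRing.Theory Num.Theory.
Import numFieldNormedType.Exports.

Local Open Scope classical_set_scope.
Local Open Scope ring_scope.
Local Open Scope complex_scope.

HB.mixin Record CompleteNormedModule_isHilbert (R : realType) H
    & CompleteNormedModule R[i] H := {
  hdot : {dot H for (@Num.conj R[i])} ;
  hdot_norm : forall u : H, hdot u u = `|u| ^+ 2
}.

#[short(type="hilbertType")]
HB.structure Definition Hilbert (R : realType) :=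
  {H of CompleteNormedModule R[i] H & CompleteNormedModule_isHilbert R H}.

Notation "'[ u , v ]" := (hdot u v) : ring_scope.

Section Operators.
Context {R : realType} {H : hilbertType R}.
Implicit Types a b c : H -> H.

Definition bounded_op : set (H -> H) := [set a | linear a /\ continuous a].

Definition adjoint a b := forall u v : H, '[a u, v] = '[u, b v].

(* The scalars are complex, so a positive operator is self-adjoint: the order
   of R[i] forces '[a u, u] to be real. *)
Definition pos_op a := bounded_op a /\ forall u : H, 0 <= '[a u, u].

Definition sqrt_op a c := pos_op c /\ c \o c = a.

Definition commutant (S : set (H -> H)) : set (H -> H) :=
  [set b | bounded_op b /\ forall a, S a -> a \o b = b \o a].

End Operators.

Record vnAlgebra (R : realType) := VNAlgebra {
  vn_space : hilbertType R ;
  vn_set : set (vn_space -> vn_space) ;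
  vn_bounded : vn_set `<=` bounded_op ;
  vn_id : vn_set idfun ;
  vn_linear : forall (k : R[i]) a b,
    vn_set a -> vn_set b -> vn_set (k *: a + b) ;
  vn_comp : forall a b, vn_set a -> vn_set b -> vn_set (a \o b) ;
  vn_adj : forall a, vn_set a -> exists2 b, vn_set b & adjoint a b ;
  vn_bicommutant : commutant (commutant vn_set) = vn_set
}.

Section Elements.
Context {R : realType}.

Definition vn_pred (M : vnAlgebra R) : {pred vn_space M -> vn_space M} :=
  fun a => `[< vn_set a >].
Arguments vn_pred : clear implicits.

Record vn_elt (M : vnAlgebra R) := VNElt {
  vn_op :> vn_space M -> vn_space M ;
  vn_opP : vn_op \in vn_pred M
}.

Variable M : vnAlgebra R.

Lemma vn_predP a : reflect (vn_set a) (a \in vn_pred M).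
Proof. exact: asboolP. Qed.

Lemma vn_submod_closed : submod_closed (vn_pred M).
Proof.
split=> [|k a b /vn_predP Ma /vn_predP Mb]; apply/vn_predP; last exact: vn_linear.
have := vn_linear (-1) (vn_id M) (vn_id M).
by rewrite scaleN1r addNr.
Qed.

HB.instance Definition _ :=
  GRing.isSubmodClosed.Build R[i] _ (vn_pred M) vn_submod_closed.
HB.instance Definition _ := [isSub for @vn_op M].
HB.instance Definition _ := [Choice of vn_elt M by <:].
HB.instance Definition _ := [SubChoice_isSubLmodule of vn_elt M by <:].

Lemma vn_mul_subproof (x y : vn_elt M) : vn_op x \o vn_op y \in vn_pred M.
Proof.
by apply/vn_predP/vn_comp; apply/vn_predP; apply: vn_opP.
Qed.

Definition vn_mul (x y : vn_elt M) : vn_elt M := VNElt (vn_mul_subproof x y).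

Lemma vn_one_subproof : idfun \in vn_pred M.
Proof. exact/vn_predP/vn_id. Qed.

Definition vn_one : vn_elt M := VNElt vn_one_subproof.

Lemma vn_star_subproof (x : vn_elt M) : exists y : vn_elt M, adjoint x y.
Proof.
have /vn_predP/vn_adj[b /vn_predP Mb xb] := vn_opP x.
by exists (VNElt Mb).
Qed.

Definition vn_star (x : vn_elt M) : vn_elt M := projT1 (cid (vn_star_subproof x)).

End Elements.

Coercion vn_elt : vnAlgebra >-> Sortclass.

Notation "x ^\*" := (vn_star x) (at level 2, format "x ^\*") : ring_scope.
Notation "x *v y" := (vn_mul x y) (at level 40, left associativity) : ring_scope.

(* Haagerup's axioms for a standard form (N, L^2(N), J, P).  N need not act on
   L^2(N) to begin with: [sf_rep] is a faithful representation of N whose range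
   is a von Neumann algebra, hence an isomorphism of von Neumann algebras. *)
Record standardForm (R : realType) (N : vnAlgebra R) := StandardForm {
  sf_space :> hilbertType R ;
  sf_rep : N -> sf_space -> sf_space ;
  sf_J : sf_space -> sf_space ;
  sf_cone : set sf_space ;
  sf_rep_bounded : forall x, bounded_op (sf_rep x) ;
  sf_rep_linear : linear sf_rep ;
  sf_rep_one : sf_rep (vn_one N) = idfun ;
  sf_rep_mul : forall x y, sf_rep (x *v y) = sf_rep x \o sf_rep y ;
  sf_rep_star : forall x, adjoint (sf_rep x) (sf_rep x^\*) ;
  sf_rep_inj : injective sf_rep ;
  sf_rep_bicommutant : commutant (commutant (range sf_rep)) = range sf_rep ;
  sf_J_antilinear : forall (k : R[i]) u v,
    sf_J (k *: u + v) = (Num.conj k) *: sf_J u + sf_J v ;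
  sf_J_invol : involutive sf_J ;
  sf_J_antiunitary : forall u v, '[sf_J u, sf_J v] = '[v, u] ;
  sf_cone_selfdual :
    sf_cone = [set u | forall v, sf_cone v -> 0 <= '[u, v]] ;
  sf_J_commutant :
    [set sf_J \o a \o sf_J | a in range sf_rep] = commutant (range sf_rep) ;
  sf_J_center : forall z : N, (forall x : N, z *v x = x *v z) ->
    sf_J \o sf_rep z \o sf_J = sf_rep z^\* ;
  sf_J_cone : forall u, sf_cone u -> sf_J u = u ;
  sf_rep_cone : forall (x : N) u,
    sf_cone u -> sf_cone (sf_rep x (sf_J (sf_rep x (sf_J u))))
}.

Section CompletelyPositive.
Context {R : realType}.

Definition vn_pos (M : vnAlgebra R) (x : M) := pos_op (vn_op x).

(* Positivity in M_n(M), acting on the n-fold direct sum of [vn_space M] *)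
Definition mx_pos (M : vnAlgebra R) n (a : 'M[M]_n) :=
  forall xi : 'I_n -> vn_space M,
    0 <= \sum_(i < n) \sum_(j < n) '[a i j (xi j), xi i].

Definition CP (M N : vnAlgebra R) : set (M -> N) :=
  [set Phi | linear Phi /\
     forall n (a : 'M[M]_n), mx_pos a -> mx_pos (map_mx Phi a)].

Definition cp_le (M N : vnAlgebra R) (Phi Psi : M -> N) := CP (Psi - Phi).

(* Convergence for the topology given by the functionals
   x |-> \sum_k '[x (xi k), eta k] with xi, eta square-summable *)
Definition ultraweak_cvg (N : vnAlgebra R) (a : nat -> N) (b : N) :=
  forall xi eta : nat -> vn_space N,
    cvgn (series (fun k => `|xi k| ^+ 2)) ->
    cvgn (series (fun k => `|eta k| ^+ 2)) ->
    limn (series (fun k => '[a n (xi k), eta k])) @[n --> \oo]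
      --> limn (series (fun k => '[b (xi k), eta k])).

Definition cp_decreases_to (M N : vnAlgebra R)
    (Phi_ : nat -> M -> N) (Phi : M -> N) :=
  (forall n, cp_le (Phi_ n.+1) (Phi_ n)) /\
  forall x : M, vn_pos x -> ultraweak_cvg (fun n => Phi_ n x) (Phi x).

End CompletelyPositive.

(* U (.) V is realised inside the dual of the space of bilinear forms on U x V
   (which is the dual of U (.) V): u (x) v is evaluation at (u, v), and U (.) V
   is the span of these evaluations. *)
Section Tensor.
Context {K : fieldType} {U V : lmodType K}.

Definition bilinear_form := {bilinear U -> V -> K | *%R & *%R}.

Definition eval_at (u : U) (v : V) : bilinear_form -> K^o := fun b => b u v.

Definition tensor_pred : {pred bilinear_form -> K^o} :=
  fun f => `[< exists n (u : 'I_n -> U) (v : 'I_n -> V),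
                 f = \sum_(i < n) eval_at (u i) (v i) >].

Record tensor := Tensor {
  tensor_val : bilinear_form -> K^o ;
  tensorP : tensor_val \in tensor_pred
}.

Lemma tensor_submod_closed : submod_closed tensor_pred.
Proof.
split=> [|k f g].
  apply/asboolP; exists 0%N, (fun=> 0), (fun=> 0); by rewrite big_ord0.
move=> /asboolP[m [u [v ->]]] /asboolP[n [u' [v' ->]]]; apply/asboolP.
exists (m + n)%N,
  (fun i => match fintype.split i with inl j => k *: u j | inr j => u' j end),
  (fun i => match fintype.split i with inl j => v j | inr j => v' j end).
rewrite big_split_ord/= scaler_sumr; congr (_ + _); apply: eq_bigr => i _.
  apply/funext => b; rewrite (unsplitK (inl i : 'I_m + 'I_n)) /eval_at.
  by rewrite linearZl_LR.
by rewrite (unsplitK (inr i : 'I_m + 'I_n)).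
Qed.

HB.instance Definition _ :=
  GRing.isSubmodClosed.Build K _ tensor_pred tensor_submod_closed.
HB.instance Definition _ := [isSub for tensor_val].
HB.instance Definition _ := [Choice of tensor by <:].
HB.instance Definition _ := [SubChoice_isSubLmodule of tensor by <:].

Lemma pure_subproof u v : eval_at u v \in tensor_pred.
Proof.
by apply/asboolP; exists 1%N, (fun=> u), (fun=> v); rewrite big_ord1.
Qed.

Definition pure (u : U) (v : V) : tensor := Tensor (pure_subproof u v).

End Tensor.

Arguments tensor {K} U V.

Notation "U ⊙ V" := (tensor U V) (at level 40, left associativity) : type_scope.
Notation "u ⊗ v" := (pure u v) (at level 40, left associativity) : ring_scope.

Section Forms.
Context {R : realType} {V : lmodType R[i]}.
Implicit Types alpha beta gamma s : V -> V -> R[i].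

Definition pos_form : set (V -> V -> R[i]) :=
  [set s | [/\ forall y, linear_for *%R (s ^~ y),
               forall x, linear_for (Num.conj \; *%R) (s x)
             & forall x, 0 <= s x x]].

Record compat_rep alpha beta := CompatRep {
  cr_space : hilbertType R ;
  cr_map : {linear V -> cr_space} ;
  cr_A : cr_space -> cr_space ;
  cr_B : cr_space -> cr_space ;
  cr_dense : dense (range cr_map) ;
  cr_posA : pos_op cr_A ;
  cr_posB : pos_op cr_B ;
  cr_commute : cr_A \o cr_B = cr_B \o cr_A ;
  cr_alphaE : forall x y, alpha x y = '[cr_A (cr_map x), cr_map y] ;
  cr_betaE : forall x y, beta x y = '[cr_B (cr_map x), cr_map y]
}.

Arguments cr_map {alpha beta} c.
Arguments cr_A {alpha beta} c.
Arguments cr_B {alpha beta} c.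

(* f(A, B) for f(r, s) = sqrt (r * s) is the positive square root of A \o B. *)
Definition is_form_gmean alpha beta gamma :=
  exists (r : compat_rep alpha beta) (c : cr_space r -> cr_space r),
    sqrt_op (cr_A r \o cr_B r) c /\
    forall x y, gamma x y = '[c (cr_map r x), cr_map r y].

Definition form_gmean alpha beta : V -> V -> R[i] :=
  xget (fun _ _ => 0) [set gamma | is_form_gmean alpha beta gamma].

End Forms.

Section CPMean.
Context {R : realType} {M N : vnAlgebra R} (L2N : standardForm N).
Implicit Types Phi Psi : M -> N.

Definition is_cp_form Phi (s : M ⊙ L2N -> M ⊙ L2N -> R[i]) :=
  pos_form s /\ forall (x y : M) (xi eta : L2N),
    s (x ⊗ xi) (y ⊗ eta) = '[sf_rep (Phi (y^\* *v x)) xi, eta].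

Definition cp_form Phi : M ⊙ L2N -> M ⊙ L2N -> R[i] :=
  xget (fun _ _ => 0) [set s | is_cp_form Phi s].

Definition is_cp_gmean Phi Psi (G : M -> N) :=
  CP G /\ forall (x y : M) (xi eta : L2N),
    '[sf_rep (G (y^\* *v x)) xi, eta] =
    form_gmean (cp_form Phi) (cp_form Psi) (x ⊗ xi) (y ⊗ eta).

Definition cp_gmean Phi Psi : M -> N :=
  xget (fun _ => 0) [set G | is_cp_gmean Phi Psi G].

End CPMean.

(* Main.v *)
Require Import Defs.
From HB Require Import structures.
From mathcomp Require Import all_boot all_order all_algebra.
From mathcomp Require Import sesquilinear complex ring lra.
From mathcomp Require Import all_classical all_reals all_analysis.

Set Implicit Arguments.
Unset Strict Implicit.
Unset Printing Implicit Defensive.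

Import Order.TTheory GRing.Theory Num.Theory.
Import numFieldNormedType.Exports.

Local Open Scope classical_set_scope.
Local Open Scope ring_scope.
Local Open Scope complex_scope.

(** The geometric mean of positive forms is characterized variationally: among
    the positive forms [de] for which the block form
    [al x x + de x y + de y x + be y y] is nonnegative, [form_gmean al be] is
    the largest.  The statement about CP maps follows from this because all of
    its parts compare a mean with another positive form, and the block
    condition is stable under every operation involved.

    For the characterization, fix a compatible representation with commuting
    positive [A], [B].  Positive square roots are unique, so the root of
    [A \o B] is [a \o b] for the commuting roots [a], [b] of [A], [B]; the
    block form of the mean is then [nrm (a (h x) + b (h y)) ^+ 2], which is
    nonnegative.  Conversely, a form [de] with nonnegative block satisfies
    [nrm (de x y) <= nrm (a (h x)) * nrm (b (h y))], hence is given by an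
    operator [D], and after making [b] invertible the operators
    [X = b^-1 D b^-1] and [Y = a b^-1] satisfy [nrm (X w) <= nrm (Y w)] with [X]
    hermitian and [Y] positive.  This forces [X <= Y] ([hermitian_le]), that is
    [D <= a b] ([commuting_max], [form_gmean_max]).

    Means of CP maps exist because, by maximality, the mean of two forms is
    invariant under every linear automorphism that preserves both of them.  The
    unitaries of [M] and of the commutant of [N] act on [M ⊙ L2N] by such
    automorphisms and span these algebras, so the mean form of [cp_form Phi] and
    [cp_form Psi] is a bimodule form; Riesz representation and the bicommutant
    property turn it into a map [M -> N] ([cp_gmean_ex]).  Complete positivity
    is read off from the form because a positive matrix over a von Neumann
    algebra is of the form [c^* c] ([matrix_sqrt]); the same fact shows that
    positivity of a matrix over [N] can be tested in any standard form
    ([rep_mx_posP]).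

    The four parts are then as follows.  Monotonicity: enlarging [al] and [be]
    preserves the block condition.  Composition with [Xi] on the left: the block
    condition says that a 2n x 2n matrix over [N] is positive, and [Xi] preserves
    this.  Composition on the right: [Xi] maps the Gram matrix [z_i^* z_j] to a
    positive matrix, which is a sum of Gram matrices.  Decreasing sequences: the
    forms of the means decrease to a positive form that inherits the block
    condition in the limit, hence lies below the form of the mean of the limits;
    it lies above it by monotonicity.  Passing between the convergence on
    [vn_space N] and on the standard form uses that an order isomorphism of von
    Neumann algebras respects infima of decreasing sequences
    ([order_iso_normal]). *)

(** * Complex scalars and real-valued norms *)

Section Scalars.
Context {R : realType}.
Local Notation C := R[i].
Implicit Types (z w : C) (r : R).

(** Norms over [R[i]] are complex numbers; the order of [R] is total, so that
    estimates are made with this real-valued version. *)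
Definition nrm (V : normedZmodType C) (u : V) : R := complex.Re `|u|.

Lemma ge0_ReE z : 0 <= z -> z = (complex.Re z)%:C.
Proof. by case: z => a b; rewrite lecE /= => /andP[/eqP-> _]. Qed.

Lemma ge0C z : 0 <= z <-> complex.Im z = 0 /\ 0 <= complex.Re z.
Proof. by rewrite lecE /=; split=> [/andP[/eqP-> ->]|[-> ->]]; rewrite ?eqxx. Qed.

Lemma leCE z w : (z <= w) <-> complex.Im z = complex.Im w /\ complex.Re z <= complex.Re w.
Proof. by rewrite lecE; split=> [/andP[/eqP-> ->]|[-> ->]]; rewrite ?eqxx. Qed.

Lemma Cext z w : complex.Re z = complex.Re w -> complex.Im z = complex.Im w -> z = w.
Proof. by case: z w => a b [c d] /= -> ->. Qed.

Lemma ReD z w : complex.Re (z + w) = complex.Re z + complex.Re w.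
Proof. by case: z w => a b []. Qed.
Lemma ImD z w : complex.Im (z + w) = complex.Im z + complex.Im w.
Proof. by case: z w => a b []. Qed.
Lemma ReN z : complex.Re (- z) = - complex.Re z. Proof. by case: z. Qed.
Lemma ImN z : complex.Im (- z) = - complex.Im z. Proof. by case: z. Qed.
Lemma Re_mul z w : complex.Re (z * w) =
  complex.Re z * complex.Re w - complex.Im z * complex.Im w.
Proof. by case: z w => a b []. Qed.
Lemma Im_mul z w : complex.Im (z * w) =
  complex.Re z * complex.Im w + complex.Im z * complex.Re w.
Proof. by case: z w => a b []. Qed.
Lemma ReJ z : complex.Re (Num.conj z) = complex.Re z. Proof. by case: z. Qed.
Lemma ImJ z : complex.Im (Num.conj z) = - complex.Im z. Proof. by case: z. Qed.
Lemma conjr r : Num.conj r%:C = r%:C.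
Proof. by apply: Cext; rewrite ?ReJ ?ImJ //= oppr0. Qed.
Lemma conjNr r : Num.conj (- r%:C) = - r%:C.
Proof. by apply: Cext; rewrite ?ReJ ?ImJ //= ?oppr0. Qed.
Definition ReImE := (ReD, ImD, ReN, ImN, Re_mul, Im_mul, ReJ, ImJ).

Lemma Re_sum I (s : seq I) (P : pred I) (F : I -> C) :
  complex.Re (\sum_(i <- s | P i) F i) = \sum_(i <- s | P i) complex.Re (F i).
Proof. by elim/big_rec2: _ => //= i x y _ <-; rewrite ReD. Qed.

Section Nrm.
Variable V : normedZmodType C.
Implicit Types u v : V.

Lemma nrmE u : `|u| = (nrm u)%:C. Proof. exact/ge0_ReE/normr_ge0. Qed.
Lemma nrm_ge0 u : 0 <= nrm u.
Proof. by have := normr_ge0 u; rewrite nrmE ler0c. Qed.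
Lemma nrmD u v : nrm (u + v) <= nrm u + nrm v.
Proof. by have := ler_normD u v; rewrite !nrmE -rmorphD /= lecR. Qed.
Lemma nrmN u : nrm (- u) = nrm u. Proof. by rewrite /nrm normrN. Qed.
Lemma nrmB u v : nrm (u - v) = nrm (v - u). Proof. by rewrite -nrmN opprB. Qed.
Lemma nrm0 : nrm (0 : V) = 0. Proof. by rewrite /nrm normr0. Qed.
Lemma nrm_eq0 u : nrm u = 0 -> u = 0.
Proof. by move=> h; apply/normr0_eq0; rewrite nrmE h. Qed.
Lemma nrm_dist (x u v : V) : nrm (u - v) <= nrm (u - x) + nrm (v - x).
Proof. by rewrite [nrm (v - x)]nrmB (le_trans _ (nrmD _ _))// addrA subrK. Qed.
Lemma nrm_ler u v : nrm u <= nrm v + nrm (u - v).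
Proof. by rewrite (le_trans _ (nrmD _ _))// addrC subrK. Qed.
End Nrm.

Lemma nrmZ (V : normedModType C) (c : C) (u : V) : nrm (c *: u) = nrm c * nrm u.
Proof. by rewrite {1}/nrm normrZ (nrmE c) (nrmE u) /= mul0r subr0. Qed.
Lemma nrmM z w : nrm (z * w) = nrm z * nrm w.
Proof. by rewrite {1}/nrm normrM (nrmE z) (nrmE w) /= mul0r subr0. Qed.
Lemma nrmJ z : nrm (Num.conj z) = nrm z.
Proof. by rewrite /nrm normcJ. Qed.
Lemma nrm_sqr z : nrm z ^+ 2 = complex.Re z ^+ 2 + complex.Im z ^+ 2.
Proof. by rewrite /nrm normc_def /= sqr_sqrtr // addr_ge0 // sqr_ge0. Qed.
Lemma nrm_real r : nrm r%:C = `|r|.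
Proof. by rewrite /nrm normc_def /= expr0n addr0 sqrtr_sqr. Qed.
Lemma Re_le_nrm z : `|complex.Re z| <= nrm z.
Proof.
by rewrite -(ler_pXn2r (_ : 0 < 2)%N) ?nnegrE ?nrm_ge0// nrm_sqr real_normK ?num_real// lerDl sqr_ge0.
Qed.
Lemma Im_le_nrm z : `|complex.Im z| <= nrm z.
Proof.
by rewrite -(ler_pXn2r (_ : 0 < 2)%N) ?nnegrE ?nrm_ge0// nrm_sqr real_normK ?num_real// lerDr sqr_ge0.
Qed.
Lemma nrm_le_ReIm z : nrm z <= `|complex.Re z| + `|complex.Im z|.
Proof.
rewrite -(ler_pXn2r (_ : 0 < 2)%N) ?nnegrE ?nrm_ge0 ?addr_ge0// nrm_sqr.
by rewrite sqrrD !real_normK ?num_real// lerD2r lerDl mulrn_wge0 // mulr_ge0.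
Qed.
Lemma mulcJ z : z * Num.conj z = (nrm z ^+ 2)%:C.
Proof. by apply: Cext; rewrite !ReImE ?nrm_sqr /=; ring. Qed.

End Scalars.

Section Conv.
Context {R : realType}.
Local Notation C := R[i].

(** Convergence is measured by the real-valued norm, so that limits of scalars
    need no topology on [R[i]] and estimates reduce to sequences in [R]. *)
Definition ncvg (V : normedZmodType C) (u : nat -> V) (l : V) :=
  (fun n => nrm (u n - l)) @ \oo --> (0 : R).

Definition cauchy_seq (V : normedZmodType C) (u : nat -> V) :=
  forall e : R, 0 < e -> exists N, forall n m, (N <= n)%N -> (N <= m)%N -> nrm (u n - u m) < e.

Lemma squeeze_cvg0 (a b : nat -> R) : (forall n, 0 <= a n <= b n) ->
  b @ \oo --> (0 : R) -> a @ \oo --> (0 : R).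
Proof.
move=> ab b0; apply: (@squeeze_cvgr _ _ _ _ (fun=> 0) b) => //; last exact: cvg_cst.
by apply: nearW.
Qed.

Section NormedZmodule.
Variable V : normedZmodType C.
Implicit Types (u v : nat -> V) (l : V).

Lemma ncvg_le u l (b : nat -> R) : (forall n, nrm (u n - l) <= b n) ->
  b @ \oo --> (0 : R) -> ncvg u l.
Proof. by move=> h; apply: squeeze_cvg0 => n; rewrite nrm_ge0 h. Qed.

Lemma ncvgP u l : ncvg u l <->
  forall e : R, 0 < e -> exists N, forall n, (N <= n)%N -> nrm (u n - l) < e.
Proof.
split=> [/cvgrPdist_lt h e /h [N _ hN]|h].
  by exists N => n /hN; rewrite /= sub0r normrN ger0_norm ?nrm_ge0.
apply/cvgrPdist_lt => e /h [N hN]; exists N => // n /hN /=.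
by rewrite sub0r normrN ger0_norm ?nrm_ge0.
Qed.

Lemma ncvg_cst l : ncvg (fun=> l) l.
Proof. by rewrite /ncvg subrr nrm0; exact: cvg_cst. Qed.

Lemma ncvgD u v l k : ncvg u l -> ncvg v k -> ncvg (fun n => u n + v n) (l + k).
Proof.
move=> ul vk; apply: (ncvg_le (b := fun n => nrm (u n - l) + nrm (v n - k))).
  by move=> n; rewrite opprD addrACA nrmD.
by rewrite -[0]addr0; apply: cvgD.
Qed.

Lemma ncvgN u l : ncvg u l -> ncvg (fun n => - u n) (- l).
Proof. by move=> ul; apply: (ncvg_le _ ul) => n; rewrite -opprD nrmN. Qed.

Lemma ncvgB u v l k : ncvg u l -> ncvg v k -> ncvg (fun n => u n - v n) (l - k).
Proof. by move=> ul vk; apply: ncvgD => //; apply: ncvgN. Qed.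

Lemma ncvg_sum I (s : seq I) (u : I -> nat -> V) (l : I -> V) :
  (forall i, ncvg (u i) (l i)) -> ncvg (fun n => \sum_(i <- s) u i n) (\sum_(i <- s) l i).
Proof.
move=> h; elim: s => [|i s IH].
  by rewrite big_nil; under eq_fun do rewrite big_nil; exact: ncvg_cst.
by rewrite big_cons; under eq_fun do rewrite big_cons; apply: ncvgD.
Qed.

Lemma ncvg_uniq u l k : ncvg u l -> ncvg u k -> l = k.
Proof.
move=> ul uk; apply/eqP; rewrite -subr_eq0; apply/eqP/nrm_eq0.
have h : (fun=> nrm (l - k)) @ \oo --> (0 : R).
  apply: (squeeze_cvg0 (b := fun n => nrm (u n - l) + nrm (u n - k))).
    by move=> n; rewrite nrm_ge0 (nrmB (u n) l) (nrmB (u n) k) nrm_dist.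
  by rewrite -[0]addr0; apply: cvgD.
by apply: (cvg_unique _ _ h) => //; exact: cvg_cst.
Qed.

Lemma ncvg_eq u v l : u =1 v -> ncvg u l -> ncvg v l.
Proof. by move=> /funext ->. Qed.

Lemma ncvg_shift u l m : ncvg u l -> ncvg (fun n => u (n + m)%N) l.
Proof.
move=> /ncvgP h; apply/ncvgP => e /h[N hN]; exists N => n Nn; apply: hN.
by rewrite (leq_trans Nn)// leq_addr.
Qed.

Lemma ncvg_bounded u l : ncvg u l -> exists2 K : R, 0 <= K & forall n, nrm (u n) <= K.
Proof.
move=> /ncvgP/(_ 1 ltr01)[N hN].
exists (\sum_(i < N) nrm (u i) + (nrm l + 1)).
  by rewrite addr_ge0 ?sumr_ge0 ?addr_ge0 ?nrm_ge0// => i _; rewrite nrm_ge0.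
move=> n; case: (ltnP n N) => nN.
  rewrite (bigD1 (Ordinal nN)) //= -addrA lerDl addr_ge0 ?addr_ge0 ?nrm_ge0//.
  by apply: sumr_ge0 => i _; rewrite nrm_ge0.
apply: (@le_trans _ _ (nrm l + 1)).
  by apply: le_trans (nrm_ler _ l) _; rewrite lerD2l ltW// hN.
by rewrite lerDr sumr_ge0// => i _; rewrite nrm_ge0.
Qed.

End NormedZmodule.

Lemma ncvg_Re (u : nat -> C) l : ncvg u l ->
  (fun n => complex.Re (u n)) @ \oo --> complex.Re l.
Proof.
move=> ul; apply/cvgrPdist_lt => e e0; have /ncvgP/(_ e e0)[N hN] := ul.
exists N => // n /hN /=; rewrite -normrN opprB; apply: le_lt_trans.
by rewrite -ReN -ReD Re_le_nrm.
Qed.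

Lemma ncvg_Im (u : nat -> C) l : ncvg u l ->
  (fun n => complex.Im (u n)) @ \oo --> complex.Im l.
Proof.
move=> ul; apply/cvgrPdist_lt => e e0; have /ncvgP/(_ e e0)[N hN] := ul.
exists N => // n /hN /=; rewrite -normrN opprB; apply: le_lt_trans.
by rewrite -ImN -ImD Im_le_nrm.
Qed.

Lemma cvg_dist0 (f : nat -> R) (a : R) : f @ \oo --> a ->
  (fun n => `|f n - a|) @ \oo --> (0 : R).
Proof.
move=> fa; have h : (fun n => f n - a) @ \oo --> a - a.
  by apply: cvgB => //; exact: cvg_cst.
by have := cvg_norm h; rewrite subrr normr0; apply.
Qed.

Lemma ncvg_ReIm (u : nat -> C) l : 
  (fun n => complex.Re (u n)) @ \oo --> complex.Re l ->
  (fun n => complex.Im (u n)) @ \oo --> complex.Im l -> ncvg u l.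
Proof.
move=> h1 h2.
apply: (ncvg_le (b := fun n => `|complex.Re (u n) - complex.Re l| + `|complex.Im (u n) - complex.Im l|)).
  by move=> n; rewrite -ReN -ImN -ReD -ImD nrm_le_ReIm.
by rewrite -[0]addr0; apply: cvgD; exact: cvg_dist0.
Qed.

Lemma ncvg_ge0 (u : nat -> C) l : (forall n, 0 <= u n) -> ncvg u l -> 0 <= l.
Proof.
move=> h ul; apply/ge0C; split.
  apply: (cvg_unique _ (ncvg_Im ul)) => //.
  have -> : (fun n => complex.Im (u n)) = cst 0.
    by apply/funext => n; have /ge0C[] := h n.
  exact: cvg_cst.
have c := ncvg_Re ul; rewrite -(cvg_lim _ c)//; apply: limr_ge; first by apply/cvg_ex; eexists; exact: c.
by apply: nearW => n; have /ge0C[] := h n.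
Qed.

Lemma ncvgZ (V : normedModType C) (u : nat -> V) l (c : C) :
  ncvg u l -> ncvg (fun n => c *: u n) (c *: l).
Proof.
move=> ul; apply: (ncvg_le (b := fun n => nrm c * nrm (u n - l))).
  by move=> n; rewrite -scalerBr nrmZ.
by rewrite -(mulr0 (nrm c)); apply: cvgMr.
Qed.

Lemma ncvgMl (u : nat -> C) l (c : C) : ncvg u l -> ncvg (fun n => c * u n) (c * l).
Proof.
move=> ul; apply: (ncvg_le (b := fun n => nrm c * nrm (u n - l))).
  by move=> n; rewrite -mulrBr nrmM.
by rewrite -(mulr0 (nrm c)); apply: cvgMr.
Qed.

Lemma cvg_inv_succ : (fun n : nat => (n.+1%:R : R)^-1) @ \oo --> (0 : R).
Proof. exact: cvg_harmonic. Qed.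

End Conv.

(** * Sesquilinear and positive forms *)

Section LinearFor.
Context {K : pzRingType} {U : lmodType K} {W : zmodType}.
Variables (s : GRing.Scale.law K W) (f : U -> W).
Hypothesis lf : linear_for s f.

Lemma linB : {morph f : x y / x - y}. Proof. exact: zmod_morphism_linear. Qed.
Lemma linZ c u : f (c *: u) = s c (f u). Proof. exact: scalable_linear. Qed.
Lemma lin0 : f 0 = 0. Proof. by have := linB 0 0; rewrite !subrr. Qed.
Lemma linN : {morph f : x / - x}.
Proof. by move=> x; have := linB 0 x; rewrite lin0 !sub0r. Qed.
Lemma linD : {morph f : x y / x + y}.
Proof. by move=> x y; have := linB x (- y); rewrite linN !opprK. Qed.
Lemma lin_sum I (r : seq I) (P : pred I) (F : I -> U) :
  f (\sum_(i <- r | P i) F i) = \sum_(i <- r | P i) f (F i).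
Proof. exact: (big_morph f linD lin0). Qed.
End LinearFor.

Definition imag {R : realType} : R[i] := Complex 0 1.
Lemma imag_sqr {R : realType} : imag * imag = -1 :> R[i].
Proof. by rewrite -expr2 sqr_i. Qed.
Lemma conj_imag {R : realType} : Num.conj (imag : R[i]) = - imag.
Proof. by apply: Cext; rewrite !ReImE /= ?oppr0. Qed.

Section Sesquilinear.
Context {R : realType} {V : lmodType R[i]}.
Local Notation C := R[i].
Implicit Types (s : V -> V -> C).

Definition sesq s := (forall y, linear_for *%R (s ^~ y)) /\
  (forall x, linear_for (Num.conj \; *%R) (s x)).

Section Rules.
Variable s : V -> V -> C.
Hypothesis hs : sesq s.
Lemma sesqDl x y z : s (x + y) z = s x z + s y z.
Proof. exact: (linD (hs.1 z)). Qed.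
Lemma sesqBl x y z : s (x - y) z = s x z - s y z.
Proof. exact: (linB (hs.1 z)). Qed.
Lemma sesqNl x z : s (- x) z = - s x z. Proof. exact: (linN (hs.1 z)). Qed.
Lemma sesqZl c x z : s (c *: x) z = c * s x z.
Proof. exact: (linZ (hs.1 z)). Qed.
Lemma sesq0l z : s 0 z = 0. Proof. exact: (lin0 (hs.1 z)). Qed.
Lemma sesqDr x y z : s x (y + z) = s x y + s x z.
Proof. exact: (linD (hs.2 x)). Qed.
Lemma sesqBr x y z : s x (y - z) = s x y - s x z.
Proof. exact: (linB (hs.2 x)). Qed.
Lemma sesqNr x z : s x (- z) = - s x z. Proof. exact: (linN (hs.2 x)). Qed.
Lemma sesqZr c x z : s x (c *: z) = Num.conj c * s x z.
Proof. exact: (linZ (hs.2 x)). Qed.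
Lemma sesq0r z : s z 0 = 0. Proof. exact: (lin0 (hs.2 z)). Qed.
Lemma sesq_suml I (r : seq I) (P : pred I) (F : I -> V) z :
  s (\sum_(i <- r | P i) F i) z = \sum_(i <- r | P i) s (F i) z.
Proof. exact: (lin_sum (hs.1 z)). Qed.
Lemma sesq_sumr I (r : seq I) (P : pred I) (F : I -> V) z :
  s z (\sum_(i <- r | P i) F i) = \sum_(i <- r | P i) s z (F i).
Proof. exact: (lin_sum (hs.2 z)). Qed.

(** Over the complex numbers a sesquilinear form is determined by its diagonal;
    equality, convergence and invariance of forms are therefore only checked
    there. *)
Lemma polarization x y : 4%:R * s x y =
  s (x + y) (x + y) - s (x - y) (x - y)
  + imag * (s (x + imag *: y) (x + imag *: y) - s (x - imag *: y) (x - imag *: y)).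
Proof.
rewrite !(sesqDl, sesqDr, sesqBl, sesqBr, sesqZl, sesqZr, sesqNl, sesqNr) conj_imag.
have i2 := @imag_sqr R.
move: (s x x) (s x y) (s y x) (s y y) imag i2 => a b c d j i2.
transitivity (4%:R * b + (1 + j * j) * (2%:R * (c - b))).
  by rewrite i2 subrr mul0r addr0.
ring.
Qed.

End Rules.

Lemma sesq_ext s t : sesq s -> sesq t -> (forall x, s x x = t x x) -> s =2 t.
Proof.
move=> hs ht st x y; apply: (@mulfI _ 4%:R); first by rewrite pnatr_eq0.
by rewrite (polarization hs) (polarization ht) !st.
Qed.

Lemma pos_form_sesq s : pos_form s -> sesq s. Proof. by case. Qed.
Lemma pos_form_ge0 s x : pos_form s -> 0 <= s x x. Proof. by case. Qed.

(** Complex polarization: the diagonal values at [x + y] and [x + i y] are real,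
    which is exactly hermitian symmetry of the off-diagonal values. *)
Lemma pos_form_herm s x y : pos_form s -> s y x = Num.conj (s x y).
Proof.
move=> ps; have hs := pos_form_sesq ps.
have r z : complex.Im (s z z) = 0 by have /ge0C[] := pos_form_ge0 z ps.
have h1 := r (x + y); have h2 := r (x + imag *: y).
move: h1 h2; rewrite !(sesqDl hs, sesqDr hs, sesqZl hs, sesqZr hs) !ReImE /= !r.
move=> h1 h2; apply: Cext; rewrite !ReImE; lra.
Qed.

(** Positivity of the 2 x 2 block of forms with diagonal [al], [be] and
    off-diagonal entry [de]. *)
Definition block_pos (al de be : V -> V -> C) := forall x y,
  0 <= al x x + de x y + de y x + be y y.

End Sesquilinear.

Section CauchySchwarz.
Context {R : realType} {V : lmodType R[i]}.
Local Notation C := R[i].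

(** Choose [c = t * conj z] with [t] real: the result is the discriminant
    inequality for the quadratic polynomial in [t]. *)
Lemma quad_bound (p q : R) (z : C) : 0 <= p -> 0 <= q ->
  (forall c : C, 0 <= p + 2 * complex.Re (c * z) + nrm c ^+ 2 * q) ->
  nrm z ^+ 2 <= p * q.
Proof.
move=> p0 q0 h.
have {}h t : 0 <= p + 2 * t * nrm z ^+ 2 + t ^+ 2 * nrm z ^+ 2 * q.
  have := h (t%:C * Num.conj z).
  rewrite nrmM nrmJ nrm_real exprMn real_normK ?num_real// -mulrA (mulrC _ z) mulcJ.
  by rewrite -rmorphM /= mulrA.
have w0 : 0 <= nrm z ^+ 2 by rewrite sqr_ge0.
move: (nrm z ^+ 2) w0 h => w w0 h.
have [qe|qn] := eqVneq q 0.
  rewrite qe mulr0; rewrite leNgt; apply/negP => wp.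
  have := h (- (p + 1) / (2 * w)); rewrite qe mulr0 addr0.
  have -> : p + 2 * (- (p + 1) / (2 * w)) * w = - 1 by field; rewrite gt_eqF.
  by rewrite lerNr oppr0 ler10.
have qp : 0 < q by rewrite lt_def qn.
have := h (- q^-1).
have -> : p + 2 * - q^-1 * w + (- q^-1) ^+ 2 * w * q = (p * q - w) / q by field.
by rewrite pmulr_lge0 ?invr_gt0// subr_ge0.
Qed.

(** Replacing [y] by its scalar multiples in the block condition gives a
    nonnegative quadratic polynomial in the scalar. *)
Lemma block_CS (al de be : V -> V -> C) x y : pos_form al -> pos_form be ->
  sesq de -> (forall x y, de y x = Num.conj (de x y)) -> block_pos al de be ->
  nrm (de x y) ^+ 2 <= complex.Re (al x x) * complex.Re (be y y).
Proof.
move=> pa pb sd hd bp; apply: quad_bound.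
- by have /ge0C[] := pos_form_ge0 x pa.
- by have /ge0C[] := pos_form_ge0 y pb.
move=> c; have /ge0C[_] := bp x (Num.conj c *: y).
rewrite (sesqZr sd) (sesqZl sd) (sesqZl (pos_form_sesq pb)) (sesqZr (pos_form_sesq pb)).
rewrite (hd x y) conjCK -rmorphM mulrA (mulrC (Num.conj c) c) mulcJ.
by rewrite !ReImE /=; congr (_ <= _); ring.
Qed.

Lemma pos_form_block (s : V -> V -> C) : pos_form s -> block_pos s s s.
Proof.
move=> ps x y; have := pos_form_ge0 (x + y) ps.
have hs := pos_form_sesq ps.
by rewrite (sesqDl hs) !(sesqDr hs) !addrA.
Qed.

Lemma CS (s : V -> V -> C) x y : pos_form s ->
  nrm (s x y) ^+ 2 <= complex.Re (s x x) * complex.Re (s y y).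
Proof.
move=> ps; apply: block_CS => //; [exact: pos_form_sesq|move=> ? ?; exact: pos_form_herm|exact: pos_form_block].
Qed.

End CauchySchwarz.

Section HilbertBasics.
Context {R : realType} {H : hilbertType R}.
Local Notation C := R[i].
Implicit Types (u v w : H) (a b : H -> H).

Lemma dot_pos_form : pos_form (hdot : H -> H -> C).
Proof.
split=> [y c u v|x c u v|x]; first by rewrite linearPl.
  by rewrite linearPr.
by rewrite hdot_norm exprn_ge0.
Qed.

Lemma dot_sesq : sesq (hdot : H -> H -> C).
Proof. exact: pos_form_sesq dot_pos_form. Qed.

Lemma dotDl u v w : '[u + v, w] = '[u, w] + '[v, w].
Proof. exact: sesqDl dot_sesq _ _ _. Qed.
Lemma dotBl u v w : '[u - v, w] = '[u, w] - '[v, w].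
Proof. exact: sesqBl dot_sesq _ _ _. Qed.
Lemma dotNl u w : '[- u, w] = - '[u, w].
Proof. exact: sesqNl dot_sesq _ _. Qed.
Lemma dotZl c u w : '[c *: u, w] = c * '[u, w].
Proof. exact: sesqZl dot_sesq _ _ _. Qed.
Lemma dotDr u v w : '[u, v + w] = '[u, v] + '[u, w].
Proof. exact: sesqDr dot_sesq _ _ _. Qed.
Lemma dotBr u v w : '[u, v - w] = '[u, v] - '[u, w].
Proof. exact: sesqBr dot_sesq _ _ _. Qed.
Lemma dotNr u w : '[u, - w] = - '[u, w].
Proof. exact: sesqNr dot_sesq _ _. Qed.
Lemma dotZr c u w : '[u, c *: w] = Num.conj c * '[u, w].
Proof. exact: sesqZr dot_sesq _ _ _. Qed.
Lemma dot0l u : '[0, u] = 0. Proof. exact: sesq0l dot_sesq _. Qed.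
Lemma dot0r u : '[u, 0] = 0. Proof. exact: sesq0r dot_sesq _. Qed.
Lemma dot_suml I (r : seq I) (P : pred I) (F : I -> H) u :
  '[\sum_(i <- r | P i) F i, u] = \sum_(i <- r | P i) '[F i, u].
Proof. exact: sesq_suml dot_sesq _ _ _ _ _. Qed.
Lemma dot_sumr I (r : seq I) (P : pred I) (F : I -> H) u :
  '[u, \sum_(i <- r | P i) F i] = \sum_(i <- r | P i) '[u, F i].
Proof. exact: sesq_sumr dot_sesq _ _ _ _ _. Qed.

Lemma dotC u v : '[v, u] = Num.conj '[u, v].
Proof. exact: (pos_form_herm _ _ dot_pos_form). Qed.

Lemma dotE u : '[u, u] = (nrm u ^+ 2)%:C.
Proof. by rewrite hdot_norm nrmE rmorphXn. Qed.

Lemma dot_le u v : nrm '[u, v] <= nrm u * nrm v.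
Proof.
have := CS u v dot_pos_form; rewrite !dotE /= -exprMn.
by rewrite ler_pXn2r// nnegrE ?mulr_ge0 ?nrm_ge0.
Qed.

Lemma dot0_eq u v : (forall w, '[u, w] = '[v, w]) -> u = v.
Proof.
move=> h; apply/eqP; rewrite -subr_eq0; apply/eqP/nrm_eq0/eqP.
by rewrite -sqrf_eq0 -(inj_eq (@complexI R)) -dotE dotBl h subrr.
Qed.

Lemma dot0_eqr u v : (forall w, '[w, u] = '[w, v]) -> u = v.
Proof. by move=> h; apply: dot0_eq => w; rewrite dotC h -dotC. Qed.

Lemma nrm_sqrD u v : nrm (u + v) ^+ 2 = nrm u ^+ 2 + 2 * complex.Re '[u, v] + nrm v ^+ 2.
Proof.
apply: complexI; rewrite -dotE dotDl !dotDr !dotE (dotC u v).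
by apply: Cext; rewrite !ReImE /=; ring.
Qed.

Lemma nrm_sqrB u v : nrm (u - v) ^+ 2 = nrm u ^+ 2 - 2 * complex.Re '[u, v] + nrm v ^+ 2.
Proof. by rewrite nrm_sqrD dotNr ReN nrmN mulrN. Qed.

Lemma parallelogram u v :
  nrm (u + v) ^+ 2 + nrm (u - v) ^+ 2 = 2 * (nrm u ^+ 2 + nrm v ^+ 2).
Proof. by rewrite nrm_sqrD nrm_sqrB; ring. Qed.

Lemma ncvg_dot (u v : nat -> H) k l : ncvg u k -> ncvg v l ->
  ncvg (fun n => '[u n, v n]) '[k, l].
Proof.
move=> uk vl; have [K K0 hK] := ncvg_bounded vl.
apply: (ncvg_le (b := fun n => nrm (u n - k) * K + nrm k * nrm (v n - l))).
  move=> n; have -> : '[u n, v n] - '[k, l] = '[u n - k, v n] + '[k, v n - l].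
    by rewrite dotBl dotBr addrA subrK.
  apply: le_trans (nrmD _ _) _; apply: lerD; last exact: dot_le.
  by apply: le_trans (dot_le _ _) _; rewrite ler_wpM2l ?nrm_ge0.
rewrite -[0]addr0; apply: cvgD.
  by rewrite -(mul0r K); apply: cvgMl.
by rewrite -(mulr0 (nrm k)); apply: cvgMr.
Qed.

Lemma gt0C (e : C) : 0 < e -> exists2 r : R, 0 < r & e = r%:C.
Proof.
move=> e0; exists (complex.Re e); last exact/ge0_ReE/ltW.
by rewrite -ltcR -ge0_ReE ?ltW.
Qed.

Lemma cauchy_ncvg (u : nat -> H) : cauchy_seq u -> exists l, ncvg u l.
Proof.
move=> cu.
have /cvg_ex[l /cvgrPdist_lt ul] : cvg (u @ \oo).
  apply: cauchy_cvg; apply: cauchy_exP => e e0; have [r r0 eE] := gt0C e0; rewrite eE {e0 eE}.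
  have [N hN] := cu r r0; exists (u N); exists N => // n /= Nn.
  by rewrite -ball_normE /= nrmE ltcR hN.
exists l; apply/ncvgP => e e0; have [|N _ hN] := ul e%:C; first by rewrite ltcR.
by exists N => n /hN; rewrite nrmE ltcR nrmB.
Qed.

(** Density of the range, in the form used for limit arguments. *)
Lemma dense_seq (V : lmodType C) (h : {linear V -> H}) : dense (range h) ->
  forall u, exists x : nat -> V, ncvg (h \o x) u.
Proof.
move=> dh u.
have /choice[x hx] : forall n : nat, exists x, nrm (u - h x) < n.+1%:R^-1.
  move=> n; have e0 : 0 < (n.+1%:R^-1 : R)%:C by rewrite ltcR invr_gt0.
  have [|z [bu [x _ hx]]] := dh (ball u (n.+1%:R^-1 : R)%:C) _ (@ball_open _ _ _ _).
    by exists u; exact: ballxx.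
  by exists x; move: bu; rewrite -hx -ball_normE /= nrmE ltcR.
exists x; apply: ncvg_le cvg_inv_succ => n /=; rewrite nrmB; exact/ltW.
Qed.

(** Continuity of a linear operator, with a real bound. *)
Lemma bounded_opP a : bounded_op a <->
  linear a /\ exists2 K, 0 <= K & forall u, nrm (a u) <= K * nrm u.
Proof.
split=> -[la].
  move=> ca; split=> //.
  pose la' := GRing.isLinear.Build C H H *:%R a la.
  pose f : {linear H -> H} := HB.pack a la'.
  have /linear_boundedP : bounded_near f (nbhs (0 : H)) by apply/linear_bounded_continuous.
  move=> /pinfty_ex_gt0 [k k0 hk]; have [r r0 kE] := gt0C k0.
  exists r => [|u]; first exact: ltW.
  by have := hk u; rewrite kE !nrmE -rmorphM /= lecR.
move=> [K K0 hK]; split=> //.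
pose la' := GRing.isLinear.Build C H H *:%R a la.
pose f : {linear H -> H} := HB.pack a la'.
apply/(@linear_bounded_continuous _ _ _ f)/linear_boundedP.
exists K%:C; split; first by apply/complex_realP; exists K.
move=> r /ltW Kr u; rewrite nrmE; apply: le_trans (_ : (K * nrm u)%:C <= _).
  by rewrite lecR hK.
by rewrite rmorphM /= -nrmE ler_wpM2r.
Qed.

Lemma bounded_ncvg a (u : nat -> H) l : bounded_op a -> ncvg u l -> ncvg (a \o u) (a l).
Proof.
move=> /bounded_opP[la [K K0 hK]] ul.
apply: (ncvg_le (b := fun n => K * nrm (u n - l))).
  by move=> n /=; rewrite -(linB la) hK.
by rewrite -(mulr0 K); apply: cvgMr.
Qed.

End HilbertBasics.

(** * Riesz representation and operators given by forms *)

Section Riesz.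
Context {R : realType} {H : hilbertType R}.
Local Notation C := R[i].

Lemma cvg0_lt (f : nat -> R) (e : R) : f @ \oo --> (0 : R) -> 0 < e ->
  exists N, forall n, (N <= n)%N -> f n < e.
Proof.
move=> /cvgrPdist_lt h /h [N _ hN]; exists N => n /hN /=.
by rewrite sub0r normrN; apply: le_lt_trans; rewrite ler_norm.
Qed.

Lemma ncvg_nrm (V : normedZmodType C) (u : nat -> V) l : ncvg u l ->
  (fun n => nrm (u n)) @ \oo --> nrm l.
Proof.
move=> /ncvgP ul; apply/cvgrPdist_lt => e /ul[N hN]; exists N => // n /hN /=.
apply: le_lt_trans; rewrite ler_norml.
have := nrm_ler (u n) l; have := nrm_ler l (u n).
by rewrite (nrmB l); lra.
Qed.

(** Minimize [F y = nrm (h y) ^+ 2 - 2 * Re (phi y)]: by the parallelogram law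
    the images under [h] of a minimizing sequence form a Cauchy sequence, and its
    limit represents [phi] because the first variation of [F] vanishes there.
    The functional lives on [V] rather than on [H] so that the lemma also serves
    functionals defined on a dense subspace only. *)
Lemma riesz (V : lmodType C) (h : V -> H) (phi : V -> C) (K : R) :
  linear h -> linear_for *%R phi ->
  (forall y, nrm (phi y) <= K * nrm (h y)) ->
  exists w, forall y, phi y = '[h y, w].
Proof.
move=> lh lphi bphi.
pose F y : R := nrm (h y) ^+ 2 - 2 * complex.Re (phi y).
have Fge y : - K ^+ 2 <= F y.
  have := bphi y; have := nrm_ge0 (h y); have := Re_le_nrm (phi y); rewrite /F.
  move: (nrm (phi y)) (complex.Re (phi y)) (nrm (h y)) => p q t.
  rewrite ler_norml => /andP[_ qp] t0 pK; have := sqr_ge0 (t - K).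
  by rewrite sqrrB -mulr_natr; lra.
have hinf : has_inf (range F).
  split; first by exists (F 0), 0.
  by exists (- K ^+ 2) => _ [y _ <-].
pose m := inf (range F).
have mF y : m <= F y by apply: ge_inf; [case: hinf|exists y].
have /choice[y hy] : forall n : nat, exists y, F y < m + n.+1%:R^-1.
  move=> n; have [|_ [y _ <-] hy] := @inf_adherent _ (range F) (n.+1%:R^-1) _ hinf.
    by rewrite invr_gt0.
  by exists y.
(* parallelogram law, with the midpoint of a and b bounded below by m *)
have par a b : nrm (h a - h b) ^+ 2 <= 2 * (F a - m) + 2 * (F b - m).
  have := mF ((2%:R^-1 : C) *: (a + b)); have := parallelogram (h a) (h b).
  rewrite /F (linZ lh) (linZ lphi) (linD lh) (linD lphi) nrmZ.
  have -> : nrm (2%:R^-1 : C) = 2%:R^-1.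
    have -> : (2%:R^-1 : C) = (2%:R^-1 : R)%:C by rewrite fmorphV rmorph_nat.
    by rewrite nrm_real ger0_norm // invr_ge0.
  have -> : complex.Re (2%:R^-1 * (phi a + phi b)) = 2%:R^-1 * (complex.Re (phi a) + complex.Re (phi b)).
    have -> : (2%:R^-1 : C) = (2%:R^-1 : R)%:C by rewrite fmorphV rmorph_nat.
    by rewrite !ReImE /=; ring.
  by rewrite exprMn; lra.
have [w hw] : exists w, ncvg (h \o y) w.
  apply: cauchy_ncvg => e e0.
  have [|N hN] := cvg0_lt (cvg_inv_succ (R := R)) (_ : 0 < e ^+ 2 / 4%:R).
    by rewrite divr_gt0 // exprn_gt0.
  exists N => a b /hN /= ha /hN /= hb; have := par (y a) (y b); have := hy a; have := hy b.
  move=> h1 h2 h3; clearbody F m.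
  have : nrm (h (y a) - h (y b)) ^+ 2 < e ^+ 2.
    move: h1 h2 h3 ha hb; move: (a.+1%:R^-1) (b.+1%:R^-1) => ra rb h1 h2 h3 ha hb; lra.
  by rewrite ltr_pXn2r// nnegrE ?nrm_ge0// ltW.
exists w => z; have : nrm ('[h z, w] - phi z) ^+ 2 <= 0 * nrm (h z) ^+ 2.
  apply: quad_bound => //; first exact: sqr_ge0.
  move=> c; rewrite add0r.
  have lim1 : (fun n : nat => n.+1%:R^-1 + 2 * complex.Re (c * ('[h z, h (y n)] - phi z))
         + nrm c ^+ 2 * nrm (h z) ^+ 2 : R) @ \oo -->
     0 + 2 * complex.Re (c * ('[h z, w] - phi z)) + nrm c ^+ 2 * nrm (h z) ^+ 2.
    apply: cvgD; last exact: cvg_cst.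
    apply: cvgD; first exact: cvg_inv_succ.
    apply: cvgMr; apply: ncvg_Re; apply: ncvgMl; apply: ncvgB; last exact: ncvg_cst.
    by apply: ncvg_dot => //; exact: ncvg_cst.
  rewrite -[2 * _]add0r -(cvg_lim _ lim1)//; apply: limr_ge.
    by apply/cvg_ex; eexists; exact: lim1.
  apply: nearW => n; have := mF (y n + c *: z); have := hy n.
  rewrite /F (linD lh) (linD lphi) (linZ lh) (linZ lphi) nrm_sqrD nrmZ exprMn dotC dotZl.
  rewrite mulrBr [complex.Re (_ - _)]ReD ReN ReJ [complex.Re (phi _ + _)]ReD /=.
  clearbody F m; move: (n.+1%:R^-1) => r; lra.
rewrite mul0r => h1; apply/esym/eqP; rewrite -subr_eq0; apply/eqP/nrm_eq0/eqP.
by rewrite -sqrf_eq0 eq_le h1 sqr_ge0.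
Qed.

Section Dense.
Variables (V : lmodType C) (h : {linear V -> H}).
Hypothesis dh : dense (range h).

Lemma dense_ext u v : (forall x, '[h x, u] = '[h x, v]) -> u = v.
Proof.
move=> e; apply: dot0_eqr => w; have [x xw] := dense_seq dh w.
apply: (@ncvg_uniq _ _ (fun n => '[h (x n), u])).
  by apply: ncvg_dot xw _; exact: ncvg_cst.
apply: (ncvg_eq (u := fun n => '[h (x n), v])); first by move=> n; rewrite e.
by apply: ncvg_dot xw _; exact: ncvg_cst.
Qed.

(** Test the inequality on a sequence converging to [w] itself. *)
Lemma dense_bound w k : 0 <= k -> (forall x, nrm '[h x, w] <= k * nrm (h x)) -> nrm w <= k.
Proof.
move=> k0 bd; have [y hy] := dense_seq dh w.
have l1 : (fun n => complex.Re '[h (y n), w]) @ \oo --> complex.Re '[w, w].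
  by apply: ncvg_Re; apply: ncvg_dot hy _; exact: ncvg_cst.
have l2 : (fun n => k * nrm (h (y n))) @ \oo --> k * nrm w.
  by apply: cvgMr; exact: ncvg_nrm hy.
have : complex.Re '[w, w] <= k * nrm w.
  rewrite -(cvg_lim _ l1)// -(cvg_lim _ l2)//; apply: ler_lim.
  - by apply/cvg_ex; eexists; exact: l1.
  - by apply/cvg_ex; eexists; exact: l2.
  - apply: nearW => n; apply: le_trans (bd _).
    by apply: le_trans (Re_le_nrm _); rewrite ler_norm.
rewrite dotE /= expr2; have := nrm_ge0 w; rewrite le0r => /orP[/eqP-> //|p].
by rewrite ler_pM2r.
Qed.

End Dense.

(** Two applications of Riesz: the first represents [de y x] by a vector [D0 x],
    the second gives the adjoint of [D0], which is defined on the whole of [H].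
    This extends the operator from the dense range without a continuity
    argument. *)
Lemma form_op (V : lmodType C) (h : {linear V -> H}) (de : V -> V -> C) (K : R) :
  dense (range h) -> sesq de -> 0 <= K ->
  (forall x y, nrm (de x y) <= K * nrm (h x) * nrm (h y)) ->
  exists2 D : H -> H, bounded_op D & forall x y, de x y = '[D (h x), h y].
Proof.
move=> dh sd K0 hd.
have lh : linear h by move=> c u v; rewrite linearP.
have /choice[D0 hD0] : forall x, exists w, forall y, de y x = '[h y, w].
  move=> x; apply: (@riesz _ h _ (K * nrm (h x))) => //; first exact: sd.1.
  by move=> y; rewrite mulrAC hd.
have bD0 x : nrm (D0 x) <= K * nrm (h x).
  apply: (dense_bound dh); first by rewrite mulr_ge0 ?nrm_ge0.
  by move=> y; rewrite -hD0 mulrAC.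
have lD0 : linear D0.
  by move=> c u v; apply: (dense_ext dh) => y; rewrite dotDr dotZr -!hD0 (sesqDr sd) (sesqZr sd).
have /choice[E hE] : forall u, exists w, forall x, '[D0 x, u] = '[h x, w].
  move=> u; apply: (@riesz _ h _ (K * nrm u)) => //.
    by move=> c x y /=; rewrite lD0 dotDl dotZl.
  move=> y; apply: le_trans (dot_le _ _) _; rewrite mulrAC.
  by rewrite ler_wpM2r ?nrm_ge0.
exists E; last by move=> x y; rewrite dotC -hE -dotC -hD0.
apply/bounded_opP; split.
  by move=> c u v; apply: (dense_ext dh) => x; rewrite dotDr dotZr -!hE dotDr dotZr.
exists K => // u; apply: (dense_bound dh); first by rewrite mulr_ge0 ?nrm_ge0.
move=> x; rewrite -hE; apply: le_trans (dot_le _ _) _; rewrite mulrAC.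
by rewrite ler_wpM2r ?nrm_ge0.
Qed.

Lemma dense_id : dense (range (@idfun H)).
Proof. by move=> O [x Ox] _; exists x; split => //; exists x. Qed.

Lemma sesq_op (de : H -> H -> C) (K : R) : sesq de -> 0 <= K ->
  (forall x y, nrm (de x y) <= K * nrm x * nrm y) ->
  exists2 D : H -> H, bounded_op D & forall x y, de x y = '[D x, y].
Proof. exact: (@form_op H idfun de K dense_id). Qed.

Lemma adjoint_ex (a : H -> H) : bounded_op a ->
  exists2 b, bounded_op b & adjoint a b.
Proof.
move=> /bounded_opP[la [K K0 hK]].
have [|//||b bb hb] := @sesq_op (fun u v => '[u, a v]) K.
- split=> [y c u v|x c u v] /=; first by rewrite dotDl dotZl.
  by rewrite la dotDr dotZr.
- move=> x y; apply: le_trans (dot_le _ _) _; rewrite (mulrC K) -mulrA.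
  by rewrite ler_wpM2l ?nrm_ge0.
by exists b => // u v; rewrite dotC hb -dotC.
Qed.

End Riesz.

(** * Hilbert spaces from complete inner products *)

Section Seminorm.
Context {R : realType} {V : lmodType R[i]} (s : V -> V -> R[i]).
Local Notation C := R[i].

Definition seminorm (x : V) : R := Num.sqrt (complex.Re (s x x)).

Definition sn_cauchy (v : nat -> V) := forall e : R, 0 < e ->
  exists N, forall n m, (N <= n)%N -> (N <= m)%N -> seminorm (v n - v m) < e.

Hypothesis ps : pos_form s.
Let hs := pos_form_sesq ps.

Lemma seminorm_ge0 x : 0 <= seminorm x. Proof. exact: sqrtr_ge0. Qed.

Lemma seminorm_sqr x : seminorm x ^+ 2 = complex.Re (s x x).
Proof. by rewrite sqr_sqrtr //; case/ge0C: (pos_form_ge0 x ps). Qed.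

Lemma seminormE x : s x x = (seminorm x ^+ 2)%:C.
Proof. by rewrite seminorm_sqr -ge0_ReE// pos_form_ge0. Qed.

Lemma seminorm_CS x y : nrm (s x y) <= seminorm x * seminorm y.
Proof.
have := CS x y ps; rewrite -!seminorm_sqr -exprMn.
by rewrite ler_pXn2r ?nnegrE ?mulr_ge0 ?nrm_ge0 ?seminorm_ge0.
Qed.

Lemma seminormD x y : seminorm (x + y) <= seminorm x + seminorm y.
Proof.
rewrite -(ler_pXn2r (_ : 0 < 2)%N) ?nnegrE ?addr_ge0 ?seminorm_ge0//.
rewrite sqrrD !seminorm_sqr.
rewrite (sesqDl hs) !(sesqDr hs) (pos_form_herm x y ps).
have := le_trans (ler_norm _) (le_trans (Re_le_nrm _) (seminorm_CS x y)).
by rewrite !ReImE -mulr_natr; lra.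
Qed.

Lemma seminormZ (c : C) x : seminorm (c *: x) = nrm c * seminorm x.
Proof.
rewrite /seminorm (sesqZl hs) (sesqZr hs) mulrA mulcJ (seminormE x) -rmorphM /=.
by rewrite sqrtrM ?sqr_ge0// !sqrtr_sqr !ger0_norm ?seminorm_ge0 ?nrm_ge0.
Qed.

Lemma seminorm0 : seminorm 0 = 0.
Proof. by rewrite /seminorm (sesq0l hs) sqrtr0. Qed.

Lemma seminormN x : seminorm (- x) = seminorm x.
Proof. by rewrite /seminorm (sesqNl hs) (sesqNr hs) opprK. Qed.

Lemma seminormB x y : seminorm (x - y) = seminorm (y - x).
Proof. by rewrite -seminormN opprB. Qed.

Lemma seminorm_dist z x y : seminorm (x - y) <= seminorm (x - z) + seminorm (y - z).
Proof. by rewrite [seminorm (y - z)]seminormB (le_trans _ (seminormD _ _))// addrA subrK. Qed.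

Lemma sn_cauchy_bounded v : sn_cauchy v -> exists2 K, 0 <= K & forall n, seminorm (v n) <= K.
Proof.
move=> /(_ 1 ltr01)[N hN]; exists (\sum_(i < N) seminorm (v i) + (seminorm (v N) + 1)).
  by rewrite addr_ge0 ?sumr_ge0 ?addr_ge0 ?seminorm_ge0// => i _; exact: seminorm_ge0.
move=> n; case: (ltnP n N) => nN.
  rewrite (bigD1 (Ordinal nN)) //= -addrA lerDl addr_ge0 ?addr_ge0 ?seminorm_ge0//.
  by apply: sumr_ge0 => i _; exact: seminorm_ge0.
apply: (@le_trans _ _ (seminorm (v N) + 1)); last first.
  by rewrite lerDr sumr_ge0// => i _; exact: seminorm_ge0.
rewrite -{1}(subrK (v N) (v n)) addrC; apply: le_trans (seminormD _ _) _.
by rewrite lerD2l ltW// hN.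
Qed.

End Seminorm.

Record innerSpace (R : realType) := InnerSpace {
  inner_space : lmodType R[i] ;
  inner_form : inner_space -> inner_space -> R[i] ;
  inner_pos : pos_form inner_form ;
  inner_definite : forall x, inner_form x x = 0 -> x = 0 ;
  inner_complete : forall u, sn_cauchy inner_form u ->
    exists l, (fun n => seminorm inner_form (u n - l)) @ \oo --> (0 : R)
}.

Section HilbertOfInnerSpace.
Context {R : realType} (E : innerSpace R).
Local Notation C := R[i].
Local Notation s := (@inner_form R E).

(** A wrapper on which the Hilbert structure given by [E] can be canonical. *)
Definition hilbert_of : Type := inner_space E.
HB.instance Definition _ := GRing.Lmodule.on hilbert_of.

Lemma hilbert_of_ler_normD (x y : hilbert_of) :
  (seminorm s (x + y))%:C <= (seminorm s x)%:C + (seminorm s y)%:C.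
Proof. by rewrite -rmorphD lecR seminormD //; exact: inner_pos. Qed.

Lemma hilbert_of_normrZ (c : C) (x : hilbert_of) :
  (seminorm s (c *: x))%:C = `|c| * (seminorm s x)%:C.
Proof. by rewrite nrmE -rmorphM seminormZ//; exact: inner_pos. Qed.

Lemma hilbert_of_normr0_eq0 (x : hilbert_of) : (seminorm s x)%:C = 0 -> x = 0.
Proof.
move=> h; apply: inner_definite.
by rewrite (seminormE (inner_pos E)) rmorphXn /= h expr0n.
Qed.

HB.instance Definition _ := Lmodule_isNormed.Build C hilbert_of
  hilbert_of_ler_normD hilbert_of_normrZ hilbert_of_normr0_eq0.

Lemma hilbert_of_nrmE (x : hilbert_of) : nrm x = seminorm s x. Proof. by []. Qed.

Lemma hilbert_of_complete (F : set_system hilbert_of) : ProperFilter F -> cauchy F -> cvg F.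
Proof.
move=> FF /cauchyP cF.
have /choice[x hx] : forall n : nat, exists x, F (ball x (n.+1%:R^-1 : R)%:C).
  by move=> n; apply: cF; rewrite ltcR invr_gt0.
have [l hl] : exists l : hilbert_of, (fun n => nrm (x n - l)) @ \oo --> (0 : R).
  apply: inner_complete => e e0.
  have r0 : 0 < e / 2 by rewrite divr_gt0.
  have [N hN] := cvg0_lt (cvg_inv_succ (R := R)) r0.
  exists N => n m /hN hn /hN hm; rewrite -hilbert_of_nrmE.
  have [z [zn zm]] := filter_ex (filterI (hx n) (hx m)).
  move: zn zm; rewrite -!ball_normE /= !nrmE !ltcR => zn zm.
  apply: le_lt_trans (nrm_dist z _ _) _; rewrite (splitr e).
  by apply: ltrD; [apply: lt_trans zn hn|apply: lt_trans zm hm].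
apply/cvg_ex; exists l; apply/cvgrPdist_lt => e e0.
have [r r0 eE] : exists2 r : R, 0 < r & e = r%:C.
  exists (complex.Re e); last exact/ge0_ReE/ltW.
  by rewrite -ltcR -ge0_ReE ?ltW.
rewrite eE {e e0 eE}.
have [|N1 h1] := cvg0_lt hl (_ : 0 < r / 2); first by rewrite divr_gt0.
have [|N2 h2] := cvg0_lt (cvg_inv_succ (R := R)) (_ : 0 < r / 2); first by rewrite divr_gt0.
pose n := maxn N1 N2.
have {}h1 := h1 n (leq_maxl _ _); have {}h2 := h2 n (leq_maxr _ _).
apply: filterS (hx n) => z; rewrite -ball_normE /= !nrmE !ltcR => zn.
apply: le_lt_trans (nrm_dist (x n) _ _) _; rewrite (splitr r) nrmB ltrD//.
by rewrite nrmB; apply: lt_trans zn h2.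
Qed.

HB.instance Definition _ := Uniform_isComplete.Build hilbert_of hilbert_of_complete.

Definition hilbert_of_dot (x y : hilbert_of) : C := s x y.

Lemma hilbert_of_dot_bilinear : bilinear_for
  (GRing.Scale.Law.clone _ _ ( *%R : C -> C -> C) _) (GRing.Scale.Law.clone _ _ (@Num.conj C \; *%R) _) hilbert_of_dot.
Proof. by case: (inner_pos E). Qed.

HB.instance Definition _ := bilinear_isBilinear.Build C hilbert_of hilbert_of C _ _ hilbert_of_dot hilbert_of_dot_bilinear.

Lemma hilbert_of_dot_herm (x y : hilbert_of) : hilbert_of_dot x y = (-1) ^+ false * Num.conj (hilbert_of_dot y x).
Proof. by rewrite expr0 mul1r; apply: pos_form_herm (inner_pos E). Qed.

HB.instance Definition _ := isHermitianSesquilinear.Build C hilbert_of false (@Num.conj C) hilbert_of_dot hilbert_of_dot_herm.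

Lemma hilbert_of_dot_gt0 (x : hilbert_of) : x != 0 -> 0 < hilbert_of_dot x x.
Proof.
move=> x0; rewrite lt_def pos_form_ge0 ?andbT; last exact: inner_pos.
by apply: contraNneq x0 => /inner_definite ->.
Qed.

HB.instance Definition _ := isDotProduct.Build C hilbert_of hilbert_of_dot hilbert_of_dot_gt0.

Lemma hilbert_of_dot_norm (x : hilbert_of) : (hilbert_of_dot : {dot hilbert_of for (@Num.conj C)}) x x = `|x| ^+ 2.
Proof. by rewrite nrmE hilbert_of_nrmE -rmorphXn /= -(seminormE (inner_pos E)). Qed.

HB.instance Definition _ := CompleteNormedModule_isHilbert.Build R hilbert_of hilbert_of_dot_norm.

End HilbertOfInnerSpace.

(** * Hilbert completion of a positive form *)

Lemma complex_cauchy {R : realType} (u : nat -> R[i]) : cauchy_seq u -> exists l, ncvg u l.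
Proof.
move=> cu.
have part (f : R[i] -> R) : (forall x y, `|f x - f y| <= nrm (x - y)) ->
    exists l : R, (f \o u) @ \oo --> l.
  move=> hf; apply/cvg_ex; apply: cauchy_cvg; apply: cauchy_exP => e e0.
  have [N hN] := cu e e0; exists (f (u N)); exists N => // n /= Nn.
  by rewrite -ball_normE /=; apply: le_lt_trans (hf _ _) _; exact: hN.
have [|a ha] := part (@complex.Re R); first by move=> x y; rewrite -ReN -ReD Re_le_nrm.
have [|b hb] := part (@complex.Im R); first by move=> x y; rewrite -ImN -ImD Im_le_nrm.
by exists (Complex a b); apply: ncvg_ReIm.
Qed.

Section Completion.
Context {R : realType} {V : lmodType R[i]} (s : V -> V -> R[i]).
Hypothesis ps : pos_form s.
Local Notation C := R[i].
Local Notation sn := (seminorm s).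
Let hs := pos_form_sesq ps.

Lemma sn_cauchy_cst x : sn_cauchy s (fun=> x).
Proof. by move=> e e0; exists 0%N => n m _ _; rewrite subrr seminorm0. Qed.

Lemma sn_cauchyP (c : C) u v : sn_cauchy s u -> sn_cauchy s v -> sn_cauchy s (fun n => c *: u n + v n).
Proof.
move=> cu cv e e0.
have e1 : 0 < e / 2 / (nrm c + 1) by rewrite !divr_gt0 // ltr_wpDl ?nrm_ge0.
have [N1 h1] := cu _ e1; have [|N2 h2] := cv (e / 2); first by rewrite divr_gt0.
exists (maxn N1 N2) => n m; rewrite !geq_max => /andP[n1 n2] /andP[m1 m2].
rewrite opprD addrACA -scalerBr; apply: le_lt_trans (seminormD ps _ _) _.
rewrite (splitr e); apply: ler_ltD; last exact: h2.
rewrite seminormZ//; have := h1 n m n1 m1; rewrite ltr_pdivlMr ?ltr_wpDl ?nrm_ge0//.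
move=> /ltW; apply: le_trans; rewrite mulrC ler_wpM2l ?seminorm_ge0 // lerDl //.
Qed.

Lemma sn_cauchy_form u v : sn_cauchy s u -> sn_cauchy s v ->
  exists l, ncvg (fun n => s (u n) (v n)) l.
Proof.
move=> cu cv; apply: complex_cauchy => e e0.
have [K K0 hK] := sn_cauchy_bounded ps cu; have [L L0 hL] := sn_cauchy_bounded ps cv.
have p0 : 0 < K + L + 1 by rewrite ltr_wpDl ?addr_ge0.
have e1 : 0 < e / (K + L + 1) by rewrite divr_gt0.
have [N1 h1] := cu _ e1; have [N2 h2] := cv _ e1.
exists (maxn N1 N2) => n m; rewrite !geq_max => /andP[n1 n2] /andP[m1 m2].
have -> : s (u n) (v n) - s (u m) (v m) = s (u n - u m) (v n) + s (u m) (v n - v m).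
  by rewrite (sesqBl hs) (sesqBr hs) addrA subrK.
apply: le_lt_trans (nrmD _ _) _.
apply: le_lt_trans (lerD (seminorm_CS ps _ _) (seminorm_CS ps _ _)) _.
have {}h1 := ltW (h1 n m n1 m1); have {}h2 := ltW (h2 n m n2 m2).
set d := e / _ in h1 h2 e1.
apply: (@le_lt_trans _ _ (d * L + K * d)).
  by apply: lerD; apply: ler_pM; rewrite ?seminorm_ge0.
have -> : e = d * (K + L + 1) by rewrite /d divfK // gt_eqF.
by rewrite (mulrC K) -mulrDr ltr_pM2l//; lra.
Qed.

(** A Cauchy sequence that tends to 0 weakly tends to 0 in seminorm:
    [s (u n) (u n)] is close to [s (u n) (u N)] for a fixed large [N]. *)
Lemma sn_null u : sn_cauchy s u -> (forall y, ncvg (fun n => s (u n) y) 0) ->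
  (fun n => sn (u n)) @ \oo --> (0 : R).
Proof.
move=> cu u0; have [K K0 hK] := sn_cauchy_bounded ps cu.
apply/cvgr0Pnorm_lt => e e0.
have d0 : 0 < e ^+ 2 / 2 / (K + 1) by rewrite !divr_gt0 ?exprn_gt0 ?ltr_wpDl.
have [N1 h1] := cu _ d0.
have /ncvgP/(_ (e ^+ 2 / 2)) [|N2 h2] := u0 (u N1); first by rewrite divr_gt0 ?exprn_gt0.
exists (maxn N1 N2) => // n /=; rewrite geq_max => /andP[n1 n2].
rewrite ger0_norm ?seminorm_ge0// -(ltr_pXn2r (_ : 0 < 2)%N) ?nnegrE ?seminorm_ge0 ?ltW//.
have := h2 n n2; rewrite subr0 => {}h2.
have : nrm (s (u n) (u n - u N1)) <= e ^+ 2 / 2.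
  apply: le_trans (seminorm_CS ps _ _) _.
  have := ltW (h1 n N1 n1 (leqnn _)); rewrite ler_pdivlMr ?ltr_wpDl// => {}h1.
  apply: le_trans h1; rewrite mulrC ler_wpM2l ?seminorm_ge0 ?ger0_norm//.
  by apply: le_trans (hK _) _; rewrite lerDl.
rewrite (sesqBr hs) => h3; rewrite seminorm_sqr //.
have := le_trans (ler_norm _) (Re_le_nrm (s (u n) (u n))).
have := nrm_ler (s (u n) (u n)) (s (u n) (u N1)); lra.
Qed.

(** The completion is realized inside the functions on [V]: an element is the
    limit of the functions [s (v n)] for a Cauchy sequence [v].  Vectors of
    seminorm 0 disappear by themselves and no quotient is needed. *)
Definition represents (f : V -> C^o) (v : nat -> V) :=
  sn_cauchy s v /\ forall y, ncvg (fun n => s (v n) y) (f y : C).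

Lemma represents_lin (c : C) f g v w : represents f v -> represents g w ->
  represents (c *: f + g) (fun n => c *: v n + w n).
Proof.
move=> [cv fv] [cw gw]; split; first exact: sn_cauchyP.
move=> y; apply: (ncvg_eq (u := fun n => c * s (v n) y + s (w n) y)).
  by move=> n; rewrite (sesqDl hs) (sesqZl hs).
by apply: ncvgD; [apply: ncvgMl|].
Qed.

Lemma represents_cst x : represents (s x) (fun=> x).
Proof. by split; [exact: sn_cauchy_cst|move=> y; exact: ncvg_cst]. Qed.

(** The limit of [s (v n) (w n)] only depends on the represented functions,
    since two representatives differ by a sequence of seminorm tending to 0. *)
Lemma represents_form f g v w v' w' l : represents f v -> represents g w ->
  represents f v' -> represents g w' -> ncvg (fun n => s (v n) (w n)) l ->
  ncvg (fun n => s (v' n) (w' n)) l.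
Proof.
move=> fv gw fv' gw' vwl.
have null f0 a b : represents f0 a -> represents f0 b -> (fun n => sn (a n - b n)) @ \oo --> (0 : R).
  move=> fa fb; have := represents_lin (- 1) fb fa.
  rewrite scaleN1r addNr => -[c0 h0].
  have -> : (fun n => sn (a n - b n)) = (fun n => sn (-1 *: b n + a n)).
    by apply/funext => n; rewrite scaleN1r addrC.
  by apply: sn_null.
have vv := null _ _ _ fv' fv; have ww := null _ _ _ gw' gw.
have [K K0 hK] := sn_cauchy_bounded ps fv.1; have [L L0 hL] := sn_cauchy_bounded ps gw'.1.
have d : ncvg (fun n => s (v' n) (w' n) - s (v n) (w n)) 0.
  apply: (ncvg_le (b := fun n => sn (v' n - v n) * L + K * sn (w' n - w n))).
    move=> n; rewrite subr0.
    have -> : s (v' n) (w' n) - s (v n) (w n) = s (v' n - v n) (w' n) + s (v n) (w' n - w n).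
      by rewrite (sesqBl hs) (sesqBr hs) addrA subrK.
    apply: le_trans (nrmD _ _) _; apply: lerD; apply: le_trans (seminorm_CS ps _ _) _.
      by rewrite ler_wpM2l ?seminorm_ge0.
    by rewrite ler_wpM2r ?seminorm_ge0.
  rewrite -[0]addr0; apply: cvgD.
    by rewrite -(mul0r L); apply: cvgMl.
  by rewrite -(mulr0 K); apply: cvgMr.
have := ncvgD d vwl; rewrite add0r; apply: ncvg_eq => n; exact: subrK.
Qed.

Definition cpl_pred of pos_form s : {pred V -> C^o} :=
  fun f => `[< exists v, represents f v >].

Record completion := Completion {
  cpl_val : V -> C^o ;
  cplP : cpl_val \in cpl_pred ps
}.

Lemma cpl_submod_closed : submod_closed (cpl_pred ps).
Proof.
split=> [|k f g].
  apply/asboolP; exists (fun=> 0); have := represents_cst 0.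
  by congr (represents _ _); apply/funext => y; rewrite (sesq0l hs).
move=> /asboolP[v fv] /asboolP[w gw]; apply/asboolP.
by exists (fun n => k *: v n + w n); apply: represents_lin.
Qed.

HB.instance Definition _ :=
  GRing.isSubmodClosed.Build C _ (cpl_pred ps) cpl_submod_closed.
HB.instance Definition _ := [isSub for cpl_val].
HB.instance Definition _ := [Choice of completion by <:].
HB.instance Definition _ := [SubChoice_isSubLmodule of completion by <:].

Lemma cpl_seq_ex (f : completion) : exists v, represents (cpl_val f) v.
Proof. exact/asboolP/cplP. Qed.

Definition cpl_seq (f : completion) := projT1 (cid (cpl_seq_ex f)).
Lemma cpl_seqP f : represents (cpl_val f) (cpl_seq f).
Proof. exact: projT2 (cid (cpl_seq_ex f)). Qed.

Lemma cpl_dot_ex (f g : completion) :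
  exists l, ncvg (fun n => s (cpl_seq f n) (cpl_seq g n)) l.
Proof. by apply: sn_cauchy_form; have [] := cpl_seqP f; have [] := cpl_seqP g. Qed.

Definition cpl_dot (f g : completion) : C := projT1 (cid (cpl_dot_ex f g)).

Lemma cpl_dotP (f g : completion) v w : represents (cpl_val f) v -> represents (cpl_val g) w ->
  ncvg (fun n => s (v n) (w n)) (cpl_dot f g).
Proof.
move=> fv gw; have h := projT2 (cid (cpl_dot_ex f g)).
exact: represents_form (cpl_seqP f) (cpl_seqP g) fv gw h.
Qed.

Lemma cpl_dot_pos : pos_form cpl_dot.
Proof.
split=> [g c f f'|f c g g'|f].
- have h := represents_lin c (cpl_seqP f) (cpl_seqP f').
  apply: (ncvg_uniq (cpl_dotP (f := c *: f + f') h (cpl_seqP g))).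
  apply: (ncvg_eq (u := fun n => c * s (cpl_seq f n) (cpl_seq g n) + s (cpl_seq f' n) (cpl_seq g n))).
    by move=> n; rewrite (sesqDl hs) (sesqZl hs).
  by apply: ncvgD; [apply: ncvgMl|]; apply: cpl_dotP; exact: cpl_seqP.
- have h := represents_lin c (cpl_seqP g) (cpl_seqP g').
  apply: (ncvg_uniq (cpl_dotP (g := c *: g + g') (cpl_seqP f) h)).
  apply: (ncvg_eq (u := fun n => Num.conj c * s (cpl_seq f n) (cpl_seq g n) + s (cpl_seq f n) (cpl_seq g' n))).
    by move=> n; rewrite (sesqDr hs) (sesqZr hs).
  by apply: ncvgD; [apply: ncvgMl|]; apply: cpl_dotP; exact: cpl_seqP.
- apply: ncvg_ge0 (cpl_dotP (cpl_seqP f) (cpl_seqP f)) => n.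
  exact: pos_form_ge0.
Qed.

Lemma iota_subproof x : (s x : V -> C^o) \in cpl_pred ps.
Proof. by apply/asboolP; exists (fun=> x); exact: represents_cst. Qed.

Definition to_cpl x : completion := Completion (iota_subproof x).

Lemma to_cpl_linear : linear to_cpl.
Proof.
move=> c x y; apply/val_inj/funext => z.
by rewrite /= (sesqDl hs) (sesqZl hs).
Qed.

Lemma to_cpl_dot x y : cpl_dot (to_cpl x) (to_cpl y) = s x y.
Proof.
apply: (ncvg_uniq (cpl_dotP (f := to_cpl x) (g := to_cpl y) (represents_cst x) (represents_cst y))).
exact: ncvg_cst.
Qed.

Lemma cpl_valE f y : cpl_val f y = cpl_dot f (to_cpl y).
Proof.
apply: (ncvg_uniq ((cpl_seqP f).2 y)).
exact: (cpl_dotP (g := to_cpl y) (cpl_seqP f) (represents_cst y)).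
Qed.

Local Notation csn := (seminorm cpl_dot).

Lemma cpl_definite f : cpl_dot f f = 0 -> f = 0.
Proof.
move=> f0; apply/val_inj/funext => y; rewrite /= cpl_valE; apply: nrm_eq0.
apply/eqP; rewrite eq_le nrm_ge0 andbT.
by apply: le_trans (seminorm_CS cpl_dot_pos _ _) _; rewrite /seminorm f0 sqrtr0 mul0r.
Qed.

Lemma cpl_approx f v : represents (cpl_val f) v ->
  (fun n => csn (f - to_cpl (v n))) @ \oo --> (0 : R).
Proof.
move=> fv; apply/cvgr0Pnorm_lt => e e0.
have e1 : 0 < e / 2 by rewrite divr_gt0.
have [N hN] := fv.1 _ e1; exists N => // m /= Nm.
rewrite ger0_norm ?seminorm_ge0//; apply: (@le_lt_trans _ _ (e / 2)); last lra.
rewrite -(ler_pXn2r (_ : 0 < 2)%N) ?nnegrE ?seminorm_ge0 ?(ltW e1)//.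
rewrite seminorm_sqr; last exact: cpl_dot_pos.
have h := represents_lin (-1) (represents_cst (v m)) fv.
have l : ncvg (fun n => s (v n - v m) (v n - v m)) (cpl_dot (f - to_cpl (v m)) (f - to_cpl (v m))).
  have hr : represents (cpl_val (f - to_cpl (v m))) (fun n => v n - v m).
    have -> : (fun n => v n - v m) = (fun n => -1 *: v m + v n).
      by apply/funext => n; rewrite scaleN1r addrC.
    suff -> : cpl_val (f - to_cpl (v m)) = -1 *: (s (v m) : V -> C^o) + cpl_val f by [].
    by rewrite scaleN1r addrC.
  exact: cpl_dotP.
have l' := ncvg_Re l; rewrite -(cvg_lim _ l')//; apply: limr_le.
  by apply/cvg_ex; eexists; exact: l'.
exists N => // n /= Nn; rewrite -seminorm_sqr// ler_pXn2r ?nnegrE ?seminorm_ge0 ?(ltW e1)//.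
by rewrite ltW// hN.
Qed.

(** Approximate the n-th term by an image of a vector of [V] up to [1 / (n + 1)];
    these vectors form a Cauchy sequence, which represents the limit. *)
Lemma cpl_complete (u : nat -> completion) : sn_cauchy cpl_dot u ->
  exists l, (fun n => csn (u n - l)) @ \oo --> (0 : R).
Proof.
move=> cu; have pd := cpl_dot_pos.
have /choice[x hx] : forall n : nat, exists x, csn (u n - to_cpl x) < n.+1%:R^-1.
  move=> n; have [|N hN] := cvg0_lt (cpl_approx (cpl_seqP (u n))) (_ : 0 < n.+1%:R^-1).
    by rewrite invr_gt0.
  by exists (cpl_seq (u n) N); exact: hN.
have csE y z : sn (y - z) = csn (to_cpl y - to_cpl z).
  by rewrite /seminorm -(linB to_cpl_linear) to_cpl_dot.
have cx : sn_cauchy s x.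
  move=> e e0; have e3 : 0 < e / 3 by rewrite divr_gt0.
  have [N1 h1] := cu _ e3; have [N2 h2] := cvg0_lt (cvg_inv_succ (R := R)) e3.
  exists (maxn N1 N2) => n m; rewrite !geq_max => /andP[n1 n2] /andP[m1 m2].
  rewrite csE; apply: le_lt_trans (seminorm_dist pd (u n) _ _) _.
  have := seminorm_dist pd (u m) (to_cpl (x m)) (u n).
  rewrite (seminormB pd (to_cpl (x n)) (u n)) (seminormB pd (to_cpl (x m)) (u m)).
  have := h1 n m n1 m1; have := lt_trans (hx n) (h2 n n2); have := lt_trans (hx m) (h2 m m2).
  lra.
have /choice[f hf] : forall y, exists l, ncvg (fun n => s (x n) y) l.
  by move=> y; apply: sn_cauchy_form => //; exact: sn_cauchy_cst.
have rf : represents f x by split.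
have fP : (f : V -> C^o) \in cpl_pred ps by apply/asboolP; exists x.
exists (Completion fP).
apply: (squeeze_cvg0 (b := fun n => n.+1%:R^-1 + csn (Completion fP - to_cpl (x n)))).
  move=> n; rewrite seminorm_ge0 /=.
  by apply: le_trans (seminorm_dist pd (to_cpl (x n)) _ _) _; rewrite lerD2r ltW.
rewrite -[0]addr0; apply: cvgD; first exact: cvg_inv_succ.
exact: cpl_approx.
Qed.

Definition cpl_inner : innerSpace R := InnerSpace cpl_dot_pos cpl_definite cpl_complete.

End Completion.

Theorem hilbert_completion {R : realType} {V : lmodType R[i]} (s : V -> V -> R[i]) :
  pos_form s -> exists (H : hilbertType R) (h : {linear V -> H}),
    dense (range h) /\ forall x y, '[h x, h y] = s x y.
Proof.
move=> ps; pose H : hilbertType R := hilbert_of (cpl_inner ps).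
pose f : V -> H := @to_cpl _ _ _ ps.
have lf : linear f by exact: to_cpl_linear.
pose lf' := GRing.isLinear.Build R[i] V H *:%R f lf.
pose h : {linear V -> H} := HB.pack f lf'.
exists H, h; split; last by move=> x y; exact: to_cpl_dot.
move=> O [g Og] oO.
have /nbhs_ballP[e e0 he] : nbhs g O by apply: open_nbhs_nbhs.
have [r r0 eE] := gt0C e0; rewrite eE in he.
have [N hN] := cvg0_lt (cpl_approx (cpl_seqP (g : completion ps))) r0.
exists (h (cpl_seq g N)); split; last by exists (cpl_seq g N).
by apply: he; rewrite -ball_normE /= nrmE ltcR; apply: hN.
Qed.

(** * Positive operators and their square roots *)

Section Operators.
Context {R : realType} {H : hilbertType R}.
Local Notation C := R[i].
Implicit Types (u v w : H) (a b c : H -> H).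

Lemma bounded_lin a : bounded_op a -> linear a. Proof. by case. Qed.

Lemma bounded_id : bounded_op (@idfun H).
Proof. by apply/bounded_opP; split=> //; exists 1 => // u; rewrite mul1r. Qed.

Lemma bounded_comp a b : bounded_op a -> bounded_op b -> bounded_op (a \o b).
Proof.
move=> /bounded_opP[la [K K0 hK]] /bounded_opP[lb [L L0 hL]]; apply/bounded_opP; split.
  by move=> k u v /=; rewrite lb la.
exists (K * L); first exact: mulr_ge0.
by move=> u /=; apply: le_trans (hK _) _; rewrite -mulrA ler_wpM2l.
Qed.

Lemma bounded_comb (k : C) a b : bounded_op a -> bounded_op b -> bounded_op (fun u => k *: a u + b u).
Proof.
move=> /bounded_opP[la [K K0 hK]] /bounded_opP[lb [L L0 hL]]; apply/bounded_opP; split.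
  by move=> l u v /=; rewrite lb la !scalerDr !scalerA (mulrC k) addrACA.
exists (nrm k * K + L); first by rewrite addr_ge0 ?mulr_ge0 ?nrm_ge0.
move=> u; apply: le_trans (nrmD _ _) _; rewrite nrmZ mulrDl lerD// -mulrA.
by rewrite ler_wpM2l ?nrm_ge0.
Qed.

Lemma op_sesq a : linear a -> sesq (fun u v => '[a u, v]).
Proof.
by move=> la; split=> [y k u v|x k u v]/=; rewrite ?la ?dotDl ?dotZl ?dotDr ?dotZr.
Qed.

Lemma pos_op_form a : pos_op a -> pos_form (fun u v => '[a u, v]).
Proof. by move=> [[la _] pa]; have [h1 h2] := op_sesq la; split. Qed.

Lemma pos_op_sa a : pos_op a -> adjoint a a.
Proof.
move=> pa u v; have /= h := pos_form_herm u v (pos_op_form pa).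
by rewrite [RHS]dotC h conjCK.
Qed.

Lemma pos_op_of_sa a : bounded_op a -> adjoint a a -> (forall u, 0 <= complex.Re '[a u, u]) -> pos_op a.
Proof.
move=> ba sa h; split=> // u; apply/ge0C; split=> //.
have : complex.Im '[a u, u] = - complex.Im '[a u, u] by rewrite {1}sa dotC ImJ.
by lra.
Qed.

Lemma pos_op_ge0 a u : pos_op a -> 0 <= complex.Re '[a u, u].
Proof. by move=> [_ /(_ u)/ge0C[]]. Qed.

(** Cauchy-Schwarz for the form of [a], applied to [u] and [a u]. *)
Lemma pos_op_sqr_le a k u : pos_op a -> 0 <= k ->
  (forall u, complex.Re '[a u, u] <= k * nrm u ^+ 2) ->
  nrm (a u) ^+ 2 <= k * complex.Re '[a u, u].
Proof.
move=> pa k0 h; have := CS u (a u) (pos_op_form pa); rewrite dotE.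
have -> : nrm (nrm (a u) ^+ 2)%:C = nrm (a u) ^+ 2 by rewrite nrm_real ger0_norm// sqr_ge0.
have := h (a u); have := pos_op_ge0 u pa; have := sqr_ge0 (nrm (a u)).
move: (nrm (a u) ^+ 2) (complex.Re _) (complex.Re _) => x p q x0 p0 h1 h2.
move: x0; rewrite le0r => /orP[/eqP ->|x0]; first exact: mulr_ge0.
rewrite -(ler_pM2r x0) -expr2; apply: le_trans h2 _.
by rewrite (mulrC k) -mulrA ler_wpM2l.
Qed.

Lemma pos_op_norm a k u : pos_op a -> 0 <= k ->
  (forall u, complex.Re '[a u, u] <= k * nrm u ^+ 2) -> nrm (a u) <= k * nrm u.
Proof.
move=> pa k0 h; rewrite -(ler_pXn2r (_ : 0 < 2)%N) ?nnegrE ?mulr_ge0 ?nrm_ge0//.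
apply: le_trans (pos_op_sqr_le u pa k0 h) _.
by rewrite exprMn expr2 -mulrA ler_wpM2l.
Qed.

Lemma Re_dot_le u v : complex.Re '[u, v] <= nrm u * nrm v.
Proof. exact: le_trans (le_trans (ler_norm _) (Re_le_nrm _)) (dot_le _ _). Qed.

Lemma op_ext a b : (forall u v, '[a u, v] = '[b u, v]) -> a = b.
Proof. by move=> h; apply/funext => u; apply: dot0_eq => v; apply: h. Qed.

End Operators.

Section SquareRoot.
Context {R : realType} {H : hilbertType R}.
Local Notation C := R[i].
Implicit Types (u v w : H) (a b c : H -> H).

(** The scalar version of the iteration [sqrt_iter], with the operator replaced
    by its norm bound 1.  It is increasing and bounded by 1, and its increments
    dominate those of the operator iteration in norm, which gives convergence
    without any power series. *)
Fixpoint majorant (n : nat) : R := if n is m.+1 then (1 + majorant m ^+ 2) / 2 else 0.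

Lemma majorant_bound n : 0 <= majorant n <= 1 /\ majorant n <= majorant n.+1.
Proof.
elim: n => [|n [/andP[h1 h2] h3]] /=; first by rewrite expr0n /=; split; lra.
have h4 : majorant n ^+ 2 <= 1 by rewrite exprn_ile1.
have h5 := sqr_ge0 (majorant n).
move: h3 => /=; move: (majorant n) h1 h2 h4 h5 => x h1 h2 h4 h5 h3.
split; first by apply/andP; split; lra.
suff : x ^+ 2 <= ((1 + x ^+ 2) / 2) ^+ 2 by lra.
by rewrite ler_pXn2r// nnegrE; lra.
Qed.

Lemma majorant_homo m n : (m <= n)%N -> majorant m <= majorant n.
Proof.
elim: n => [|n IH]; first by rewrite leqn0 => /eqP->.
rewrite leq_eqVlt => /orP[/eqP->//|]; rewrite ltnS => /IH/le_trans; apply.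
by case: (majorant_bound n).
Qed.

Lemma majorant_cauchy e : 0 < e -> exists N, forall m n, (N <= m)%N -> (m <= n)%N ->
  majorant n - majorant m < e.
Proof.
move=> e0; pose A := range majorant.
have hA : has_sup A.
  split; first by exists 0, 0%N.
  by exists 1 => _ [n _ <-]; case: (majorant_bound n) => /andP[].
have [_ [N _ <-] hN] := sup_adherent e0 hA.
exists N => m n Nm mn.
have : majorant n <= sup A by apply: (sup_upper_bound hA); exists n.
have := majorant_homo Nm; lra.
Qed.

Variable y : H -> H.
Hypothesis y_bounded : bounded_op y.
Hypothesis y_sa : adjoint y y.
Hypothesis y_contr : forall u, nrm (y u) <= nrm u.
Let half : C := (2%:R^-1 : R)%:C.
Let halfE : nrm half = 2%:R^-1.
Proof. by rewrite nrm_real ger0_norm // invr_ge0. Qed.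

(** The fixed point [z = (y + z^2) / 2] of this iteration satisfies
    [(1 - z)^2 = 1 - y]. *)
Fixpoint sqrt_iter (n : nat) : H -> H := fun u =>
  if n is m.+1 then half *: (y u + sqrt_iter m (sqrt_iter m u)) else 0.

Lemma sqrt_iter_lin n : linear (sqrt_iter n).
Proof.
elim: n => [|n IH] k u v /=; first by rewrite scaler0 addr0.
rewrite !IH (bounded_lin y_bounded) scalerA (mulrC k) -scalerA -scalerDr; congr (_ *: _).
by rewrite scalerDr addrACA.
Qed.

Lemma sqrt_iter_sa n : adjoint (sqrt_iter n) (sqrt_iter n).
Proof.
elim: n => [|n IH] u v /=; first by rewrite dot0l dot0r.
by rewrite dotZl dotZr conjr dotDl dotDr y_sa !IH.
Qed.

Lemma sqrt_iter_nrm n u : nrm (sqrt_iter n u) <= majorant n * nrm u.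
Proof.
elim: n u => [|n IH] u /=; first by rewrite nrm0 mul0r.
rewrite nrmZ halfE; have := nrmD (y u) (sqrt_iter n (sqrt_iter n u)).
have := y_contr u; have := IH (sqrt_iter n u).
have [/andP[s0 _] _] := majorant_bound n.
have := ler_wpM2l s0 (IH u); rewrite mulrA -expr2; move: (majorant n ^+ 2) => q.
by move: (nrm u) => z; lra.
Qed.

(** The difference of squares is written as
    [z' (z' u - z u) + (z' (z u) - z (z u))], so that the norm bounds of the
    factors are enough. *)
Lemma sqrt_iter_step n u : nrm (sqrt_iter n.+1 u - sqrt_iter n u) <= (majorant n.+1 - majorant n) * nrm u.
Proof.
elim: n u => [|n IH] u.
  by rewrite /= subr0 addr0 expr0n /= subr0 addr0 nrmZ halfE mul1r ler_wpM2l ?invr_ge0.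
rewrite [X in X - _]/= [X in _ - X]/= -scalerBr nrmZ halfE opprD addrACA subrr add0r.
set z' := sqrt_iter n.+1; set z := sqrt_iter n.
have -> : z' (z' u) - z (z u) = z' (z' u - z u) + (z' (z u) - z (z u)).
  by rewrite (linB (sqrt_iter_lin n.+1 : linear z')) addrA subrK.
have h1 := sqrt_iter_nrm n.+1 (z' u - z u); have h2 := IH (z u); have h3 := sqrt_iter_nrm n u.
have h4 := IH u; have [/andP[s0 _] _] := majorant_bound n.+1; have [/andP[t0 _] st] := majorant_bound n.
have := nrmD (z' (z' u - z u)) (z' (z u) - z (z u)).
have e : (majorant n.+2 - majorant n.+1) = 2%:R^-1 * (majorant n.+1 * (majorant n.+1 - majorant n) + (majorant n.+1 - majorant n) * majorant n).
  have e1 : majorant n.+2 = (1 + majorant n.+1 ^+ 2) / 2 by [].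
  have e2 : majorant n.+1 = (1 + majorant n ^+ 2) / 2 by [].
  move: (majorant n.+2) (majorant n.+1) (majorant n) e1 e2 => p x t -> e2.
  by rewrite {2}e2; field.
rewrite e -mulrA ler_pM2l ?invr_gt0// => /le_trans; apply.
rewrite mulrDl; apply: lerD.
  by apply: le_trans h1 _; rewrite -mulrA ler_wpM2l.
by apply: le_trans h2 _; rewrite -mulrA ler_wpM2l// subr_ge0.
Qed.

Lemma sqrt_iter_diff m n u : (m <= n)%N ->
  nrm (sqrt_iter n u - sqrt_iter m u) <= (majorant n - majorant m) * nrm u.
Proof.
elim: n => [|n IH]; first by rewrite leqn0 => /eqP->; rewrite !subrr nrm0 mul0r.
rewrite leq_eqVlt => /orP[/eqP->|]; first by rewrite !subrr nrm0 mul0r.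
rewrite ltnS => /IH h; have h' := sqrt_iter_step n u.
have -> : sqrt_iter n.+1 u - sqrt_iter m u = (sqrt_iter n.+1 u - sqrt_iter n u) + (sqrt_iter n u - sqrt_iter m u).
  by rewrite addrA subrK.
apply: le_trans (nrmD _ _) _; apply: le_trans (lerD h' h) _.
by rewrite -mulrDl addrA subrK.
Qed.

Lemma sqrt_iter_cvg u : exists l, ncvg (fun n => sqrt_iter n u) l.
Proof.
apply: cauchy_ncvg => e e0.
have p : 0 < nrm u + 1 by rewrite ltr_wpDl ?nrm_ge0.
have [|N hN] := @majorant_cauchy (e / (nrm u + 1)); first by rewrite divr_gt0.
exists N => n m; wlog mn : n m / (m <= n)%N.
  by move=> h; case/orP: (leq_total m n) => // ? ? ?; [exact: h|rewrite nrmB; exact: h].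
move=> Nn Nm; apply: le_lt_trans (sqrt_iter_diff _ mn) _.
have := hN m n Nm mn; rewrite ltr_pdivlMr// => /(le_lt_trans _); apply.
by rewrite ler_wpM2l ?lerDl// subr_ge0 majorant_homo.
Qed.

Lemma sqrt_iter_limit : exists z : H -> H,
  [/\ bounded_op z, adjoint z z, forall u, nrm (z u) <= nrm u,
      forall u, z u = half *: (y u + z (z u)) &
      forall b, bounded_op b -> y \o b = b \o y -> z \o b = b \o z].
Proof.
have /choice[z hz] := sqrt_iter_cvg; exists z.
have z1 u : nrm (z u) <= nrm u.
  have l := ncvg_nrm (hz u); rewrite -(cvg_lim _ l)//; apply: limr_le.
    by apply/cvg_ex; eexists; exact: l.
  apply: nearW => n; apply: le_trans (sqrt_iter_nrm n u) _.
  by have [/andP[_ s1] _] := majorant_bound n; rewrite ler_piMl ?nrm_ge0.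
have lz : linear z.
  move=> k u v; apply: (ncvg_uniq (hz _)).
  apply: (ncvg_eq (u := fun n => k *: sqrt_iter n u + sqrt_iter n v)).
    by move=> n; rewrite sqrt_iter_lin.
  by apply: ncvgD => //; apply: ncvgZ.
split=> //.
- by apply/bounded_opP; split=> //; exists 1 => // u; rewrite mul1r.
- move=> u v; apply: (@ncvg_uniq _ _ (fun n => '[sqrt_iter n u, v])).
    by apply: ncvg_dot => //; exact: ncvg_cst.
  apply: (ncvg_eq (u := fun n => '[u, sqrt_iter n v])); first by move=> n; rewrite sqrt_iter_sa.
  by apply: ncvg_dot => //; exact: ncvg_cst.
- move=> u; apply: (ncvg_uniq (hz u)).
  suff h : ncvg (fun n => sqrt_iter n.+1 u) (half *: (y u + z (z u))).
    apply/ncvgP => e e0; have /ncvgP/(_ e e0)[N hN] := h; exists N.+1 => -[//|n] Nn.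
    exact: hN.
  apply: ncvgZ; apply: ncvgD; first exact: ncvg_cst.
  apply: (ncvg_le (b := fun n => nrm (sqrt_iter n u - z u) + nrm (sqrt_iter n (z u) - z (z u)))).
    move=> n; have -> : sqrt_iter n (sqrt_iter n u) - z (z u) = sqrt_iter n (sqrt_iter n u - z u) + (sqrt_iter n (z u) - z (z u)).
      by rewrite (linB (sqrt_iter_lin n)) addrA subrK.
    apply: le_trans (nrmD _ _) _; rewrite lerD2r; apply: le_trans (sqrt_iter_nrm n _) _.
    by have [/andP[_ s1] _] := majorant_bound n; rewrite ler_piMl ?nrm_ge0.
  by rewrite -[0]addr0; apply: cvgD; exact: hz.
- move=> b bb yb; apply/funext => u /=; apply: (ncvg_uniq (hz _)).
  apply: (ncvg_eq (u := fun n => b (sqrt_iter n u))); last exact: bounded_ncvg (hz u).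
  move=> n; elim: n u => [|n IH] u /=; first by rewrite (lin0 (bounded_lin bb)).
  rewrite (linZ (bounded_lin bb)) (linD (bounded_lin bb)) !IH.
  by have -> : y (b u) = b (y u) := congr1 (@^~ u) yb.
Qed.

End SquareRoot.

Section Roots.
Context {R : realType} {H : hilbertType R}.
Local Notation C := R[i].
Implicit Types (u v w : H) (a b c : H -> H).

(** Apply the iteration to [y = 1 - a / (K + 1)] with [K] a bound of [a].  The
    second conclusion holds because each iterate commutes with whatever commutes
    with [a]; it places roots in bicommutants. *)
Lemma sqrt_op_ex a : pos_op a -> exists2 c, sqrt_op a c &
  forall b, bounded_op b -> a \o b = b \o a -> c \o b = b \o c.
Proof.
move=> pa; have [/bounded_opP[la [K K0 hK]] _] := pa.
have K1 : 0 < K + 1 by rewrite ltr_wpDl.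
pose y u := - ((K + 1)^-1 : R)%:C *: a u + u.
have by_ : bounded_op y by apply: bounded_comb; [case: pa|exact: bounded_id].
have yE u : complex.Re '[y u, u] = nrm u ^+ 2 - (K + 1)^-1 * complex.Re '[a u, u].
  by rewrite dotDl dotZl dotE !ReImE /=; ring.
have aK u : complex.Re '[a u, u] <= K * nrm u ^+ 2.
  by apply: le_trans (Re_dot_le _ _) _; rewrite expr2 mulrA ler_wpM2r ?nrm_ge0.
have py : pos_op y.
  apply: pos_op_of_sa => //.
    by move=> u v; rewrite dotDl dotDr dotZl dotZr conjNr (pos_op_sa pa).
  move=> u; rewrite yE subr_ge0 mulrC ler_pdivrMr//; apply: le_trans (aK u) _.
  by rewrite mulrC ler_wpM2l ?sqr_ge0// lerDl.
have y1 u : nrm (y u) <= nrm u.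
  rewrite -[leRHS]mul1r; apply: pos_op_norm => // v.
  by rewrite mul1r yE gerBl mulr_ge0 ?pos_op_ge0// invr_ge0 ltW.
have [z [bz sz z1 zE zc]] := sqrt_iter_limit by_ (pos_op_sa py) y1.
have lz := bounded_lin bz.
pose r : C := (Num.sqrt (K + 1))%:C.
have rr : r * r = (K + 1)%:C by rewrite -rmorphM -expr2 sqr_sqrtr // ltW.
pose c u := r *: (u - z u).
have cE : c = fun u => - r *: z u + r *: u.
  by apply/funext => u; rewrite /c scalerBr scaleNr addrC.
exists c.
  split.
    apply: pos_op_of_sa.
    - rewrite cE; apply: bounded_comb => //; apply/bounded_opP; split.
        by move=> k u v; rewrite scalerDr !scalerA mulrC.
      by exists (nrm r); rewrite ?nrm_ge0// => u; rewrite nrmZ.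
    - move=> u v; rewrite cE dotDl dotDr !dotZl !dotZr conjNr conjr.
      by rewrite sz.
    - move=> u; have -> : complex.Re '[c u, u] = Num.sqrt (K + 1) * (nrm u ^+ 2 - complex.Re '[z u, u]).
        by rewrite dotZl dotBl dotE !ReImE /=; ring.
      rewrite mulr_ge0 ?sqrtr_ge0// subr_ge0; apply: le_trans (Re_dot_le _ _) _.
      by rewrite expr2 ler_wpM2r ?nrm_ge0.
  apply/funext => u /=; rewrite /c.
  rewrite (linZ lz) -scalerBr (linB lz) scalerA rr.
  have zz : z u - z (z u) = y u - z u.
    have h : z u + z u = y u + z (z u).
      have hh : 2%:R^-1 + 2%:R^-1 = 1 :> R by lra.
      by rewrite {1 2}zE -scalerDl -rmorphD /= hh scale1r.
    by apply/eqP; rewrite subr_eq addrAC -h addrK.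
  rewrite zz opprB addrA subrK /y opprD addrCA subrr addr0 scaleNr opprK scalerA -rmorphM /=.
  by rewrite divff ?gt_eqF// scale1r.
move=> b bb ab; have yb : y \o b = b \o y.
  apply/funext => u /=; rewrite /y (bounded_lin bb).
  by have -> : a (b u) = b (a u) := congr1 (@^~ u) ab.
have zb := zc b bb yb; apply/funext => u /=; rewrite /c (linZ (bounded_lin bb)) (linB (bounded_lin bb)).
by have -> : z (b u) = b (z u) := congr1 (@^~ u) zb.
Qed.

Lemma pos_op_ker a u : pos_op a -> complex.Re '[a u, u] = 0 -> a u = 0.
Proof.
move=> pa h; have := CS u (a u) (pos_op_form pa); rewrite h mul0r dotE => h2.
apply: nrm_eq0; apply/eqP; rewrite -sqrf_eq0.
have := h2; rewrite nrm_real normrX real_normK ?num_real// => h3.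
by rewrite -sqrf_eq0 eq_le h3 sqr_ge0.
Qed.

(** With [v = a u - b u], the equation [a v + b v = (a^2 - b^2) u = 0] and
    positivity give [a v = b v = 0], whence ['[v, v] = 0]. *)
Lemma sqrt_op_comm_uniq a b : pos_op a -> pos_op b -> a \o b = b \o a ->
  a \o a = b \o b -> a = b.
Proof.
move=> pa pb ab aabb; apply/funext => u.
have la := bounded_lin pa.1; have lb := bounded_lin pb.1.
have abE v : a (b v) = b (a v) := congr1 (@^~ v) ab.
have aabbE v : a (a v) = b (b v) := congr1 (@^~ v) aabb.
pose v := a u - b u.
have s0 : a v + b v = 0.
  by rewrite /v (linB la) (linB lb) aabbE abE addrA subrK subrr.
have : complex.Re '[a v, v] + complex.Re '[b v, v] = 0 by rewrite -ReD -dotDl s0 dot0l.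
have ha := pos_op_ge0 v pa; have hb := pos_op_ge0 v pb => h.
have av : a v = 0 by apply: pos_op_ker => //; lra.
have bv : b v = 0 by apply: pos_op_ker => //; lra.
have : '[v, v] = 0.
  by rewrite {1}/v dotBl (pos_op_sa pa) (pos_op_sa pb) av bv subrr.
rewrite dotE => -[] /eqP; rewrite sqrf_eq0 => /eqP/nrm_eq0 v0.
by apply/eqP; rewrite -subr_eq0; apply/eqP.
Qed.

(** Every root commutes with its square, hence with the canonical root. *)
Lemma sqrt_op_uniq a b c : sqrt_op a b -> sqrt_op a c -> b = c.
Proof.
move=> [pb bb] [pc cc].
have pa : pos_op a.
  split; first by rewrite -bb; apply: bounded_comp; case: pb.
  by move=> u; rewrite -bb /= (pos_op_sa pb) dotE lecR sqr_ge0.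
have [s [ps ss] sc] := sqrt_op_ex pa.
have e d : pos_op d -> d \o d = a -> d = s.
  move=> pd dd; apply: sqrt_op_comm_uniq => //; last by rewrite ss.
  by rewrite -sc //; [case: pd|rewrite -dd].
by rewrite (e b) // (e c).
Qed.

(** [a b = c a c] for the root [c] of [b]. *)
Lemma pos_op_comp a b : pos_op a -> pos_op b -> a \o b = b \o a -> pos_op (a \o b).
Proof.
move=> pa pb ab; have [c [pc cc] ca] := sqrt_op_ex pb.
split; first by apply: bounded_comp; [case: pa|case: pb].
move=> u; rewrite /= -cc /=.
have ac : c \o a = a \o c by apply: ca; [case: pa|].
have -> : a (c (c u)) = c (a (c u)) := esym (congr1 (@^~ (c u)) ac).
by rewrite (pos_op_sa pc); case: pa.
Qed.

Lemma commuting_sqrt A B c : pos_op A -> pos_op B -> A \o B = B \o A ->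
  sqrt_op (A \o B) c -> exists a b, [/\ sqrt_op A a, sqrt_op B b, a \o b = b \o a & c = a \o b].
Proof.
move=> pA pB AB sc.
have [a [pa aa] ca] := sqrt_op_ex pA; have [b [pb bb] cb] := sqrt_op_ex pB.
have bA : b \o A = A \o b by apply: cb; [case: pA|].
have ab : a \o b = b \o a by apply: ca; [case: pb|].
exists a, b; split=> //; apply: sqrt_op_uniq sc _; split; first exact: pos_op_comp.
have abE v : a (b v) = b (a v) := congr1 (@^~ v) ab.
by rewrite -aa -bb; apply/funext => u /=; rewrite -abE.
Qed.

(** The root [c] of [b] is bounded below, hence onto by [riesz] applied along
    [c], and so is [b = c^2]. *)
Lemma pos_op_inv b (e : R) : pos_op b -> 0 < e ->
  (forall u, e * nrm u ^+ 2 <= complex.Re '[b u, u]) ->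
  exists2 d, bounded_op d & (forall u, b (d u) = u) /\ (forall u, d (b u) = u).
Proof.
move=> pb e0 h; have [c [pc cc] _] := sqrt_op_ex pb.
have ccE v : c (c v) = b v := congr1 (@^~ v) cc.
have lb := bounded_lin pb.1.
have cn u : nrm (c u) ^+ 2 = complex.Re '[b u, u].
  by rewrite -ccE (pos_op_sa pc) dotE.
have e1 : 0 < Num.sqrt e by rewrite sqrtr_gt0.
have cs v : exists w, c w = v.
  have [|||w hw] := @riesz _ _ H c (fun y => '[y, v]) ((Num.sqrt e)^-1 * nrm v).
  - by apply: bounded_lin; case: pc.
  - by move=> k x y; rewrite dotDl dotZl.
  - move=> y; apply: le_trans (dot_le _ _) _.
    rewrite mulrAC ler_wpM2r ?nrm_ge0// ler_pdivlMl//.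
    rewrite -(ler_pXn2r (_ : 0 < 2)%N) ?nnegrE ?mulr_ge0 ?nrm_ge0 ?sqrtr_ge0//.
    by rewrite exprMn sqr_sqrtr ?(ltW e0)// cn.
  by exists w; apply: dot0_eqr => y; rewrite hw (pos_op_sa pc).
have bs v : exists w, b w = v.
  by have [w <-] := cs v; have [w' <-] := cs w; exists w'; rewrite ccE.
have bd u : e * nrm u <= nrm (b u).
  have := nrm_ge0 u; rewrite le0r => /orP[/eqP->|u0]; first by rewrite mulr0 nrm_ge0.
  rewrite -(ler_pM2r u0) -mulrA -expr2; apply: le_trans (h u) _; exact: Re_dot_le.
have /choice[d hd] := bs.
have bi u v : b u = b v -> u = v.
  move=> uv; apply/eqP; rewrite -subr_eq0; apply/eqP/nrm_eq0/eqP.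
  have := bd (u - v); rewrite (linB lb) uv subrr nrm0 pmulr_rle0// => h2.
  by rewrite eq_le h2 nrm_ge0.
exists d; last by split=> // u; apply: bi.
apply/bounded_opP; split; first by move=> k u v; apply: bi; rewrite lb !hd.
exists e^-1; first by rewrite invr_ge0 ltW.
by move=> u; rewrite ler_pdivlMl// -[in leRHS](hd u).
Qed.

End Roots.

(** * Maximality of the product of commuting roots *)

Section OperatorMaximality.
Context {R : realType} {H : hilbertType R}.
Local Notation C := R[i].
Implicit Types (u v w : H) (a b c : H -> H).

(** Suppose that the supremum [la] of the quadratic form of [T = X - Y] on the
    unit sphere is positive.  Since [la - T] is positive, a unit vector [u] that
    nearly attains [la] is an approximate eigenvector, so [X u] is close to
    [la u + Y u], whose squared norm is at least [la ^+ 2 + nrm (Y u) ^+ 2].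
    This contradicts [nrm (X u) <= nrm (Y u)]. *)
Lemma hermitian_le (X Y : H -> H) : bounded_op X -> adjoint X X -> pos_op Y ->
  (forall w, nrm (X w) <= nrm (Y w)) ->
  forall u, complex.Re '[X u, u] <= complex.Re '[Y u, u].
Proof.
move=> bX sX pY XY u0; rewrite leNgt; apply/negP => XYu0.
have bY : bounded_op Y by case: pY.
pose T u := -1 *: Y u + X u.
have bT : bounded_op T by exact: bounded_comb.
have lT := bounded_lin bT.
have TE u : complex.Re '[T u, u] = complex.Re '[X u, u] - complex.Re '[Y u, u].
  by rewrite dotDl dotZl mulN1r ReD ReN addrC.
have sT : adjoint T T.
  by move=> u v; rewrite dotDl dotDr dotZl dotZr rmorphN rmorph1 sX (pos_op_sa pY).
have /bounded_opP[_ [K K0 hK]] := bT; have /bounded_opP[_ [L L0 hL]] := bY.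
pose A := [set complex.Re '[T u, u] | u in [set u : H | nrm u = 1]].
have scal u : nrm u != 0 -> exists2 v, nrm v = 1 & complex.Re '[T u, u] = nrm u ^+ 2 * complex.Re '[T v, v].
  move=> u1; exists ((nrm u)^-1%:C *: u).
    by rewrite nrmZ nrm_real ger0_norm ?invr_ge0 ?nrm_ge0// mulVf.
  by rewrite (linZ lT) dotZl dotZr conjr !ReImE /=; field.
have Tu0 : 0 < complex.Re '[T u0, u0] by rewrite TE subr_gt0.
have nu0 : nrm u0 != 0.
  apply/eqP => /nrm_eq0 u00; move: Tu0; rewrite u00 dot0r /= ltxx //.
have hA : has_sup A.
  split; first by have [v v1 _] := scal _ nu0; exists (complex.Re '[T v, v]), v.
  exists K => _ [v /= v1 <-]; apply: le_trans (Re_dot_le _ _) _.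
  by rewrite v1 mulr1; have := hK v; rewrite v1 mulr1.
pose la := sup A.
have supA v : nrm v = 1 -> complex.Re '[T v, v] <= la.
  by move=> v1; apply: (sup_upper_bound hA); exists v.
have Tla u : complex.Re '[T u, u] <= la * nrm u ^+ 2.
  have [/nrm_eq0 ->|u1] := eqVneq (nrm u) 0; first by rewrite dot0r nrm0 expr0n mulr0.
  by have [v v1 ->] := scal _ u1; rewrite mulrC ler_wpM2r ?sqr_ge0// supA.
have la0 : 0 < la.
  by have := lt_le_trans Tu0 (Tla u0); rewrite pmulr_lgt0// lt_def sqr_ge0 sqrf_eq0 nu0.
have laE : la = sup A by [].
clearbody la.
pose P u := -1 *: T u + (la%:C *: u).
have bP : bounded_op P.
  apply: bounded_comb => //; apply/bounded_opP; split.
    by move=> k u v; rewrite scalerDr !scalerA mulrC.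
  by exists (nrm la%:C); rewrite ?nrm_ge0// => u; rewrite nrmZ.
have PE u : complex.Re '[P u, u] = la * nrm u ^+ 2 - complex.Re '[T u, u].
  by rewrite dotDl !dotZl mulN1r dotE !ReImE /=; ring.
have pP : pos_op P.
  apply: pos_op_of_sa => //.
    by move=> u v; rewrite dotDl dotDr !dotZl !dotZr rmorphN rmorph1 conjr sT.
  by move=> u; rewrite PE subr_ge0.
have laK : 0 < la + K by rewrite ltr_pwDl.
have Psq u : nrm (P u) ^+ 2 <= (la + K) * complex.Re '[P u, u].
  apply: pos_op_sqr_le => //; first exact: ltW.
  move=> v; rewrite PE mulrDl lerD2l.
  have := le_trans (Re_le_nrm _) (dot_le (T v) v).
  rewrite ler_norml => /andP[h _]; rewrite lerNl; apply: le_trans h.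
  by rewrite lerN2 expr2 mulrA ler_wpM2r ?nrm_ge0.
(* r is small enough for 2 * L * r + r ^+ 2 < la ^+ 2, where L bounds Y *)
pose r := la / (2 * L + la + 1) * la.
have d0 : 0 < 2 * L + la + 1 by lra.
have r0 : 0 < r by rewrite /r mulr_gt0 ?divr_gt0.
have rE : r * (2 * L + la + 1) = la ^+ 2 by rewrite /r; field; rewrite gt_eqF.
have rla : r <= la.
  by rewrite /r; apply: ler_piMl; [exact: ltW|rewrite ler_pdivrMr// mul1r; lra].
have eta0 : 0 < r ^+ 2 / (la + K) by rewrite divr_gt0 // exprn_gt0.
have [u u1 hu] : exists2 u, nrm u = 1 & la - r ^+ 2 / (la + K) < complex.Re '[T u, u].
  by rewrite {1}laE; have [_ [u /= u1 <-] hu] := sup_adherent eta0 hA; exists u.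
have Pu : nrm (P u) <= r.
  rewrite -(ler_pXn2r (_ : 0 < 2)%N) ?nnegrE ?nrm_ge0 ?(ltW r0)//.
  apply: le_trans (Psq u) _; rewrite mulrC -ler_pdivlMr// PE u1 expr1n mulr1.
  by move: hu; move: (r ^+ 2 / _) => q; lra.
have XE : X u = (la%:C *: u + Y u) - P u.
  by rewrite /P /T !scaleN1r opprD opprK [RHS]addrC (addrC (_ *: u)) addrACA addNr addr0 addrAC addNr add0r.
have h1 : nrm (la%:C *: u + Y u) <= nrm (Y u) + r.
  have -> : la%:C *: u + Y u = X u + P u by rewrite XE subrK.
  by apply: le_trans (nrmD _ _) _; apply: lerD.
have h2 : la ^+ 2 + nrm (Y u) ^+ 2 <= nrm (la%:C *: u + Y u) ^+ 2.
  rewrite nrm_sqrD nrmZ u1 mulr1 nrm_real real_normK ?num_real// lerD2r lerDl.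
  by rewrite dotZl -(pos_op_sa pY) Re_mul /= mul0r subr0 !mulr_ge0 ?pos_op_ge0 ?(ltW la0).

have h3 : nrm (la%:C *: u + Y u) ^+ 2 <= (nrm (Y u) + r) ^+ 2.
  by rewrite ler_pXn2r ?nnegrE ?nrm_ge0 ?addr_ge0 ?nrm_ge0 ?(ltW r0).
have h4 := hL u; rewrite u1 mulr1 in h4.
have h5 : nrm (Y u) * r <= L * r by rewrite ler_wpM2r// ltW.
have h6 : r ^+ 2 <= r * la by rewrite expr2 ler_wpM2l// ltW.
have := le_trans h2 h3; rewrite sqrrD -rE -mulr_natr.
move: h5 h6 r0; clear; move: (nrm (Y u)) => y; lra.
Qed.

(** After replacing [a], [b] by [e + a], [e + b] the operator [b] has an inverse
    [d], and [hermitian_le] applies to [d D d] and [a d]; then let [e] tend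
    to 0. *)
Lemma commuting_max a b (D : H -> H) : pos_op a -> pos_op b -> a \o b = b \o a ->
  bounded_op D -> adjoint D D ->
  (forall u v, nrm '[D u, v] <= nrm (a u) * nrm (b v)) ->
  forall u, complex.Re '[D u, u] <= complex.Re '[a u, b u].
Proof.
move=> pa pb ab bD sD hD u.
have la := bounded_lin pa.1; have lb := bounded_lin pb.1.
have abE v : a (b v) = b (a v) := congr1 (@^~ v) ab.
(* sh e c is the operator e + c, which is bounded below for positive c *)
pose sh (e : R) (c : H -> H) v := e%:C *: v + c v.
have shP (e : R) c : 0 < e -> pos_op c -> pos_op (sh e c).
  move=> e0 pc; apply: pos_op_of_sa.
  - exact: bounded_comb bounded_id pc.1.
  - by move=> x y; rewrite dotDl dotDr dotZl dotZr conjr (pos_op_sa pc).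
  - move=> x; rewrite dotDl dotZl dotE -rmorphM ReD /=.
    by rewrite addr_ge0 ?pos_op_ge0// mulr_ge0 ?sqr_ge0 ?ltW.
have shge (e : R) c v : 0 < e -> pos_op c -> nrm (c v) <= nrm (sh e c v).
  move=> e0 pc; rewrite -(ler_pXn2r (_ : 0 < 2)%N) ?nnegrE ?nrm_ge0//.
  rewrite /sh nrm_sqrD dotZl -(pos_op_sa pc) Re_mul /= mul0r subr0 lerDr addr_ge0 ?sqr_ge0//.
  by rewrite !mulr_ge0 ?pos_op_ge0// ltW.
have key (e : R) : 0 < e -> complex.Re '[D u, u] <= complex.Re '[sh e a u, sh e b u].
  move=> e0; have pA := shP e a e0 pa; have pB := shP e b e0 pb.
  have [|d bd [Bd dB]] := pos_op_inv pB e0.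
    move=> v; rewrite dotDl dotZl dotE -rmorphM ReD /= lerDl; exact: pos_op_ge0.
  have sd : adjoint d d.
    by move=> x y; rewrite -{1}(Bd y) -(pos_op_sa pB) Bd.
  suff : complex.Re '[(d \o D \o d) (sh e b u), sh e b u] <= complex.Re '[(sh e a \o d) (sh e b u), sh e b u].
    by rewrite /= dB sd dB.
  apply: hermitian_le.
  - by apply: bounded_comp => //; apply: bounded_comp.
  - by move=> x y /=; rewrite sd sD -sd.
  - have AB v : sh e a (sh e b v) = sh e b (sh e a v).
      by rewrite /sh la lb abE !scalerDr addrACA.
    split; first by apply: bounded_comp => //; case: pA.
    move=> w /=; rewrite -{2}(Bd w) -(pos_op_sa pB).
    have pc : pos_op (sh e b \o sh e a).
      by apply: pos_op_comp => //; apply/funext => v /=; rewrite AB.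
    by case: pc => _ /(_ (d w)).
  - move=> w /=; set x := d (D (d w)).
    have := nrm_ge0 x; rewrite le0r => /orP[/eqP->|x0]; first exact: nrm_ge0.
    rewrite -(ler_pM2r x0) -expr2 -[nrm x ^+ 2]ger0_norm ?sqr_ge0// -nrm_real -dotE.
    rewrite {1}/x sd; apply: le_trans (hD _ _) _.
    apply: ler_pM; rewrite ?nrm_ge0//; first exact: shge.
    by apply: le_trans (shge e b _ e0 pb) _; rewrite Bd.
pose k := complex.Re '[u, b u] + complex.Re '[a u, u] + nrm u ^+ 2.
have k0 : 0 <= k by rewrite /k -(pos_op_sa pb) !addr_ge0 ?pos_op_ge0 ?sqr_ge0.
have key2 (e : R) : 0 < e -> e <= 1 -> complex.Re '[D u, u] <= complex.Re '[a u, b u] + e * k.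
  move=> e0 e1; apply: le_trans (key e e0) _.
  rewrite /sh dotDl !dotDr !dotZl !dotZr !conjr dotE -!rmorphM !ReImE /=.
  rewrite /k; have : e * (e * nrm u ^+ 2) <= e * nrm u ^+ 2.
    by apply: ler_wpM2l; [exact: ltW|apply: ler_piMl => //; exact: sqr_ge0].
  move: (e * (e * _)) (complex.Re _) (complex.Re _) (complex.Re _) => p x y z; lra.
apply/ler_addgt0Pr => e e0.
have m0 : 0 < Num.min 1 (e / (k + 1)) by rewrite lt_min ltr01 divr_gt0 // ltr_wpDl.
have m1 : Num.min 1 (e / (k + 1)) <= 1 by rewrite ge_min lexx.
apply: le_trans (key2 _ m0 m1) _; rewrite lerD2l.
apply: le_trans (_ : e / (k + 1) * k <= _).
  by rewrite ler_wpM2r// ge_min lexx orbT.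
by rewrite mulrAC ler_pdivrMr ?ltr_wpDl// ler_pM2l// lerDl.
Qed.

End OperatorMaximality.

(** * The geometric mean of positive forms *)

Section FormMean.
Context {R : realType} {V : lmodType R[i]}.
Local Notation C := R[i].
Implicit Types (al be ga de : V -> V -> C).

Lemma pos_formD al be : pos_form al -> pos_form be -> pos_form (fun x y => al x y + be x y).
Proof.
move=> pa pb; have ha := pos_form_sesq pa; have hb := pos_form_sesq pb.
split=> [y c u v|x c u v|x] /=.
- by rewrite (sesqDl ha) (sesqZl ha) (sesqDl hb) (sesqZl hb) mulrDr addrACA.
- by rewrite (sesqDr ha) (sesqZr ha) (sesqDr hb) (sesqZr hb) mulrDr addrACA.
- by rewrite addr_ge0 ?pos_form_ge0.
Qed.

(** In the completion for [al + be] the two forms are given by positive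
    operators with [A + B = 1], which therefore commute. *)
Lemma is_form_gmean_ex al be : pos_form al -> pos_form be -> exists ga, is_form_gmean al be ga.
Proof.
move=> pa pb; have [H [h [dh hs]]] := hilbert_completion (pos_formD pa pb).
have nE x : nrm (h x) ^+ 2 = complex.Re (al x x) + complex.Re (be x x).
  by have := dotE (h x); rewrite hs => e; rewrite -ReD e.
have op de : pos_form de -> (forall x, complex.Re (de x x) <= nrm (h x) ^+ 2) ->
    exists2 A : H -> H, pos_op A & forall x y, de x y = '[A (h x), h y].
  move=> pd hd; have sn x : seminorm de x <= nrm (h x).
    by rewrite -(ler_pXn2r (_ : 0 < 2)%N) ?nnegrE ?nrm_ge0 ?seminorm_ge0// seminorm_sqr.
  have [|A bA AE] := form_op dh (pos_form_sesq pd) ler01.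
    move=> x y; rewrite mul1r; apply: le_trans (seminorm_CS pd x y) _.
    by apply: ler_pM; rewrite ?seminorm_ge0.
  exists A => //; split=> // u; have [x xu] := dense_seq dh u.
  apply: ncvg_ge0 (ncvg_dot (bounded_ncvg bA xu) xu) => n /=.
  by rewrite -AE pos_form_ge0.
have [|A pA AE] := op al pa.
  by move=> x; rewrite nE lerDl; case/ge0C: (pos_form_ge0 x pb).
have [|B pB BE] := op be pb.
  by move=> x; rewrite nE lerDr; case/ge0C: (pos_form_ge0 x pa).
have sum1 u : A u + B u = u.
  have [x xu] := dense_seq dh u.
  have e z : A (h z) + B (h z) = h z.
    apply: (dense_ext dh) => y; rewrite dotDr (dotC (A _)) (dotC (B _)) -AE -BE -rmorphD.
    by rewrite [RHS]dotC; congr (Num.conj _); rewrite hs.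
  apply: (@ncvg_uniq _ _ (fun n => A (h (x n)) + B (h (x n)))).
    by apply: ncvgD; [exact: bounded_ncvg pA.1 xu|exact: bounded_ncvg pB.1 xu].
  by apply: ncvg_eq xu => n /=; rewrite e.
have AB : A \o B = B \o A.
  apply/funext => u /=; have eB v : B v = v - A v by rewrite -[X in X - _]sum1 addrC addKr.
  by rewrite !eB (linB (bounded_lin pA.1)).
have [c sc _] := sqrt_op_ex (pos_op_comp pA pB AB).
exists (fun x y => '[c (h x), h y]).
by exists (CompatRep dh pA pB AB AE BE), c.
Qed.

Lemma form_gmeanP al be : pos_form al -> pos_form be -> is_form_gmean al be (form_gmean al be).
Proof. by move=> pa pb; apply: xgetPex; exact: is_form_gmean_ex. Qed.

(** With [c = a \o b] the block form is [nrm (a (h x) + b (h y)) ^+ 2]. *)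
Lemma is_form_gmean_pos_block al be ga : is_form_gmean al be ga -> pos_form ga /\ block_pos al ga be.
Proof.
move=> [r [c [sc gE]]].
have [a [b [[pa aa] [pb bb] ab cE]]] := commuting_sqrt (cr_posA r) (cr_posB r) (cr_commute r) sc.
have {}gE x y : ga x y = '[a (cr_map r x), b (cr_map r y)].
  have abE v : a (b v) = b (a v) := congr1 (@^~ v) ab.
  by rewrite gE cE /= abE (pos_op_sa pb).
have alE x y : al x y = '[a (cr_map r x), a (cr_map r y)].
  by rewrite (cr_alphaE r) -aa /= (pos_op_sa pa).
have beE x y : be x y = '[b (cr_map r x), b (cr_map r y)].
  by rewrite (cr_betaE r) -bb /= (pos_op_sa pb).
have [pc _] := sc.
split.
  split=> [y k u v|x k u v|x].
  - by rewrite !gE linearP (bounded_lin pa.1) dotDl dotZl.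
  - by rewrite !gE linearP (bounded_lin pb.1) dotDr dotZr.
  - by rewrite gE -(pos_op_sa pb) -[b (a _)](congr1 (@^~ _) ab); case: (pos_op_comp pa pb ab).
move=> x y; rewrite alE beE !gE.
set p := a (cr_map r x); set q := b (cr_map r y).
have -> : '[a (cr_map r y), b (cr_map r x)] = '[q, p].
  have abE v : a (b v) = b (a v) := congr1 (@^~ v) ab.
  by rewrite (pos_op_sa pa) abE -(pos_op_sa pb).
by rewrite -addrA -dotDr -dotDr -dotDl dotE lecR sqr_ge0.
Qed.

Lemma is_form_gmean_max al be ga de : pos_form al -> pos_form be -> is_form_gmean al be ga ->
  pos_form de -> block_pos al de be ->
  forall x, complex.Re (de x x) <= complex.Re (ga x x).
Proof.
move=> pal pbe [r [c [sc gE]]] pd bp x0.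
have [a [b [[pa aa] [pb bb] ab cE]]] := commuting_sqrt (cr_posA r) (cr_posB r) (cr_commute r) sc.
set h := cr_map r; have dh : dense (range h) := @cr_dense _ _ _ _ r.
have abE v : a (b v) = b (a v) := congr1 (@^~ v) ab.
have dle x y : nrm (de x y) <= nrm (a (h x)) * nrm (b (h y)).
  rewrite -(ler_pXn2r (_ : 0 < 2)%N) ?nnegrE ?mulr_ge0 ?nrm_ge0// exprMn.
  apply: le_trans (block_CS x y pal pbe (pos_form_sesq pd) (fun x y => pos_form_herm x y pd) bp) _.
  by rewrite (cr_alphaE r) (cr_betaE r) -aa -bb /= (pos_op_sa pa) (pos_op_sa pb) !dotE.
have /bounded_opP[_ [K K0 hK]] := pa.1; have /bounded_opP[_ [L L0 hL]] := pb.1.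
have [||D bD DE] := @form_op _ _ _ h de (K * L) dh (pos_form_sesq pd).
- exact: mulr_ge0.
- move=> x y; apply: le_trans (dle x y) _.
  have -> : K * L * nrm (h x) * nrm (h y) = (K * nrm (h x)) * (L * nrm (h y)) by ring.
  by apply: ler_pM; rewrite ?nrm_ge0.
rewrite DE gE cE /= -/h abE (pos_op_sa pb); apply: commuting_max => //.
- move=> u v; have [x xu] := dense_seq dh u; have [y yv] := dense_seq dh v.
  apply: (@ncvg_uniq _ _ (fun n => '[D (h (x n)), h (y n)])).
    exact: ncvg_dot (bounded_ncvg bD xu) yv.
  apply: (ncvg_eq (u := fun n => '[h (x n), D (h (y n))])).
    by move=> n /=; rewrite [LHS]dotC -!DE [RHS](pos_form_herm _ _ pd).
  exact: ncvg_dot xu (bounded_ncvg bD yv).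
- move=> u v; have [x xu] := dense_seq dh u; have [y yv] := dense_seq dh v.
  have l1 := ncvg_nrm (ncvg_dot (bounded_ncvg bD xu) yv).
  have l2 : (fun n => nrm (a (h (x n))) * nrm (b (h (y n)))) @ \oo --> nrm (a u) * nrm (b v).
    by apply: cvgM; [exact: ncvg_nrm (bounded_ncvg pa.1 xu)|exact: ncvg_nrm (bounded_ncvg pb.1 yv)].
  rewrite -(cvg_lim _ l1)// -(cvg_lim _ l2)//; apply: ler_lim.
  - by apply/cvg_ex; eexists; exact: l1.
  - by apply/cvg_ex; eexists; exact: l2.
  - by apply: nearW => n /=; rewrite -DE; exact: dle.
Qed.

Lemma form_gmean_pos al be : pos_form al -> pos_form be -> pos_form (form_gmean al be).
Proof. by move=> pa pb; have [] := is_form_gmean_pos_block (form_gmeanP pa pb). Qed.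
Lemma form_gmean_block al be : pos_form al -> pos_form be -> block_pos al (form_gmean al be) be.
Proof. by move=> pa pb; have [] := is_form_gmean_pos_block (form_gmeanP pa pb). Qed.
Lemma form_gmean_max al be de : pos_form al -> pos_form be -> pos_form de -> block_pos al de be ->
  forall x, complex.Re (de x x) <= complex.Re (form_gmean al be x x).
Proof. by move=> pa pb; apply: is_form_gmean_max => //; exact: form_gmeanP. Qed.

(** The transported form [form_gmean al be (T x) (T y)] satisfies the block
    condition again, hence lies below [form_gmean al be]; the inverse of [T]
    gives the reverse inequality. *)
Lemma form_gmean_invariant al be (T T' : V -> V) : pos_form al -> pos_form be ->
  linear T -> linear T' -> cancel T T' -> cancel T' T ->
  (forall x y, al (T x) (T y) = al x y) -> (forall x y, be (T x) (T y) = be x y) ->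
  forall x y, form_gmean al be (T x) (T y) = form_gmean al be x y.
Proof.
move=> pa pb lT lT' TK TK' aT bT.
have pg := form_gmean_pos pa pb; set ga := form_gmean al be in pg *.
have hg := pos_form_sesq pg.
have tr (S S' : V -> V) : linear S -> (forall x y, al (S x) (S y) = al x y) -> (forall x y, be (S x) (S y) = be x y) ->
    pos_form (fun x y => ga (S x) (S y)) /\ forall x, complex.Re (ga (S x) (S x)) <= complex.Re (ga x x).
  move=> lS aS bS; have p : pos_form (fun x y => ga (S x) (S y)).
    split=> [y k u v|x k u v|x] /=.
    - by rewrite lS (sesqDl hg) (sesqZl hg).
    - by rewrite lS (sesqDr hg) (sesqZr hg).
    - exact: pos_form_ge0.
  split=> // x; apply: (form_gmean_max pa pb p) => u v.
  by have := form_gmean_block pa pb (S u) (S v); rewrite aS bS.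
have [p1 h1] := tr T T' lT aT bT.
have [||p2 h2] := tr T' T lT'.
- by move=> x y; rewrite -aT !TK'.
- by move=> x y; rewrite -bT !TK'.
apply: (sesq_ext (pos_form_sesq p1) hg) => x.
apply: Cext; last first.
  by have /ge0C[-> _] := pos_form_ge0 (T x) pg; have /ge0C[-> _] := pos_form_ge0 x pg.
by apply/eqP; rewrite eq_le h1 /=; have := h2 (T x); rewrite TK.
Qed.

End FormMean.

(** * Matrices over a von Neumann algebra *)

Section DirectSum.
Context {R : realType} (H : hilbertType R) (n : nat).
Local Notation C := R[i].
Local Notation V := ('I_n -> H).

Definition dsum_form (u v : V) : C := \sum_i '[u i, v i].

Lemma dsum_pos : pos_form dsum_form.
Proof.
split=> [y c u v|x c u v|x]; rewrite /dsum_form.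
- rewrite mulr_sumr -big_split; apply: eq_bigr => i _ /=.
  by rewrite -dotZl -dotDl.
- rewrite /= mulr_sumr -big_split; apply: eq_bigr => i _ /=.
  by rewrite -dotZr -dotDr.
- by apply: sumr_ge0 => i _; rewrite dotE lecR sqr_ge0.
Qed.

Lemma dsum_seminorm_sqr (u : V) : seminorm dsum_form u ^+ 2 = \sum_i nrm (u i) ^+ 2.
Proof.
rewrite (seminorm_sqr dsum_pos) Re_sum; apply: eq_bigr => i _.
by rewrite dotE.
Qed.

Lemma dsum_coord (u : V) i : nrm (u i) <= seminorm dsum_form u.
Proof.
rewrite -(ler_pXn2r (_ : 0 < 2)%N) ?nnegrE ?nrm_ge0 ?seminorm_ge0// dsum_seminorm_sqr.
by rewrite (bigD1 i) //= lerDl sumr_ge0// => j _; exact: sqr_ge0.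
Qed.

Lemma dsum_le_sum (u : V) : seminorm dsum_form u <= \sum_i nrm (u i).
Proof.
rewrite -(ler_pXn2r (_ : 0 < 2)%N) ?nnegrE ?sumr_ge0 ?seminorm_ge0//; last first.
  by move=> i _; exact: nrm_ge0.
rewrite dsum_seminorm_sqr.
have [] : \sum_i nrm (u i) ^+ 2 <= (\sum_i nrm (u i)) ^+ 2 /\ 0 <= \sum_i nrm (u i); last by [].
elim/big_rec2: _ => [|i y x _ [h x0]]; first by rewrite expr0n.
split; last by rewrite addr_ge0 ?nrm_ge0.
rewrite sqrrD -addrA lerD2l (le_trans h)// lerDr -mulr_natr mulr_ge0// mulr_ge0//; exact: nrm_ge0.
Qed.

Lemma dsum_definite (u : V) : dsum_form u u = 0 -> u = 0.
Proof.
move=> h; apply/funext => i; apply: nrm_eq0; apply/eqP; rewrite eq_le nrm_ge0 andbT.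
by apply: le_trans (dsum_coord u i) _; rewrite /seminorm h sqrtr0.
Qed.

Lemma dsum_complete (u : nat -> V) : sn_cauchy dsum_form u ->
  exists l, (fun n => seminorm dsum_form (u n - l)) @ \oo --> (0 : R).
Proof.
move=> cu; have /choice[l hl] : forall i, exists l, ncvg (fun k => u k i) l.
  move=> i; apply: cauchy_ncvg => e e0; have [N hN] := cu e e0; exists N => k m Nk Nm.
  by apply: le_lt_trans (dsum_coord (u k - u m) i) (hN _ _ Nk Nm).
exists l; apply: (squeeze_cvg0 (b := fun k => \sum_i nrm (u k i - l i))).
  by move=> k; rewrite seminorm_ge0 dsum_le_sum.
elim: (index_enum _) => [|i s IH].
  by under eq_fun do rewrite big_nil; exact: cvg_cst.
under eq_fun do rewrite big_cons.
have : (fun k => nrm (u k i - l i) + \sum_(j <- s) nrm (u k j - l j)) @ \oo --> (0 + 0 : R).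
  by apply: cvgD; [exact: (hl i)|exact: IH].
by rewrite addr0.
Qed.

Definition dsum : hilbertType R :=
  hilbert_of (InnerSpace dsum_pos dsum_definite dsum_complete).

Lemma dsum_dot (u v : dsum) : '[u, v] = \sum_i '[(u : V) i, (v : V) i].
Proof. by []. Qed.

Lemma dsum_nrm (u : dsum) : nrm u = seminorm dsum_form u.
Proof. by []. Qed.

Definition dsum_inj (j : 'I_n) (v : H) : dsum := fun k => if k == j then v else 0.

Lemma dsum_inj_dotr (u : dsum) j v : '[u, dsum_inj j v] = '[(u : V) j, v].
Proof.
rewrite dsum_dot (bigD1 j) //= /dsum_inj eqxx big1 ?addr0// => k /negPf ->.
by rewrite dot0r.
Qed.

Lemma dsum_inj_lin j : linear (dsum_inj j).
Proof.
move=> c u v; apply/funext => k.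
transitivity (c *: dsum_inj j u k + dsum_inj j v k); last by [].
rewrite /dsum_inj; by case: eqP => // _; rewrite scaler0 addr0.
Qed.

End DirectSum.

Section MatrixOps.
Context {R : realType} {H : hilbertType R} {n : nat}.
Local Notation C := R[i].

Lemma matrix_op_bounded (a : 'I_n -> 'I_n -> H -> H) : (forall i j, bounded_op (a i j)) ->
  bounded_op ((fun u i => \sum_j a i j (u j)) : dsum H n -> dsum H n).
Proof.
move=> ba; apply/bounded_opP; split.
  move=> c u v; apply/funext => i.
  transitivity (c *: (\sum_j a i j ((u : 'I_n -> H) j)) + \sum_j a i j ((v : 'I_n -> H) j)); last by [].
  rewrite scaler_sumr -big_split.
  by apply: eq_bigr => j _; rewrite (bounded_lin (ba i j)).
have /choice[K hK] : forall p : 'I_n * 'I_n, exists K, 0 <= K /\ forall u, nrm (a p.1 p.2 u) <= K * nrm u.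
  by move=> p; have /bounded_opP[_ [K K0 h]] := ba p.1 p.2; exists K.
exists (\sum_i \sum_j K (i, j)).
  by apply: sumr_ge0 => i _; apply: sumr_ge0 => j _; have [] := hK (i, j).
move=> u; rewrite !dsum_nrm; apply: le_trans (dsum_le_sum _) _.
rewrite mulr_suml; apply: ler_sum => i _; rewrite mulr_suml.
have h : nrm (\sum_j a i j ((u : 'I_n -> H) j)) <= \sum_j nrm (a i j ((u : 'I_n -> H) j)).
  elim/big_rec2: _ => [|j y x _ h]; first by rewrite nrm0.
  by apply: le_trans (nrmD _ _) _; rewrite lerD2l.
apply: le_trans h _; apply: ler_sum => j _; have [K0 h] := hK (i, j).
by apply: le_trans (h _) _; rewrite ler_wpM2l// dsum_coord.
Qed.

End MatrixOps.

Section VN.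
Context {R : realType}.
Local Notation C := R[i].
Implicit Types (M : vnAlgebra R).

Lemma vn_opD M (x y : M) u : (x + y) u = x u + y u. Proof. by []. Qed.
Lemma vn_opN M (x : M) u : (- x) u = - x u. Proof. by []. Qed.
Lemma vn_op0 M u : (0 : M) u = 0. Proof. by []. Qed.
Lemma vn_opB M (x y : M) u : (x - y) u = x u - y u. Proof. by []. Qed.
Lemma vn_opZ M c (x : M) u : (c *: x) u = c *: x u. Proof. by []. Qed.
Lemma vn_op_sum M I (r : seq I) (P : pred I) (F : I -> M) u :
  (\sum_(i <- r | P i) F i) u = \sum_(i <- r | P i) F i u.
Proof. by elim/big_rec2: _ => // i y x _ <-. Qed.
Lemma vn_opM M (x y : M) u : (x *v y) u = x (y u). Proof. by []. Qed.

Lemma vn_opS M (x : M) : vn_set (vn_op x). Proof. exact/vn_predP/vn_opP. Qed.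
Lemma vn_op_bounded M (x : M) : bounded_op (vn_op x).
Proof. exact/vn_bounded/vn_opS. Qed.
Lemma vn_op_lin M (x : M) : linear (vn_op x). Proof. by case: (vn_op_bounded x). Qed.

Lemma vn_starP M (x : M) : adjoint x x^\*.
Proof. exact: projT2 (cid (vn_star_subproof x)). Qed.
Lemma vn_starPl M (x : M) u v : '[x^\* u, v] = '[u, x v].
Proof. by rewrite dotC -vn_starP -dotC. Qed.

Lemma vn_ext M (x y : M) : (forall u v, '[x u, v] = '[y u, v]) -> x = y.
Proof. by move=> h; apply: val_inj; apply: op_ext. Qed.

(** The bicommutant property, as the way to produce elements of [M]. *)
Lemma vn_bicomm M (a : vn_space M -> vn_space M) : bounded_op a ->
  (forall b, commutant (vn_set (v := M)) b -> a \o b = b \o a) -> exists x : M, vn_op x = a.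
Proof.
move=> ba h; have Ma : vn_set (v := M) a.
  by rewrite -vn_bicommutant; split=> // b /h.
by exists (VNElt (introT (vn_predP _) Ma)).
Qed.

(** The root of the matrix operator on the n-fold direct sum commutes with the
    diagonal action of the commutant of [M], so its entries lie in the
    bicommutant [M]. *)
Lemma matrix_sqrt M n (a : 'M[M]_n) : mx_pos a -> exists c : 'M[M]_n,
  forall i j, a i j = \sum_r (c r i)^\* *v c r j.
Proof.
move=> pa; pose H := vn_space M.
pose T : dsum H n -> dsum H n := fun u i => \sum_j a i j (u j).
have bT : bounded_op T by apply: (matrix_op_bounded (a := fun i j => vn_op (a i j))) => i j; exact: vn_op_bounded.
have pT : pos_op T.
  split=> // u; rewrite dsum_dot /T.
  have -> : \sum_i '[\sum_j a i j ((u : 'I_n -> H) j), (u : 'I_n -> H) i] =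
      \sum_i \sum_j '[a i j ((u : 'I_n -> H) j), (u : 'I_n -> H) i].
    by apply: eq_bigr => i _; rewrite dot_suml.
  exact: pa.
have [S [pS SS] Sc] := sqrt_op_ex pT.
pose c0 (i j : 'I_n) (v : H) : H := (S (dsum_inj j v) : 'I_n -> H) i.
have lS := bounded_lin pS.1; have /bounded_opP[_ [K K0 hK]] := pS.1.
have bc0 i j : bounded_op (c0 i j).
  apply/bounded_opP; split; first by move=> k u v; rewrite /c0 dsum_inj_lin lS.
  exists K => // v; apply: le_trans (dsum_coord _ i) _; apply: le_trans (hK _) _.
  rewrite ler_wpM2l// dsum_nrm; apply: le_trans (dsum_le_sum _) _.
  rewrite (bigD1 j) //= /dsum_inj eqxx big1 ?addr0// => k /negPf ->; exact: nrm0.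
have cc0 i j : exists x : M, vn_op x = c0 i j.
  apply: vn_bicomm => // b [bb hb]; have lb := bounded_lin bb.
  (* the diagonal action of b, bounded because it is a matrix operator *)
  pose B : dsum H n -> dsum H n := fun u i => b (u i).
  have bB : bounded_op B.
    have -> : B = fun u i => \sum_j (if j == i then b (u j) else 0).
      by apply/funext => u; apply/funext => k; rewrite -big_mkcond big_pred1_eq.
    have -> : (fun u i => \sum_j (if j == i then b (u j) else 0)) =
      (fun u i => \sum_j (fun i j v => if j == i then b v else 0) i j (u j)) :> (dsum H n -> dsum H n) by [].
    apply: (matrix_op_bounded (a := fun i j v => if j == i then b v else 0)) => k l; case: eqP => // _; apply/bounded_opP; split.
      by move=> q u v; rewrite scaler0 addr0.
    by exists 0 => // u; rewrite nrm0 mul0r.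
  have TB : T \o B = B \o T.
    apply/funext => u; apply/funext => k; rewrite /= /T /B (lin_sum lb).
    apply: eq_bigr => l _; have := hb _ (vn_opS (a k l)).
    by move=> /(congr1 (@^~ ((u : 'I_n -> H) l))).
  have SB := Sc B bB TB.
  apply/funext => v /=; rewrite /c0.
  have -> : dsum_inj j (b v) = B (dsum_inj j v).
    by apply/funext => k; rewrite /B /dsum_inj; case: eqP => // _; rewrite (lin0 lb).
  by have /= -> := congr1 (@^~ (dsum_inj j v)) SB.
have /choice[c1 hc1] : forall p : 'I_n * 'I_n, exists x : M, vn_op x = c0 p.1 p.2.
  by move=> p; exact: cc0.
exists (\matrix_(i, j) c1 (i, j)) => i j; apply: vn_ext => u v.
rewrite vn_op_sum dot_suml.
transitivity '[S (dsum_inj j u), S (dsum_inj i v)].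
  have SSE w : S (S w) = T w := congr1 (@^~ w) SS.
  rewrite -(pos_op_sa pS) SSE.
  rewrite dsum_inj_dotr /T (bigD1 j) //= /dsum_inj eqxx big1 ?addr0// => k /negPf ->.
  exact: (lin0 (vn_op_lin _)).
rewrite dsum_dot; apply: eq_bigr => r _.
by rewrite vn_opM vn_starPl !mxE !hc1.
Qed.

End VN.

(** * The star algebra of elements, its squares and its unitaries *)

Section StarAlgebra.
Context {R : realType} {M : vnAlgebra R}.
Local Notation C := R[i].
Implicit Types (x y z : M).

Lemma vn_star_uniq x y : adjoint x y -> x^\* = y.
Proof. by move=> h; apply: vn_ext => u v; rewrite vn_starPl dotC [RHS]dotC h. Qed.

Lemma vn_starK x : x^\*^\* = x.
Proof. by apply: vn_star_uniq => u v; rewrite vn_starPl. Qed.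

Lemma vn_starM x y : (x *v y)^\* = y^\* *v x^\*.
Proof. by apply: vn_star_uniq => u v; rewrite !vn_opM !vn_starP. Qed.

Lemma vn_starD x y : (x + y)^\* = x^\* + y^\*.
Proof. by apply: vn_star_uniq => u v; rewrite !vn_opD dotDl dotDr !vn_starP. Qed.

Lemma vn_starZ (c : C) x : (c *: x)^\* = Num.conj c *: x^\*.
Proof. by apply: vn_star_uniq => u v; rewrite !vn_opZ dotZl dotZr !vn_starP conjCK. Qed.

Lemma vn_star1 : (vn_one M)^\* = vn_one M.
Proof. exact: vn_star_uniq. Qed.

Lemma vn_mulA x y z : x *v (y *v z) = x *v y *v z. Proof. exact: val_inj. Qed.
Lemma vn_mul1l x : vn_one M *v x = x. Proof. exact: val_inj. Qed.
Lemma vn_mul1r x : x *v vn_one M = x. Proof. exact: val_inj. Qed.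
Lemma vn_mulDl x y z : (x + y) *v z = x *v z + y *v z. Proof. exact: val_inj. Qed.
Lemma vn_mulZl c x y : (c *: x) *v y = c *: (x *v y). Proof. exact: val_inj. Qed.
Lemma vn_mulDr x y z : x *v (y + z) = x *v y + x *v z.
Proof. by apply: vn_ext => u v; rewrite vn_opM !vn_opD !vn_opM (linD (vn_op_lin x)). Qed.
Lemma vn_mulZr c x y : x *v (c *: y) = c *: (x *v y).
Proof. by apply: vn_ext => u v; rewrite vn_opM !vn_opZ !vn_opM (linZ (vn_op_lin x)). Qed.
Lemma vn_pos_star x : vn_pos (x^\* *v x).
Proof.
split=> [|u]; first exact: vn_op_bounded.
by rewrite vn_opM vn_starPl dotE lecR sqr_ge0.
Qed.

Lemma vn_sqrt x : vn_pos x -> exists2 s : M, sqrt_op x s &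
  forall y, x *v y = y *v x -> s *v y = y *v s.
Proof.
move=> px; have [s0 [ps ss] sc] := sqrt_op_ex px.
have [s sE] : exists s : M, vn_op s = s0.
  apply: vn_bicomm => [|b [bb hb]]; first by case: ps.
  by apply: sc => //; apply: hb; exact: vn_opS.
exists s; first by rewrite /sqrt_op sE.
move=> y xy; apply: val_inj; rewrite /= sE; apply: sc; first exact: vn_op_bounded.
by have /= := congr1 (@vn_op R M) xy.
Qed.

Lemma vn_pos_square x : vn_pos x -> exists c : M, x = c^\* *v c.
Proof.
move=> /vn_sqrt[s [ps ss] _]; exists s; apply: val_inj; rewrite /= -ss.
by rewrite (vn_star_uniq (pos_op_sa ps)).
Qed.

(** Polarization of [(x + c)^* (x + c)] over the fourth roots of unity [c] writes
    [x] as a combination of squares. *)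
Lemma square_ind (P : M -> Prop) : (forall w, P (w^\* *v w)) ->
  (forall (c : C) x y, P x -> P y -> P (c *: x + y)) -> forall x, P x.
Proof.
move=> hs hl.
have hD x y : P x -> P y -> P (x + y).
  by move=> px py; rewrite -[x]scale1r; apply: hl.
have h0 : P 0.
  by have := hl (-1) _ _ (hs 0) (hs 0); rewrite scaleN1r addNr.
have hZ c x : P x -> P (c *: x) by move=> px; rewrite -[_ *: _]addr0; apply: hl.
move=> x; pose q (c : C) := (x + c *: vn_one M)^\* *v (x + c *: vn_one M).
have qE c : q c = x^\* *v x + c *: x^\* + Num.conj c *: x + (Num.conj c * c) *: vn_one M.
  rewrite /q vn_starD vn_starZ vn_star1 !vn_mulDl !vn_mulDr !vn_mulZl !vn_mulZr !vn_mul1l vn_mul1r.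
  by rewrite !scalerA !addrA.
have sq c : P (q c) by exact: hs.
clearbody q.
have -> : x = (4%:R^-1 : R)%:C *: (q 1 + -1 *: q (-1) + imag *: (q imag + -1 *: q (- imag))).
  have cN : Num.conj (- imag : C) = imag by apply: Cext; rewrite !ReImE /= ?oppr0 ?opprK.
  rewrite !qE cN conj_imag rmorphN rmorph1.
  apply: vn_ext => u v; rewrite !(vn_opZ, vn_opD, vn_opN) !(dotZl, dotDl, dotNl).
  have i2 := @imag_sqr R; set a := '[(x^\* *v x) u, v]; set b := '[x^\* u, v]; set c := '[x u, v].
  set d := '[vn_one M u, v].
  have q4 : (4%:R^-1 : R)%:C * 4%:R = 1 :> C by apply: Cext; rewrite !ReImE /=; field.
  move: ((4%:R^-1 : R)%:C) (imag : C) q4 i2 => f j q4 i2.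
  transitivity (f * 4%:R * c + f * ((1 + j * j) * (2%:R * (b - c)))); last by ring.
  by rewrite i2 subrr mul0r mulr0 addr0 q4 mul1r.
by apply/hZ/hD; [apply/hD/hZ|apply/hZ/hD/hZ].
Qed.

Definition vn_unitary x := x^\* *v x = vn_one M /\ x *v x^\* = vn_one M.

(** A self-adjoint contraction [g] is the mean of the unitaries
    [g + i s] and [g - i s], where [s] is the root of [1 - g^2]. *)
Lemma unitary_ind (P : M -> Prop) : (forall u, vn_unitary u -> P u) ->
  (forall (c : C) x y, P x -> P y -> P (c *: x + y)) -> forall x, P x.
Proof.
move=> hu hl.
have hD x y : P x -> P y -> P (x + y).
  by move=> px py; rewrite -[x]scale1r; apply: hl.
have h0 : P 0.
  have p1 : P (vn_one M) by apply: hu; split; rewrite vn_star1 vn_mul1l.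
  by have := hl (-1) _ _ p1 p1; rewrite scaleN1r addNr.
have hZ c x : P x -> P (c *: x) by move=> px; rewrite -[_ *: _]addr0; apply: hl.
have sa h : h^\* = h -> P h.
  move=> hs; have /bounded_opP[lh [K K0 hK]] := vn_op_bounded h.
  have K1 : 0 < K + 1 by rewrite ltr_wpDl.
  pose g : M := ((K + 1)^-1 : R)%:C *: h.
  have gs : g^\* = g by rewrite vn_starZ conjr hs.
  have gn u : nrm (g u) <= nrm u.
    rewrite vn_opZ nrmZ nrm_real ger0_norm ?invr_ge0 ?(ltW K1)// ler_pdivrMl//.
    by apply: le_trans (hK u) _; rewrite ler_wpM2r ?nrm_ge0// lerDl.
  have hE : h = (K + 1)%:C *: g.
    by rewrite scalerA -rmorphM /= divff ?gt_eqF// scale1r.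
  clearbody g.
  have p : vn_pos (vn_one M - g *v g).
    apply: pos_op_of_sa; first exact: vn_op_bounded.
      move=> u v; rewrite !vn_opB !vn_opM dotBl dotBr -{1 2}gs !vn_starPl.
      by congr (_ - _); rewrite -{2}gs vn_starPl -{2}gs vn_starPl.
    move=> u; rewrite vn_opB vn_opM dotBl ReD ReN dotE subr_ge0 -{1}gs vn_starPl dotE.
    by rewrite /= ler_pXn2r ?nnegrE ?nrm_ge0// gn.
  have [s [ps ss] sc] := vn_sqrt p.
  have {}ss : s *v s = vn_one M - g *v g by apply: val_inj.
  have gsg : s *v g = g *v s.
    apply: (sc g); apply: vn_ext => u v.
    by rewrite !vn_opM !vn_opB !vn_opM (linB (vn_op_lin g)).
  have sss : s^\* = s := vn_star_uniq (pos_op_sa ps).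
  have e1 (a b : C) : b + a = 0 -> a * b = 1 -> (g + a *: s) *v (g + b *: s) = vn_one M.
    move=> ab0 ab1; rewrite !(vn_mulDl, vn_mulDr, vn_mulZl, vn_mulZr) gsg !scalerA.
    rewrite addrA -(addrA (g *v g)) -scalerDl ab0 scale0r addr0 ab1 scale1r ss.
    by rewrite addrC subrK.
  have uU (a : C) : Num.conj a = - a -> a * a = -1 -> vn_unitary (g + a *: s).
    move=> ca aa; rewrite /vn_unitary vn_starD vn_starZ gs sss ca.
    by split; apply: e1; rewrite ?addNr ?subrr// ?mulNr ?mulrN aa opprK.
  have gE : g = (2%:R^-1 : R)%:C *: ((g + imag *: s) + (g + (- imag) *: s)).
    rewrite addrACA -scalerDl subrr scale0r addr0 scalerDr -scalerDl -rmorphD /=.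
    have -> : 2%:R^-1 + 2%:R^-1 = 1 :> R by lra.
    by rewrite scale1r.
  rewrite hE gE; apply/hZ/hZ/hD; apply/hu/uU.
  - exact: conj_imag.
  - exact: imag_sqr.
  - by apply: Cext; rewrite !ReImE /= ?oppr0 ?opprK.
  - by rewrite mulNr mulrN opprK imag_sqr.
move=> x.
have xE : x = (2%:R^-1 : R)%:C *: ((x + x^\*) + (- imag) *: (imag *: (x - x^\*))).
  rewrite [X in _ + X]scalerA mulNr imag_sqr opprK scale1r addrACA subrr addr0 scalerDr -scalerDl -rmorphD /=.
  have -> : 2%:R^-1 + 2%:R^-1 = 1 :> R by lra.
  by rewrite scale1r.
rewrite xE; apply/hZ/hD; last apply/hZ; apply/sa.
  by rewrite vn_starD vn_starK addrC.
have e : (x - x^\*)^\* = - (x - x^\*).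
  transitivity (x^\* + Num.conj (-1) *: x^\*^\*).
    by rewrite -vn_starZ -vn_starD scaleN1r.
  by rewrite rmorphN rmorph1 scaleN1r vn_starK opprB.
by rewrite vn_starZ e conj_imag scaleNr scalerN opprK.
Qed.
End StarAlgebra.

(** * Commutants and standard representations *)

Section CommutantAlgebra.
Context {R : realType} (M : vnAlgebra R).
Local Notation H := (vn_space M).
Local Notation S := (commutant (@vn_set _ M)).

Lemma commutant_linear (k : R[i]) (a b : H -> H) : S a -> S b -> S (k *: a + b).
Proof.
move=> [ba ha] [bb hb]; split; first exact: bounded_comb.
move=> x Mx; apply/funext => u; have [lx _] := vn_bounded Mx.
have /(congr1 (@^~ u)) /= ea := ha x Mx; have /(congr1 (@^~ u)) /= eb := hb x Mx.
transitivity (x (k *: a u + b u)); first by [].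
by rewrite lx ea eb.
Qed.

Lemma commutant_adj (a : H -> H) : S a -> exists2 b, S b & adjoint a b.
Proof.
move=> [ba ha]; have [b bb ab] := adjoint_ex ba; exists b => //; split=> // x Mx.
have [y My xy] := vn_adj Mx; apply: op_ext => u v /=.
have /(congr1 (@^~ v)) /= e := ha y My.
have abl p q : '[b p, q] = '[p, a q] by rewrite dotC -ab -dotC.
by rewrite xy abl -e -xy -abl.
Qed.

Lemma commutant_comp (a b : H -> H) : S a -> S b -> S (a \o b).
Proof.
move=> [ba ha] [bb hb]; split; first exact: bounded_comp.
move=> x Mx; apply/funext => u /=.
have /(congr1 (@^~ (b u))) /= -> := ha x Mx.
by have /(congr1 (@^~ u)) /= -> := hb x Mx.
Qed.

Lemma commutant_bounded : S `<=` bounded_op. Proof. by move=> a []. Qed.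
Lemma commutant_id : S idfun. Proof. by split; [exact: bounded_id|]. Qed.
Lemma commutant_bicommutant : commutant (commutant S) = S.
Proof. by rewrite vn_bicommutant. Qed.

(** Packaged as a von Neumann algebra so that [unitary_ind] applies to it. *)
Definition commutant_vn : vnAlgebra R :=
  VNAlgebra commutant_bounded commutant_id commutant_linear commutant_comp
    commutant_adj commutant_bicommutant.

End CommutantAlgebra.

Section StandardRepresentation.
Context {R : realType} {N : vnAlgebra R} (L : standardForm N).
Local Notation C := R[i].
Local Notation rep := (@sf_rep R N L).

Lemma rep_range_bounded : range rep `<=` bounded_op.
Proof. by move=> _ [x _ <-]; exact: sf_rep_bounded. Qed.
Lemma rep_range_id : range rep idfun.
Proof. by exists (vn_one N) => //; exact: sf_rep_one. Qed.
Lemma rep_range_linear (k : C) a b : range rep a -> range rep b -> range rep (k *: a + b).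
Proof. by move=> [x _ <-] [y _ <-]; exists (k *: x + y) => //; rewrite sf_rep_linear. Qed.
Lemma rep_range_comp a b : range rep a -> range rep b -> range rep (a \o b).
Proof. by move=> [x _ <-] [y _ <-]; exists (x *v y) => //; rewrite sf_rep_mul. Qed.
Lemma rep_range_adj a : range rep a -> exists2 b, range rep b & adjoint a b.
Proof. by move=> [x _ <-]; exists (rep x^\*); [exists x^\*|exact: sf_rep_star]. Qed.

(** The image of [N] in its standard form, so that [matrix_sqrt] also applies on
    that side. *)
Definition rep_vn : vnAlgebra R :=
  VNAlgebra rep_range_bounded rep_range_id rep_range_linear rep_range_comp
    rep_range_adj (sf_rep_bicommutant L).

Lemma to_rep_subproof (x : N) : rep x \in @vn_pred R rep_vn.
Proof. by apply/vn_predP; exists x. Qed.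
Definition to_rep (x : N) : rep_vn := VNElt (to_rep_subproof x).

Lemma to_rep_surj (y : rep_vn) : exists x, to_rep x = y.
Proof. by have [x _ xy] := vn_opS y; exists x; apply: val_inj. Qed.

Lemma repD x y u : rep (x + y) u = rep x u + rep y u.
Proof. by rewrite (linD (sf_rep_linear L)). Qed.
Lemma repB x y u : rep (x - y) u = rep x u - rep y u.
Proof. by rewrite (linB (sf_rep_linear L)). Qed.
Lemma rep0 u : rep 0 u = 0.
Proof. by rewrite (lin0 (sf_rep_linear L)). Qed.
Lemma repZ c x u : rep (c *: x) u = c *: rep x u.
Proof. by rewrite (linZ (sf_rep_linear L)). Qed.
Lemma rep_sum I (r : seq I) (P : pred I) (F : I -> N) u :
  rep (\sum_(i <- r | P i) F i) u = \sum_(i <- r | P i) rep (F i) u.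
Proof.
elim/big_rec2: _ => [|i y x _ h]; first exact: rep0.
by rewrite repD h.
Qed.
Lemma repM x y u : rep (x *v y) u = rep x (rep y u).
Proof. by rewrite sf_rep_mul. Qed.
Lemma rep_lin x : linear (rep x). Proof. by case: (sf_rep_bounded L x). Qed.
Lemma rep_starl x u v : '[rep x^\* u, v] = '[u, rep x v].
Proof. by rewrite dotC -sf_rep_star -dotC. Qed.

Definition rep_mx_pos n (b : 'M[N]_n) := forall xi : 'I_n -> L,
  0 <= \sum_(i < n) \sum_(j < n) '[rep (b i j) (xi j), xi i].

(** In both directions a positive matrix is [c^* c], and this identity can be
    transported through the isomorphism [sf_rep], whereas [mx_pos]
    refers to the vectors of one particular space. *)
Lemma rep_mx_posP n (b : 'M[N]_n) : mx_pos b <-> rep_mx_pos b.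
Proof.
split=> [/matrix_sqrt[c cE] xi|pb xi].
  have -> : \sum_(i < n) \sum_(j < n) '[rep (b i j) (xi j), xi i] =
      \sum_r '[\sum_j rep (c r j) (xi j), \sum_i rep (c r i) (xi i)].
    under eq_bigr => i _.
      under eq_bigr => j _.
        rewrite cE rep_sum dot_suml.
        under eq_bigr => r _ do rewrite repM rep_starl.
        over.
      rewrite exchange_big; over.
    rewrite exchange_big; apply: eq_bigr => r _ /=.
    rewrite dot_sumr; apply: eq_bigr => i _; by rewrite dot_suml.
  by apply: sumr_ge0 => r _; rewrite dotE lecR sqr_ge0.
have : mx_pos (\matrix_(i, j) to_rep (b i j)).
  by move=> eta; have := pb eta; congr (_ <= _); apply: eq_bigr => i _; apply: eq_bigr => j _; rewrite mxE.
move=> /matrix_sqrt[c cE].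
have /choice[c' hc'] : forall p : 'I_n * 'I_n, exists x, to_rep x = c p.1 p.2.
  by move=> p; exact: to_rep_surj.
have bE i j : b i j = \sum_r (c' (r, i))^\* *v c' (r, j).
  apply: (sf_rep_inj (s := L)); apply: op_ext => u v.
  have h (u' v' : vn_space rep_vn) :
      '[to_rep (b i j) u', v'] = \sum_r '[c r j u', c r i v'].
    have := cE i j; rewrite mxE => ->; rewrite vn_op_sum dot_suml.
    by apply: eq_bigr => r _; rewrite vn_opM vn_starPl.
  transitivity (\sum_r '[c r j (u : vn_space rep_vn), c r i v]); first exact: h.
  rewrite rep_sum dot_suml; apply: eq_bigr => r _.
  by rewrite repM rep_starl -(hc' (r, i)) -(hc' (r, j)).
have -> : \sum_(i < n) \sum_(j < n) '[b i j (xi j), xi i] =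
    \sum_r '[\sum_j c' (r, j) (xi j), \sum_i c' (r, i) (xi i)].
  under eq_bigr => i _.
    under eq_bigr => j _.
      rewrite bE vn_op_sum dot_suml.
      under eq_bigr => r _ do rewrite vn_opM vn_starPl.
      over.
    rewrite exchange_big; over.
  rewrite exchange_big; apply: eq_bigr => r _ /=.
  rewrite dot_sumr; apply: eq_bigr => i _; by rewrite dot_suml.
by apply: sumr_ge0 => r _; rewrite dotE lecR sqr_ge0.
Qed.

(** The value on [(\sum_j z j ⊗ xi j, \sum_i z i ⊗ eta i)] of the form that [D]
    defines on [M ⊙ L]. *)
Definition rep_gram (M : vnAlgebra R) (D : M -> N) n (z : 'I_n -> M) (xi eta : 'I_n -> L) : C :=
  \sum_(i < n) \sum_(j < n) '[rep (D ((z i)^\* *v z j)) (xi j), eta i].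

Lemma gram_mx_pos (M : vnAlgebra R) n (z : 'I_n -> M) :
  mx_pos (\matrix_(i, j) ((z i)^\* *v z j)).
Proof.
move=> xi.
have -> : \sum_(i < n) \sum_(j < n) '[(\matrix_(i, j) ((z i)^\* *v z j)) i j (xi j), xi i] =
    '[\sum_j z j (xi j), \sum_i z i (xi i)].
  rewrite dot_sumr; apply: eq_bigr => i _; rewrite dot_suml; apply: eq_bigr => j _.
  by rewrite mxE vn_opM vn_starPl.
by rewrite dotE lecR sqr_ge0.
Qed.

(** Every positive matrix over [M] is a sum over [r] of Gram matrices
    [(c r i)^* c r j], so complete positivity only has to be tested on Gram
    matrices, that is on the form defined by [D]. *)
Lemma cpP (M : vnAlgebra R) (D : M -> N) : linear D ->
  CP D <-> forall n (z : 'I_n -> M) xi, 0 <= rep_gram D z xi xi.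
Proof.
move=> lD; split=> [[_ cD] n z xi|h].
  have /rep_mx_posP/(_ xi) := cD n _ (gram_mx_pos z).
  by congr (_ <= _); apply: eq_bigr => i _; apply: eq_bigr => j _; rewrite !mxE.
split=> // n a /matrix_sqrt[c cE]; apply/rep_mx_posP => xi.
have -> : \sum_(i < n) \sum_(j < n) '[rep (map_mx D a i j) (xi j), xi i] =
    \sum_r rep_gram D (c r) xi xi.
  under eq_bigr => i _.
    under eq_bigr => j _ do rewrite mxE cE (lin_sum lD) rep_sum dot_suml.
    rewrite exchange_big; over.
  by rewrite exchange_big.
by apply: sumr_ge0 => r _; exact: h.
Qed.

End StandardRepresentation.

(** * Maps and forms on the algebraic tensor product *)

Section TensorTheory.
Context {K : fieldType} {U V : lmodType K}.
Implicit Types (t : U ⊙ V) (u : U) (v : V).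

Lemma tensor_val_sum_pure n (u : 'I_n -> U) (v : 'I_n -> V) :
  tensor_val (\sum_i u i ⊗ v i) = \sum_i eval_at (u i) (v i).
Proof. by elim/big_rec2: _ => // i y x _ <-. Qed.

Lemma tensor_decomp t : exists n (u : 'I_n -> U) (v : 'I_n -> V), t = \sum_i u i ⊗ v i.
Proof.
have /asboolP[n [u [v e]]] := tensorP t; exists n, u, v; apply: val_inj.
by rewrite /= e tensor_val_sum_pure.
Qed.

Lemma tensor_valP (c : K) t t' (b : bilinear_form) :
  tensor_val (c *: t + t') b = c * tensor_val t b + tensor_val t' b.
Proof. by []. Qed.

Lemma tensor_val_sum n (u : 'I_n -> U) (v : 'I_n -> V) (b : bilinear_form) :
  tensor_val (\sum_i u i ⊗ v i) b = \sum_i b (u i) (v i).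
Proof. by elim/big_rec2: _ => // i y x _ <-. Qed.

Lemma tensor_ext t t' : (forall b, tensor_val t b = tensor_val t' b) -> t = t'.
Proof. by move=> h; apply: val_inj; apply/funext. Qed.

Lemma pure_linl v : linear (fun u : U => (u ⊗ v : U ⊙ V)).
Proof.
move=> c x y; apply: tensor_ext => b; rewrite tensor_valP /= /eval_at.
by rewrite linearPl.
Qed.

Lemma pure_linr u : linear (fun v : V => (u ⊗ v : U ⊙ V)).
Proof.
move=> c x y; apply: tensor_ext => b; rewrite tensor_valP /= /eval_at.
by rewrite linearPr.
Qed.

Lemma bilinear_mk (f : U -> V -> K) : (forall v, linear_for *%R (f ^~ v)) ->
  (forall u, linear_for *%R (f u)) -> exists b : @bilinear_form K U V, forall u v, b u v = f u v.
Proof.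
move=> h1 h2.
pose b' := bilinear_isBilinear.Build K U V K *%R *%R f (h1, h2).
pose b : @bilinear_form K U V := HB.pack f b'.
by exists b.
Qed.

End TensorTheory.

Section TensorMap.
Context {K : fieldType} {U V U' V' : lmodType K}.

(** Elements of the tensor product are functions of bilinear forms; the map acts
    by precomposing these forms with [f] and [g]. *)
Lemma tensor_map (f : U -> U') (g : V -> V') : linear f -> linear g ->
  exists2 T : U ⊙ V -> U' ⊙ V', linear T & forall u v, T (u ⊗ v) = f u ⊗ g v.
Proof.
move=> lf lg.
have /choice[B hB] : forall b : @bilinear_form K U' V', exists b' : @bilinear_form K U V,
    forall u v, b' u v = b (f u) (g v).
  move=> b; apply: bilinear_mk => [v c x y|u c x y].
    by rewrite lf linearPl.
  by rewrite lg linearPr.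
have TP t : (fun b => tensor_val t (B b)) \in @tensor_pred K U' V'.
  apply/asboolP; have [n [u [v ->]]] := tensor_decomp t.
  exists n, (fun i => f (u i)), (fun i => g (v i)); apply/funext => b.
  rewrite tensor_val_sum.
  transitivity (tensor_val (\sum_i f (u i) ⊗ g (v i)) b); last by rewrite tensor_val_sum_pure.
  by rewrite tensor_val_sum; apply: eq_bigr => i _; rewrite hB.
exists (fun t => Tensor (TP t)); first by move=> c x y; apply: tensor_ext.
by move=> u v; apply: tensor_ext => b /=; rewrite /eval_at hB.
Qed.

End TensorMap.

Section TensorForm.
Context {R : realType} {U V : lmodType R[i]}.
Local Notation C := R[i].

Lemma sesq_tensorE (s : U ⊙ V -> U ⊙ V -> C) n m (u : 'I_n -> U) (v : 'I_n -> V) (u' : 'I_m -> U) (v' : 'I_m -> V) :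
  sesq s -> s (\sum_i u i ⊗ v i) (\sum_j u' j ⊗ v' j) = \sum_j \sum_i s (u i ⊗ v i) (u' j ⊗ v' j).
Proof.
by move=> hs; rewrite (sesq_sumr hs); apply: eq_bigr => j _; rewrite (sesq_suml hs).
Qed.

Lemma sesq_tensor_ext (s s' : U ⊙ V -> U ⊙ V -> C) : sesq s -> sesq s' ->
  (forall u v u' v', s (u ⊗ v) (u' ⊗ v') = s' (u ⊗ v) (u' ⊗ v')) -> s =2 s'.
Proof.
move=> hs hs' e t t'; have [n [u [v ->]]] := tensor_decomp t; have [m [u' [v' ->]]] := tensor_decomp t'.
by rewrite !sesq_tensorE//; apply: eq_bigr => j _; apply: eq_bigr => i _.
Qed.

(** Evaluate the first argument on the bilinear form obtained by summing [F] over
    a chosen decomposition of the second one.  Exchanging the two sums shows that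
    the choice does not matter, whence antilinearity in the second argument. *)
Lemma tensor_form (F : U -> V -> U -> V -> C) :
  (forall v u' v', linear_for *%R (fun u => F u v u' v')) ->
  (forall u u' v', linear_for *%R (fun v => F u v u' v')) ->
  (forall u v v', linear_for (Num.conj \; *%R) (fun u' => F u v u' v')) ->
  (forall u v u', linear_for (Num.conj \; *%R) (fun v' => F u v u' v')) ->
  exists2 s : U ⊙ V -> U ⊙ V -> C, sesq s &
    forall u v u' v', s (u ⊗ v) (u' ⊗ v') = F u v u' v'.
Proof.
move=> h1 h2 h3 h4.
have /choice[B hB] : forall p : U * V, exists b : @bilinear_form C U V,
    forall u v, b u v = F u v p.1 p.2.
  by move=> [u' v'] /=; exact: bilinear_mk.
have /choice[B' hB'] : forall p : U * V, exists b : @bilinear_form C U V,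
    forall u' v', b u' v' = Num.conj (F p.1 p.2 u' v').
  move=> [u v]; apply: bilinear_mk => [v' c x y|u' c x y] /=.
    have -> : F u v (c *: x + y) v' = Num.conj c * F u v x v' + F u v y v' by exact: h3.
    by rewrite rmorphD rmorphM /= conjCK.
  have -> : F u v u' (c *: x + y) = Num.conj c * F u v u' x + F u v u' y by exact: h4.
  by rewrite rmorphD rmorphM /= conjCK.
have /choice[d hd] : forall t : U ⊙ V, exists d : {n : nat & (('I_n -> U) * ('I_n -> V))%type},
    t = \sum_i (projT2 d).1 i ⊗ (projT2 d).2 i.
  by move=> t; have [n [u [v e]]] := tensor_decomp t; exists (existT _ n (u, v)).
pose s t t' : C := \sum_j tensor_val t (B ((projT2 (d t')).1 j, (projT2 (d t')).2 j)).
have sE n (u : 'I_n -> U) (v : 'I_n -> V) t' :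
    s (\sum_i u i ⊗ v i) t' = \sum_i Num.conj (tensor_val t' (B' (u i, v i))).
  rewrite /s; under eq_bigr => j _ do rewrite tensor_val_sum.
  rewrite exchange_big; apply: eq_bigr => i _ /=.
  rewrite [in RHS](hd t') tensor_val_sum rmorph_sum; apply: eq_bigr => j _.
  by rewrite hB hB' /= conjCK.
exists s.
  split=> [t' c x y|t c x y].
    rewrite /s mulr_sumr -big_split; apply: eq_bigr => j _; exact: tensor_valP.
  have [n [u [v ->]]] := tensor_decomp t.
  set t0 := \sum_i _; transitivity (Num.conj c * s t0 x + s t0 y); last by [].
  rewrite !sE mulr_sumr -big_split.
  by apply: eq_bigr => j _; rewrite tensor_valP rmorphD rmorphM.
move=> u v u' v'.
have := sE 1%N (fun=> u) (fun=> v) (u' ⊗ v'); rewrite !big_ord1 => ->.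
by rewrite /= /eval_at hB' conjCK.
Qed.

End TensorForm.

(** * Geometric means of CP maps *)

Section CPForms.
Context {R : realType} {M N : vnAlgebra R} (L : standardForm N).
Local Notation C := R[i].
Local Notation rep := (@sf_rep R N L).
Local Notation cpf := (@cp_form R M N L).
Implicit Types (Phi Psi G D : M -> N).

Lemma stinespring_form_ex D : linear D -> exists2 s : M ⊙ L -> M ⊙ L -> C, sesq s &
  forall x xi y eta, s (x ⊗ xi) (y ⊗ eta) = '[rep (D (y^\* *v x)) xi, eta].
Proof.
move=> lD; apply: (@tensor_form _ _ _ (fun x xi y eta => '[rep (D (y^\* *v x)) xi, eta])).
- by move=> xi y eta c u v; rewrite vn_mulDr vn_mulZr lD repD repZ dotDl dotZl.
- by move=> x y eta c u v; rewrite rep_lin dotDl dotZl.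
- move=> x xi eta c u v; rewrite vn_starD vn_starZ vn_mulDl vn_mulZl lD repD repZ dotDl dotZl.
  by [].
- by move=> x xi y c u v; rewrite dotDr dotZr.
Qed.

Lemma form_gram (s : M ⊙ L -> M ⊙ L -> C) D n (z : 'I_n -> M) xi eta : sesq s ->
  (forall x xi y eta, s (x ⊗ xi) (y ⊗ eta) = '[rep (D (y^\* *v x)) xi, eta]) ->
  s (\sum_i z i ⊗ xi i) (\sum_i z i ⊗ eta i) = rep_gram D z xi eta.
Proof.
move=> hs sE; rewrite sesq_tensorE//; apply: eq_bigr => i _; apply: eq_bigr => j _.
exact: sE.
Qed.

Lemma cp_form_spec Phi : CP Phi -> is_cp_form Phi (cpf Phi).
Proof.
move=> cP; apply: xgetPex; have [s hs sE] := stinespring_form_ex cP.1.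
exists s; split=> //; case: (hs) => h1 h2; split=> // t.
have [n [z [xi ->]]] := tensor_decomp t.
rewrite (form_gram _ _ _ hs sE); exact: ((@cpP _ _ L _ _ cP.1).1 cP n z xi).
Qed.

Lemma cp_form_pos Phi : CP Phi -> pos_form (cpf Phi).
Proof. by case/cp_form_spec. Qed.
Lemma cp_formE Phi x xi y eta : CP Phi ->
  cpf Phi (x ⊗ xi) (y ⊗ eta) = '[rep (Phi (y^\* *v x)) xi, eta].
Proof. by case/cp_form_spec. Qed.
Lemma cp_form_gram Phi n (z : 'I_n -> M) xi eta : CP Phi ->
  cpf Phi (\sum_i z i ⊗ xi i) (\sum_i z i ⊗ eta i) = rep_gram Phi z xi eta.
Proof.
by move=> cP; apply: form_gram; [exact/pos_form_sesq/cp_form_pos|move=> *; exact: cp_formE].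
Qed.

(** The quadratic form of [Psi - Phi] is the difference of those of [Psi] and
    [Phi], so [cpP] applies. *)
Lemma cp_leP Phi Psi : CP Phi -> CP Psi ->
  cp_le Phi Psi <-> forall t, complex.Re (cpf Phi t t) <= complex.Re (cpf Psi t t).
Proof.
move=> cP cQ; have lD : linear (Psi - Phi).
  move=> c x y; transitivity (Psi (c *: x + y) - Phi (c *: x + y)); first by [].
  transitivity (c *: (Psi x - Phi x) + (Psi y - Phi y)); last by [].
  by rewrite cP.1 cQ.1 scalerBr opprD addrACA.
have sE n (z : 'I_n -> M) xi : rep_gram (Psi - Phi) z xi xi =
    rep_gram Psi z xi xi - rep_gram Phi z xi xi :> C.
  rewrite /rep_gram -sumrB; apply: eq_bigr => i _.
  rewrite -sumrB; apply: eq_bigr => j _; rewrite -dotBl -repB.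
  by [].
have cpL := @cpP _ _ L _ _ lD.
split=> [/cpL h t|h].
  have [n [z [xi ->]]] := tensor_decomp t; rewrite !cp_form_gram//.
  by have /ge0C[_] := h n z xi; rewrite sE ReD ReN subr_ge0.
apply/cpL => n z xi; rewrite sE -!cp_form_gram//; set t := \sum_i _.
have /ge0C[i1 _] := pos_form_ge0 t (cp_form_pos cP).
have /ge0C[i2 _] := pos_form_ge0 t (cp_form_pos cQ).
by apply/ge0C; rewrite ImD ImN i1 i2 subr0 ReD ReN subr_ge0.
Qed.

(** Concatenate decompositions of [t] and [t'] and pad with zero vectors; block
    forms then become sums over one common Gram matrix. *)
Lemma tensor_common (t t' : M ⊙ L) : exists n (z : 'I_n -> M) (xi eta : 'I_n -> L),
  t = \sum_i z i ⊗ xi i /\ t' = \sum_i z i ⊗ eta i.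
Proof.
have [n [z [xi ->]]] := tensor_decomp t; have [m [z' [eta ->]]] := tensor_decomp t'.
(* concatenation of two families *)
pose p (T : Type) (f : 'I_n -> T) (g : 'I_m -> T) (i : 'I_(n + m)) :=
  match fintype.split i with inl j => f j | inr j => g j end.
have pl T (f : 'I_n -> T) g j : p T f g (lshift m j) = f j.
  by rewrite /p (unsplitK (inl j : 'I_n + 'I_m)).
have pr T (f : 'I_n -> T) g j : p T f g (rshift n j) = g j.
  by rewrite /p (unsplitK (inr j : 'I_n + 'I_m)).
exists (n + m)%N, (p _ z z'), (p _ xi (fun=> 0)), (p _ (fun=> 0) eta).
have l0 (x : M) : (x ⊗ (0 : L) : M ⊙ L) = 0 by exact: (lin0 (pure_linr x)).
split; rewrite big_split_ord /=.
  rewrite [X in _ + X]big1 ?addr0 => [|j _]; last by rewrite !pr l0.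
  by apply: eq_bigr => j _; rewrite !pl.
rewrite [X in X + _]big1 ?add0r => [|j _]; last by rewrite !pl l0.
by apply: eq_bigr => j _; rewrite !pr.
Qed.

Lemma sesq_comp (V : lmodType C) (s : V -> V -> C) (T : V -> V) : sesq s -> linear T ->
  sesq (fun x y => s (T x) (T y)).
Proof.
move=> hs lT; split=> [y c u v|x c u v] /=.
  by rewrite lT (sesqDl hs) (sesqZl hs).
by rewrite lT (sesqDr hs) (sesqZr hs).
Qed.

Section Existence.
Variables (Phi Psi : M -> N).
Hypotheses (cP : CP Phi) (cQ : CP Psi).
Let al := cpf Phi.
Let be := cpf Psi.
Let ga := form_gmean al be.
Let pa : pos_form al := cp_form_pos cP.
Let pb : pos_form be := cp_form_pos cQ.
Let pg : pos_form ga := form_gmean_pos pa pb.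
Let hg : sesq ga := pos_form_sesq pg.

Lemma tensor_map_cancel (f f' : M -> M) (g g' : L -> L) (T T' : M ⊙ L -> M ⊙ L) :
  linear T -> linear T' -> cancel f f' -> cancel g g' ->
  (forall x xi, T (x ⊗ xi) = f x ⊗ g xi) -> (forall x xi, T' (x ⊗ xi) = f' x ⊗ g' xi) ->
  cancel T T'.
Proof.
move=> lT lT' ff gg TE TE' t; have [n [z [xi ->]]] := tensor_decomp t.
rewrite (lin_sum lT) (lin_sum lT'); apply: eq_bigr => i _.
by rewrite TE TE' ff gg.
Qed.

(** [form_gmean_invariant] for automorphisms of the form [f (x) g], in adjoint
    form. *)
Lemma gmean_map_invariant (f f' : M -> M) (g g' : L -> L) :
  linear f -> linear f' -> linear g -> linear g' ->
  cancel f f' -> cancel f' f -> cancel g g' -> cancel g' g ->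
  (forall D x xi y eta, CP D -> '[rep (D ((f y)^\* *v f x)) (g xi), g eta] =
     '[rep (D (y^\* *v x)) xi, eta]) ->
  forall x xi y eta, ga (f x ⊗ g xi) (y ⊗ eta) = ga (x ⊗ xi) (f' y ⊗ g' eta).
Proof.
move=> lf lf' lg lg' ff ff' gg gg' inv x xi y eta.
have [T lT TE] := tensor_map lf lg; have [T' lT' TE'] := tensor_map lf' lg'.
have TK := tensor_map_cancel lT lT' ff gg TE TE'.
have TK' := tensor_map_cancel lT' lT ff' gg' TE' TE.
have Ti D : CP D -> forall t t', cpf D (T t) (T t') = cpf D t t'.
  move=> cD; have hs := pos_form_sesq (cp_form_pos cD).
  apply: (sesq_tensor_ext (sesq_comp hs lT) hs) => u v u' v'.
  by rewrite !TE !cp_formE// inv.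
have := form_gmean_invariant pa pb lT lT' TK TK' (Ti _ cP) (Ti _ cQ) (x ⊗ xi) (T' (y ⊗ eta)).
by rewrite TK' TE TE'.
Qed.

Lemma gmean_left_module (a : M) x xi y eta :
  ga (a *v x ⊗ xi) (y ⊗ eta) = ga (x ⊗ xi) (a^\* *v y ⊗ eta).
Proof.
move: a x xi y eta; apply: unitary_ind => [u [u1 u2]|c a b ha hb] x xi y eta.
  have lm (w : M) : linear (fun x : M => w *v x) by move=> k p q; rewrite vn_mulDr vn_mulZr.
  apply: (gmean_map_invariant (f := fun x => u *v x) (f' := fun x => u^\* *v x) (g := id) (g' := id)) => //.
  - by move=> p; rewrite vn_mulA u1 vn_mul1l.
  - by move=> p; rewrite vn_mulA u2 vn_mul1l.
  - by move=> D p q r s cD; rewrite vn_starM -vn_mulA (vn_mulA _ u) u1 vn_mul1l.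
rewrite vn_starD vn_starZ !vn_mulDl !vn_mulZl.
rewrite (linD (pure_linl _)) (linZ (pure_linl _)) (linD (pure_linl _)) (linZ (pure_linl _)) /=.
by rewrite (sesqDl hg) (sesqZl hg) (sesqDr hg) (sesqZr hg) conjCK ha hb.
Qed.

Lemma gmean_right_module (b : commutant_vn (rep_vn L)) x (xi : L) y (eta : L) :
  ga (x ⊗ (b xi : L)) (y ⊗ eta) = ga (x ⊗ xi) (y ⊗ (b^\* eta : L)).
Proof.
move: b x xi y eta; apply: unitary_ind => [u [u1 u2]|c a b ha hb] x xi y eta.
  apply: (gmean_map_invariant (f := id) (f' := id) (g := vn_op u) (g' := vn_op u^\*)) => //.
  - exact: (vn_op_lin u).
  - exact: (vn_op_lin u^\*).
  - by move=> p; exact: (congr1 (fun w : commutant_vn (rep_vn L) => w p) u1).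
  - by move=> p; exact: (congr1 (fun w : commutant_vn (rep_vn L) => w p) u2).
  - move=> D p q r s cD; have [bu cu] : commutant (vn_set (v := rep_vn L)) (vn_op u) := vn_opS u.
    have /(congr1 (@^~ q)) /= -> := cu (rep (D (r^\* *v p))) (ex_intro2 _ _ _ I erefl).
    have us := congr1 (fun w : commutant_vn (rep_vn L) => w s) u1.
    by rewrite (vn_starP u) -vn_opM us.
rewrite vn_starD vn_starZ.
have -> : (x ⊗ ((c *: a + b) xi : L) : M ⊙ L) = c *: (x ⊗ (a xi : L)) + x ⊗ (b xi : L).
  exact: pure_linr.
have -> : (y ⊗ ((Num.conj c *: a^\* + b^\*) eta : L) : M ⊙ L) =
    Num.conj c *: (y ⊗ (a^\* eta : L)) + y ⊗ (b^\* eta : L).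
  exact: pure_linr.
by rewrite (sesqDl hg) (sesqZl hg) (sesqDr hg) (sesqZr hg) conjCK ha hb.
Qed.

(** The block condition at [(t, - t)] bounds the mean form by the arithmetic
    mean of the two forms, which are bounded by operators of [N]. *)
Lemma form_gmean_seminorm_bound (x : M) : exists2 K : R, 0 <= K &
  forall xi : L, seminorm ga (x ⊗ xi) <= K * nrm xi.
Proof.
have bd (D : M -> N) : exists2 K : R, 0 <= K & forall xi : L, complex.Re '[rep (D (x^\* *v x)) xi, xi] <= K * nrm xi ^+ 2.
  have /bounded_opP[_ [K K0 hK]] := sf_rep_bounded L (D (x^\* *v x)); exists K => // xi.
  by apply: le_trans (Re_dot_le _ _) _; rewrite expr2 mulrA ler_wpM2r ?nrm_ge0.
have [K K0 hK] := bd Phi; have [K' K'0 hK'] := bd Psi.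
exists (Num.sqrt (K + K')); first exact: sqrtr_ge0.
move=> xi; set t := x ⊗ xi.
have h := form_gmean_block pa pb t (- t).
rewrite -/ga (sesqNl hg) (sesqNr hg) (sesqNl (pos_form_sesq pb)) (sesqNr (pos_form_sesq pb)) opprK in h.
have {}h : 2 * complex.Re (ga t t) <= complex.Re (al t t) + complex.Re (be t t).
  by move: h => /ge0C[_]; rewrite !ReImE; lra.
have := hK xi; have := hK' xi; rewrite -!cp_formE// -/al -/be -/t => h1 h2.
rewrite -(ler_pXn2r (_ : 0 < 2)%N) ?nnegrE ?seminorm_ge0 ?mulr_ge0 ?sqrtr_ge0 ?nrm_ge0//.
rewrite seminorm_sqr// exprMn sqr_sqrtr ?addr_ge0// mulrDl.
have : 0 <= complex.Re (ga t t) by case/ge0C: (pos_form_ge0 t pg).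
lra.
Qed.

(** [G x] is the operator of the bounded form
    [fun xi eta => ga (x ⊗ xi) (1 ⊗ eta)].  It commutes with the commutant of the
    standard representation by [gmean_right_module], so it belongs to [N], and
    [gmean_left_module] recovers all values of [ga] from [G]. *)
Lemma cp_gmean_ex : exists G, is_cp_gmean L Phi Psi G.
Proof.
have [K1 K10 hK1] := form_gmean_seminorm_bound (vn_one M).
have /choice[G GE] : forall x, exists g : N, forall xi eta : L,
    '[rep g xi, eta] = ga (x ⊗ xi) (vn_one M ⊗ eta).
  move=> x; have [K K0 hK] := form_gmean_seminorm_bound x.
  have [|||D bD DE] := @sesq_op _ L (fun xi eta => ga (x ⊗ xi) (vn_one M ⊗ eta)) (K * K1).
  - split=> [eta c u v|xi c u v] /=.
      by rewrite (pure_linr x) (sesqDl hg) (sesqZl hg).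
    by rewrite (pure_linr (vn_one M)) (sesqDr hg) (sesqZr hg).
  - exact: mulr_ge0.
  - move=> u v; apply: le_trans (seminorm_CS pg _ _) _.
    have -> : K * K1 * nrm u * nrm v = (K * nrm u) * (K1 * nrm v) by ring.
    by apply: ler_pM; rewrite ?seminorm_ge0.
  have [g' g'E] : exists g' : rep_vn L, vn_op g' = D.
    apply: vn_bicomm => // b hb.
    pose b' : commutant_vn (rep_vn L) := VNElt (introT (@vn_predP _ (commutant_vn (rep_vn L)) b) hb).
    apply: op_ext => u v /=; rewrite -DE.
    transitivity (ga (x ⊗ (b' u : L)) (vn_one M ⊗ v)); first by [].
    rewrite gmean_right_module DE; exact: esym (vn_starP b' _ _).
  have [g gE] := to_rep_surj g'; exists g => xi eta; rewrite DE -g'E -gE.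
  by [].
have GM x y xi eta : '[rep (G (y^\* *v x)) xi, eta] = ga (x ⊗ xi) (y ⊗ eta).
  by rewrite GE gmean_left_module vn_starK vn_mul1r.
exists G; split=> //.
have lG : linear G.
  move=> c x y; apply: (sf_rep_inj (s := L)); apply: op_ext => u v.
  rewrite GE repD repZ dotDl dotZl !GE.
  by rewrite (pure_linl u) (sesqDl hg) (sesqZl hg).
apply/(@cpP _ _ L _ _ lG) => n z xi; rewrite -(form_gram (s := ga))//.
exact: pos_form_ge0.
Qed.

End Existence.

Lemma cp_gmean_spec Phi Psi : CP Phi -> CP Psi -> is_cp_gmean L Phi Psi (cp_gmean L Phi Psi).
Proof. by move=> cP cQ; apply: xgetPex; exact: cp_gmean_ex. Qed.

Lemma cp_gmean_CP Phi Psi : CP Phi -> CP Psi -> CP (cp_gmean L Phi Psi).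
Proof. by move=> cP cQ; case: (cp_gmean_spec cP cQ). Qed.

Lemma cp_gmean_form Phi Psi : CP Phi -> CP Psi ->
  cpf (cp_gmean L Phi Psi) =2 form_gmean (cpf Phi) (cpf Psi).
Proof.
move=> cP cQ; have [cG GE] := cp_gmean_spec cP cQ.
apply: sesq_tensor_ext; first exact/pos_form_sesq/cp_form_pos.
  by apply/pos_form_sesq/form_gmean_pos; exact: cp_form_pos.
by move=> x xi y eta; rewrite cp_formE// GE.
Qed.

Lemma cp_gmean_block Phi Psi : CP Phi -> CP Psi ->
  block_pos (cpf Phi) (cpf (cp_gmean L Phi Psi)) (cpf Psi).
Proof.
move=> cP cQ t t'; rewrite !cp_gmean_form//.
by apply: form_gmean_block; exact: cp_form_pos.
Qed.

(** The competitor [de] is an arbitrary positive form, because the limit argument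
    for sequences produces one only as a limit of forms. *)
Lemma cp_gmean_max Phi Psi de : CP Phi -> CP Psi -> pos_form de ->
  block_pos (cpf Phi) de (cpf Psi) ->
  forall t, complex.Re (de t t) <= complex.Re (cpf (cp_gmean L Phi Psi) t t).
Proof.
move=> cP cQ pd bp t; rewrite cp_gmean_form//.
by apply: form_gmean_max => //; exact: cp_form_pos.
Qed.

End CPForms.

(** * Monotonicity and compositions *)

Section MeanProperties.
Context {R : realType}.
Local Notation C := R[i].

Lemma CP_comp (M N P : vnAlgebra R) (Phi : M -> N) (Xi : N -> P) :
  CP Phi -> CP Xi -> CP (Xi \o Phi).
Proof.
move=> [lP cP] [lX cX]; split=> [c x y|n a pa] /=; first by rewrite lP lX.
rewrite (_ : map_mx _ a = map_mx Xi (map_mx Phi a)); first exact/cX/cP.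
by apply/matrixP => i j; rewrite !mxE.
Qed.

Section Blocks.
Context {M N : vnAlgebra R} (L : standardForm N).
Local Notation rep := (@sf_rep R N L).
Local Notation cpf := (@cp_form R M N L).
Local Notation gram D z := (@rep_gram R N L M D _ z).
Implicit Types (Phi Psi G D : M -> N).

Lemma cp_block_gramP Phi Psi G : CP Phi -> CP Psi -> CP G ->
  block_pos (cpf Phi) (cpf G) (cpf Psi) <->
  forall n (z : 'I_n -> M) (xi eta : 'I_n -> L),
    0 <= gram Phi z xi xi + gram G z xi eta + gram G z eta xi + gram Psi z eta eta.
Proof.
move=> cP cQ cG; split=> [h n z xi eta|h t t'].
  by rewrite -!cp_form_gram.
by have [n [z [xi [eta [-> ->]]]]] := tensor_common t t'; rewrite !cp_form_gram.
Qed.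

Lemma cp_le_form Phi Psi t : CP Phi -> CP Psi -> cp_le Phi Psi -> cpf Phi t t <= cpf Psi t t.
Proof.
move=> cP cQ /(cp_leP L cP cQ)/(_ t) h; apply/leCE; split=> //.
by have /ge0C[-> _] := pos_form_ge0 t (cp_form_pos L cP);
   have /ge0C[-> _] := pos_form_ge0 t (cp_form_pos L cQ).
Qed.

Lemma cp_gmean_mono (Phi1 Phi2 Psi1 Psi2 : M -> N) :
  CP Phi1 -> CP Phi2 -> CP Psi1 -> CP Psi2 -> cp_le Phi1 Phi2 -> cp_le Psi1 Psi2 ->
  cp_le (cp_gmean L Phi1 Psi1) (cp_gmean L Phi2 Psi2).
Proof.
move=> cP1 cP2 cQ1 cQ2 hP hQ; apply/(cp_leP L); [exact: cp_gmean_CP|exact: cp_gmean_CP|].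
apply: cp_gmean_max => //; first exact/cp_form_pos/cp_gmean_CP.
move=> t t'; have h := cp_gmean_block (L := L) cP1 cQ1 t t'; apply: le_trans h _.
by rewrite lerD ?cp_le_form// lerD2r lerD2r cp_le_form.
Qed.

Lemma cp_gmean_max_cp Phi Psi G : CP Phi -> CP Psi -> CP G ->
  block_pos (cpf Phi) (cpf G) (cpf Psi) -> cp_le G (cp_gmean L Phi Psi).
Proof.
move=> cP cQ cG bp; apply/(cp_leP L) => //; first exact: cp_gmean_CP.
by apply: cp_gmean_max => //; exact: cp_form_pos.
Qed.

End Blocks.

Lemma rep_block_sum (N : vnAlgebra R) (L : standardForm N) n (a b c d : 'M[N]_n) (xi : 'I_(n + n) -> L) :
  \sum_(i < n + n) \sum_(j < n + n) '[sf_rep (block_mx a b c d i j) (xi j), xi i] =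
  \sum_(i < n) \sum_(j < n) '[sf_rep (a i j) (xi (lshift n j)), xi (lshift n i)] +
  \sum_(i < n) \sum_(j < n) '[sf_rep (c i j) (xi (lshift n j)), xi (rshift n i)] +
  \sum_(i < n) \sum_(j < n) '[sf_rep (b i j) (xi (rshift n j)), xi (lshift n i)] +
  \sum_(i < n) \sum_(j < n) '[sf_rep (d i j) (xi (rshift n j)), xi (rshift n i)].
Proof.
rewrite big_split_ord /=.
under eq_bigr => i _.
  rewrite big_split_ord /=.
  under eq_bigr => j _ do rewrite block_mxEul.
  under [X in _ + X]eq_bigr => j _ do rewrite block_mxEur.
  over.
under [X in _ + X]eq_bigr => i _.
  rewrite big_split_ord /=.
  under eq_bigr => j _ do rewrite block_mxEdl.
  under [X in _ + X]eq_bigr => j _ do rewrite block_mxEdr.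
  over.
by rewrite !big_split /= addrACA -!addrA; congr (_ + _); rewrite !addrA; congr (_ + _); rewrite addrC.
Qed.

(** By [cp_block_gramP] the block condition says that the 2n x 2n matrix with
    blocks [Phi], [G], [G], [Psi] applied to a Gram matrix is positive; apply [Xi]
    to this matrix. *)
Lemma cp_gmean_comp_left (M N P : vnAlgebra R) (L : standardForm N) (L' : standardForm P)
  (Phi Psi : M -> N) (Xi : N -> P) : CP Phi -> CP Psi -> CP Xi ->
  cp_le (Xi \o cp_gmean L Phi Psi) (cp_gmean L' (Xi \o Phi) (Xi \o Psi)).
Proof.
move=> cP cQ cX; have cG := cp_gmean_CP L cP cQ.
apply: cp_gmean_max_cp; try exact: CP_comp.
apply/cp_block_gramP; try exact: CP_comp.
move=> n z xi eta.
pose g D := map_mx D (\matrix_(i, j) ((z i)^\* *v z j)) : 'M[N]_n.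
pose E := block_mx (g Phi) (g (cp_gmean L Phi Psi)) (g (cp_gmean L Phi Psi)) (g Psi).
have pE : mx_pos E.
  apply/(@rep_mx_posP _ _ L) => ze; rewrite rep_block_sum.
  have /(cp_block_gramP L cP cQ cG) h := cp_gmean_block (L := L) cP cQ.
  have := h n z (fun i => ze (lshift n i)) (fun i => ze (rshift n i)).
  by congr (_ <= _); congr (_ + _ + _ + _); apply: eq_bigr => i _; apply: eq_bigr => j _; rewrite !mxE.
have /(@rep_mx_posP _ _ L') := cX.2 _ _ pE.
rewrite /E map_block_mx => h.
pose ze (i : 'I_(n + n)) : L' := match fintype.split i with inl j => xi j | inr j => eta j end.
have zl j : ze (lshift n j) = xi j by rewrite /ze (unsplitK (inl j : 'I_n + 'I_n)).
have zr j : ze (rshift n j) = eta j by rewrite /ze (unsplitK (inr j : 'I_n + 'I_n)).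
have := h ze; rewrite rep_block_sum; congr (_ <= _); congr (_ + _ + _ + _);
  by apply: eq_bigr => i _; apply: eq_bigr => j _; rewrite !mxE ?zl ?zr.
Qed.

(** [Xi] maps a Gram matrix to a positive matrix, which is a sum of Gram matrices
    by [matrix_sqrt]; the block condition is additive. *)
Lemma cp_gmean_comp_right (K M N : vnAlgebra R) (L : standardForm N)
  (Phi Psi : M -> N) (Xi : K -> M) : CP Phi -> CP Psi -> CP Xi ->
  cp_le (cp_gmean L Phi Psi \o Xi) (cp_gmean L (Phi \o Xi) (Psi \o Xi)).
Proof.
move=> cP cQ cX; have cG := cp_gmean_CP L cP cQ.
apply: cp_gmean_max_cp; try exact: CP_comp.
apply/cp_block_gramP; try exact: CP_comp.
move=> n z xi eta.
have /matrix_sqrt[c cE] := cX.2 _ _ (gram_mx_pos z).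
have gE (D : M -> N) (ze ze' : 'I_n -> L) : CP D -> rep_gram (D \o Xi) z ze ze' = \sum_r rep_gram D (c r) ze ze'.
  move=> cD; rewrite exchange_big; apply: eq_bigr => i _ /=; rewrite exchange_big.
  apply: eq_bigr => j _ /=; have := cE i j; rewrite !mxE => ->.
  by rewrite (lin_sum cD.1) rep_sum dot_suml.
rewrite !gE// -!big_split; apply: sumr_ge0 => r _ /=.
by move/(cp_block_gramP L cP cQ cG): (cp_gmean_block (L := L) cP cQ); apply.
Qed.

End MeanProperties.

(** * Decreasing sequences of forms and normality *)

Section DecreasingForms.
Context {R : realType} {V : lmodType R[i]}.
Local Notation C := R[i].

Lemma decreasing_Re_cvg (s : nat -> V -> V -> C) (x : V) : (forall n, pos_form (s n)) ->
  (forall n x, complex.Re (s n.+1 x x) <= complex.Re (s n x x)) ->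
  exists l, ncvg (fun n => s n x x) l.
Proof.
move=> ps ds; have ge n y : 0 <= complex.Re (s n y y) by case/ge0C: (pos_form_ge0 y (ps n)).
have im n y : complex.Im (s n y y) = 0 by case/ge0C: (pos_form_ge0 y (ps n)).
have /cvg_ex[l hl] : cvgn (fun n => complex.Re (s n x x)).
  apply: nonincreasing_is_cvgn.
    by apply/nonincreasing_seqP => n; exact: ds.
  by exists 0 => _ [n _ <-].
exists (l%:C); apply: ncvg_ReIm => //=.
have -> : (fun n => complex.Im (s n x x)) = cst 0 by apply/funext => n; exact: im.
exact: cvg_cst.
Qed.

Lemma polarized_cvg (s : nat -> V -> V -> C) : (forall n, sesq (s n)) ->
  (forall x, exists l, ncvg (fun n => s n x x) l) ->
  forall x y, exists l, ncvg (fun n => s n x y) l.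
Proof.
move=> hs h x y.
have [l1 h1] := h (x + y); have [l2 h2] := h (x - y).
have [l3 h3] := h (x + imag *: y); have [l4 h4] := h (x - imag *: y).
exists (4%:R^-1 * ((l1 - l2) + imag * (l3 - l4))).
have hh := ncvgMl 4%:R^-1 (ncvgD (ncvgB h1 h2) (ncvgMl imag (ncvgB h3 h4))).
apply: ncvg_eq hh => n /=.
by rewrite -polarization // mulrA mulVf ?pnatr_eq0// mul1r.
Qed.

Lemma decreasing_forms (s : nat -> V -> V -> C) : (forall n, pos_form (s n)) ->
  (forall n x, complex.Re (s n.+1 x x) <= complex.Re (s n x x)) ->
  exists2 t, pos_form t & forall x y, ncvg (fun n => s n x y) (t x y).
Proof.
move=> ps ds; have hs n := pos_form_sesq (ps n).
have cv := polarized_cvg hs (fun x => decreasing_Re_cvg x ps ds).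
have /choice[t ht] : forall p : V * V, exists l, ncvg (fun n => s n p.1 p.2) l by move=> p; exact: cv.
exists (fun x y => t (x, y)); last by move=> x y; exact: ht (x, y).
split=> [y c u v|x c u v|x].
- apply: (ncvg_uniq (ht (c *: u + v, y))).
  apply: (ncvg_eq (u := fun n => c * s n u y + s n v y)).
    by move=> n /=; rewrite (sesqDl (hs n)) (sesqZl (hs n)).
  by apply: ncvgD; [apply: ncvgMl; exact: ht (u, y)|exact: ht (v, y)].
- apply: (ncvg_uniq (ht (x, c *: u + v))).
  apply: (ncvg_eq (u := fun n => Num.conj c * s n x u + s n x v)).
    by move=> n /=; rewrite (sesqDr (hs n)) (sesqZr (hs n)).
  by apply: ncvgD; [apply: ncvgMl; exact: ht (x, u)|exact: ht (x, v)].
- by apply: ncvg_ge0 (ht (x, x)) => n; exact: pos_form_ge0.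
Qed.

End DecreasingForms.

Section Normality.
Context {R : realType}.
Local Notation C := R[i].

Lemma vn_pos_form (M : vnAlgebra R) (x : M) : vn_pos x -> pos_form (fun u v => '[x u, v]).
Proof. exact: pos_op_form. Qed.

Lemma decreasing_le (M : vnAlgebra R) (e : nat -> M) : (forall n, vn_pos (e n - e n.+1)) ->
  forall n u, complex.Re '[e n.+1 u, u] <= complex.Re '[e n u, u].
Proof.
move=> de n u; have := pos_op_ge0 u (de n).
by rewrite vn_opB dotBl ReD ReN subr_ge0.
Qed.

Lemma vn_pos_le (M : vnAlgebra R) (x y : M) : vn_pos x -> vn_pos y ->
  (forall u, complex.Re '[x u, u] <= complex.Re '[y u, u]) -> vn_pos (y - x).
Proof.
move=> px py h; split=> [|u]; first exact: vn_op_bounded.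
rewrite vn_opB dotBl subr_ge0; apply/leCE; split=> //.
have /ge0C[-> _] := pos_form_ge0 u (vn_pos_form px).
by have /ge0C[-> _] := pos_form_ge0 u (vn_pos_form py).
Qed.

(** The limit of the forms of [e n] is bounded by the form of [e 0], so it comes
    from an operator, which commutes with the commutant of [M]. *)
Lemma decreasing_infimum (M : vnAlgebra R) (e : nat -> M) :
  (forall n, vn_pos (e n)) -> (forall n, vn_pos (e n - e n.+1)) ->
  exists f : M, [/\ vn_pos f, forall n, vn_pos (e n - f) &
    forall u v, ncvg (fun n => '[e n u, v]) '[f u, v]].
Proof.
move=> pe de; have ds := decreasing_le de.
have [t pt ht] := decreasing_forms (fun n => vn_pos_form (pe n)) ds.
have le_n m n u : (m <= n)%N -> complex.Re '[e n u, u] <= complex.Re '[e m u, u].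
  elim: n => [|n IH]; first by rewrite leqn0 => /eqP->.
  rewrite leq_eqVlt => /orP[/eqP->//|]; rewrite ltnS => /IH; apply: le_trans; exact: ds.
have tle n u : complex.Re (t u u) <= complex.Re '[e n u, u].
  have l := ncvg_Re (ht u u); rewrite -(cvg_lim _ l)//; apply: limr_le.
    by apply/cvg_ex; eexists; exact: l.
  by exists n => // m /= nm; apply: le_n.
have /bounded_opP[_ [K K0 hK]] := vn_op_bounded (e 0%N).
have snt u : seminorm t u <= Num.sqrt K * nrm u.
  rewrite -(ler_pXn2r (_ : 0 < 2)%N) ?nnegrE ?seminorm_ge0 ?mulr_ge0 ?sqrtr_ge0 ?nrm_ge0//.
  rewrite seminorm_sqr// exprMn sqr_sqrtr//; apply: le_trans (tle 0%N u) _.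
  by apply: le_trans (Re_dot_le _ _) _; rewrite expr2 mulrA ler_wpM2r ?nrm_ge0.
have [|D bD DE] := sesq_op (pos_form_sesq pt) K0.
- move=> u v; apply: le_trans (seminorm_CS pt u v) _.
  apply: le_trans (ler_pM (seminorm_ge0 _ _) (seminorm_ge0 _ _) (snt u) (snt v)) _.
  have -> : Num.sqrt K * nrm u * (Num.sqrt K * nrm v) = Num.sqrt K ^+ 2 * nrm u * nrm v by ring.
  by rewrite sqr_sqrtr.
have [f fE] : exists f : M, vn_op f = D.
  apply: vn_bicomm => // b [bb hb]; have [b' _ bb'] := adjoint_ex bb.
  apply: op_ext => u v /=; rewrite -DE bb' -DE.
  apply: (ncvg_uniq (ht _ _)); apply: ncvg_eq (ht u (b' v)) => n /=.
  rewrite -bb'; congr ('[_, _]).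
  by have /(congr1 (@^~ u)) := hb _ (vn_opS (e n)).
have pf : vn_pos f.
  by split=> [|u]; [exact: vn_op_bounded|rewrite fE -DE; exact: pos_form_ge0].
exists f; split=> // [n|u v]; last by rewrite fE -DE.
by apply: vn_pos_le => // u; rewrite fE -DE.
Qed.

(** If [f] is the infimum of the images, then [f = th g] with [0 <= g <= e n] for
    all [n]; hence [g = 0] and [f = 0]. *)
Lemma order_iso_normal (M M' : vnAlgebra R) (th : M -> M') (e : nat -> M) :
  (forall x y, th (x - y) = th x - th y) -> (forall y, exists x, th x = y) ->
  (forall x, vn_pos x <-> vn_pos (th x)) ->
  (forall n, vn_pos (e n)) -> (forall n, vn_pos (e n - e n.+1)) ->
  (forall u, ncvg (fun n => '[e n u, u]) 0) ->
  forall u v, ncvg (fun n => '[th (e n) u, v]) 0.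
Proof.
move=> thB surj thP pe de e0 u v.
have [||f [pf hf fl]] := @decreasing_infimum M' (th \o e).
- by move=> n; apply/thP.
- by move=> n /=; rewrite -thB; apply/thP.
have [g gE] := surj f.
have pg : vn_pos g by apply/thP; rewrite gE.
have g0 : g = 0.
  apply: vn_ext => p q; apply: (sesq_ext (t := fun p q => '[(0 : M) p, q]) (pos_form_sesq (vn_pos_form pg)) _).
    by apply: op_sesq; exact: vn_op_lin.
  move=> {p q} p; rewrite vn_op0 dot0l.
  have gge : 0 <= '[g p, p] by case: pg.
  apply: le_anti; rewrite gge andbT.
  have : 0 <= 0 - '[g p, p]; last by rewrite sub0r oppr_ge0.
  apply: (ncvg_ge0 (u := fun n => '[e n p, p] - '[g p, p])); last first.
    by apply: ncvgB => //; exact: ncvg_cst.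
  move=> n; rewrite -dotBl -vn_opB.
  have : vn_pos (e n - g) by apply/thP; rewrite thB gE; exact: hf.
  by case.
have := fl u v; rewrite -gE g0.
have -> : th 0 = 0 by rewrite -(subrr 0) thB subrr.
by rewrite vn_op0 dot0l.
Qed.

Lemma to_repP (N : vnAlgebra R) (L : standardForm N) (x : N) : vn_pos x <-> vn_pos (to_rep L x).
Proof.
split=> [/vn_pos_square[c ->]|/vn_pos_square[d]].
  split=> [|u]; first exact: vn_op_bounded.
  change (0 <= '[@sf_rep R N L (c^\* *v c) u, u]).
  by rewrite repM rep_starl dotE lecR sqr_ge0.
have [c <-] := to_rep_surj d => xE.
have -> : x = c^\* *v c; last exact: vn_pos_star.
apply: (sf_rep_inj (s := L)); apply: op_ext => u v.
have := congr1 (fun w : rep_vn L => '[w u, v]) xE; rewrite vn_opM vn_starPl.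
by rewrite repM rep_starl.
Qed.

Lemma rep_normal (N : vnAlgebra R) (L : standardForm N) (e : nat -> N) :
  (forall n, vn_pos (e n)) -> (forall n, vn_pos (e n - e n.+1)) ->
  (forall u, ncvg (fun n => '[e n u, u]) 0) ->
  forall xi eta : L, ncvg (fun n => '[sf_rep (e n) xi, eta]) 0.
Proof.
move=> pe de e0 xi eta.
apply: (@order_iso_normal _ (rep_vn L) (to_rep L)) pe de e0 xi eta.
- move=> x y; apply: val_inj; apply/funext => u; exact: repB.
- exact: to_rep_surj.
- exact: to_repP.
Qed.

Lemma rep_normal_inv (N : vnAlgebra R) (L : standardForm N) (e : nat -> N) :
  (forall n, vn_pos (e n)) -> (forall n, vn_pos (e n - e n.+1)) ->
  (forall xi : L, ncvg (fun n => '[sf_rep (e n) xi, xi]) 0) ->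
  forall u v, ncvg (fun n => '[e n u, v]) 0.
Proof.
move=> pe de e0 u v.
have /choice[th thK] := @to_rep_surj _ _ L.
have inj : injective (to_rep L).
  by move=> x y /(congr1 (@vn_op R (rep_vn L))) /sf_rep_inj.
have thK' x : th (to_rep L x) = x by apply: inj; rewrite thK.
have rB x y : to_rep L (x - y) = to_rep L x - to_rep L y.
  apply: val_inj; apply/funext => p; exact: repB.
apply: (ncvg_eq (u := fun n => '[th (to_rep L (e n)) u, v])); first by move=> n; rewrite thK'.
apply: (@order_iso_normal (rep_vn L) N th (fun n => to_rep L (e n))).
- by move=> x y; apply: inj; rewrite rB !thK.
- by move=> x; exists (to_rep L x).
- by move=> x; rewrite -{1}(thK x); apply: iff_sym; exact: to_repP.
- by move=> n; apply: (to_repP L _).1.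
- by move=> n; rewrite -rB; apply: (to_repP L _).1.
- exact: e0.
Qed.

End Normality.

(** * Ultraweak convergence *)

Section Ultraweak.
Context {R : realType}.

(** The statements about ultraweak limits are made in the topology of [R[i]]. *)
Lemma ncvg_topP (u : nat -> (R[i] : numFieldType)) (l : (R[i] : numFieldType)) :
  u @ \oo --> l <-> @ncvg R (R[i] : numFieldType) u l.
Proof.
split=> [/cvgrPdist_lt h|/ncvgP h].
  apply/ncvgP => e e0; have [|N _ hN] := h e%:C; first by rewrite ltcR.
  by exists N => n /hN; rewrite nrmE ltcR nrmB.
apply/cvgrPdist_lt => e e0; have [r r0 eE] := gt0C e0.
have [N hN] := h r r0; exists N => // n /hN; rewrite eE nrmB /=.
by rewrite nrmE ltcR.
Qed.

Local Notation C := (R[i] : numFieldType).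

Lemma ncvg_limn (u : nat -> C) (l : C) : @ncvg R C u l -> limn u = l.
Proof. by move=> /ncvg_topP h; apply: cvg_lim => //; exact: norm_hausdorff. Qed.

Lemma ncvg_cvgn (u : nat -> C) (l : C) : @ncvg R C u l -> cvgn u.
Proof. by move=> /ncvg_topP h; apply/cvg_ex; exists l. Qed.

Lemma cvgn_ncvg (u : nat -> C) : cvgn u -> @ncvg R C u (limn u).
Proof. by move=> /cvg_ex[l h]; apply/ncvg_topP; rewrite (cvg_lim _ h)//; exact: norm_hausdorff. Qed.

(** Sequences concentrated at index 0 reduce ultraweak to weak convergence. *)
Lemma series_single (f : nat -> C) : (forall k, f k.+1 = 0) -> @ncvg R C (series f) (f 0%N).
Proof.
move=> f0; apply/ncvgP => e e0; exists 1%N => -[//|n] _.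
by rewrite /series /= big_nat_recl// big1 ?addr0 ?subrr ?nrm0.
Qed.

Lemma weak_of_ultraweak (N : vnAlgebra R) (a : nat -> N) (b : N) : ultraweak_cvg a b ->
  forall u v, ncvg (fun n => '[a n u, v]) '[b u, v].
Proof.
move=> h u v; pose s (w : vn_space N) (k : nat) := if k is 0 then w else 0.
have hs w : cvgn (series (fun k => `|s w k| ^+ 2)).
  by apply: ncvg_cvgn; apply: series_single => k; rewrite /= normr0 expr0n.
have lE (x : N) : limn (series (fun k => '[x (s u k), s v k])) = '[x u, v].
  by apply: ncvg_limn; apply: series_single => k; rewrite /= dot0r.
have /ncvg_topP := h (s u) (s v) (hs u) (hs v); rewrite lE.
by under eq_fun do rewrite lE.
Qed.

(** Dominated convergence: the tails are uniformly small by [b], and the finitely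
    many remaining terms tend to 0. *)
Lemma dominated_series (f : nat -> nat -> C) (b : nat -> R) (K : R) (S : nat -> C) : 0 <= K ->
  (forall n k, nrm (f n k) <= K * b k) -> (forall k, 0 <= b k) -> cvgn (series b) ->
  (forall k, @ncvg R C (fun n => f n k) 0) -> (forall n, @ncvg R C (series (f n)) (S n)) ->
  @ncvg R C S 0.
Proof.
move=> K0 fb b0 /cvg_ex[B hB] f0 fS.
apply/ncvgP => e e0.
have e1 : 0 < e / 2 / (K + 1) by rewrite !divr_gt0 // ltr_wpDl.
have /cvgrPdist_lt/(_ _ e1)[N _ hN] := hB.
have tail n m : (N <= m)%N -> nrm (series (f n) m - series (f n) N) <= K * (series b m - series b N).
  move=> Nm; rewrite !sub_series_geq// mulr_sumr.
  elim/big_rec2: _ => [|i y x _ h]; first by rewrite nrm0.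
  by apply: le_trans (nrmD _ _) _; rewrite lerD.
have mono m : (N <= m)%N -> series b m <= B.
  move=> _; rewrite -(cvg_lim _ hB)//; apply: nondecreasing_cvgn_le; last by apply/cvg_ex; exists B.
  by apply/nondecreasing_seqP => n; rewrite /series /= big_nat_recr//= lerDl.
have tailS n : nrm (S n - series (f n) N) <= K * (e / 2 / (K + 1)).
  have l := ncvg_nrm (ncvgB (fS n) (ncvg_cst (series (f n) N))).
  rewrite -(cvg_lim _ l)//; apply: limr_le; first by apply/cvg_ex; eexists; exact: l.
  exists N => // m /= Nm; apply: le_trans (tail n m Nm) _; rewrite ler_wpM2l//.
  have := hN N (leqnn N) => /= /ltW /(le_trans (ler_norm _)); have := mono m Nm; lra.
have fin : @ncvg R C (fun n => series (f n) N) 0.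
  have -> : (0 : C) = \sum_(k <- index_iota 0 N) 0 by rewrite big1.
  exact: (@ncvg_sum R C _ _ (fun k n => f n k)).
have /ncvgP/(_ (e / 2)) [|N' hN'] := fin; first by rewrite divr_gt0.
exists N' => n /hN'; rewrite !subr0 => h.
apply: le_lt_trans (nrm_ler _ (series (f n) N)) _.
rewrite (splitr e); apply: ltr_leD => //; apply: le_trans (tailS n) _.
by rewrite mulrC mulrAC ler_pdivrMr ?ltr_wpDl// ler_wpM2l ?lerDl// ltW// divr_gt0.
Qed.

(** A decreasing sequence of positive operators is uniformly bounded, so the
    series are dominated by [nrm (xi k) ^+ 2 + nrm (eta k) ^+ 2]. *)
Lemma ultraweak_of_weak (N : vnAlgebra R) (a : nat -> N) (b : N) :
  (forall n, vn_pos (a n - b)) -> (forall n, vn_pos (a n - a n.+1)) ->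
  (forall u v, ncvg (fun n => '[(a n - b) u, v]) 0) -> ultraweak_cvg a b.
Proof.
move=> pd dd d0 xi eta /cvgn_ncvg hxi /cvgn_ncvg heta.
pose d n := a n - b.
have aE n u v : '[a n u, v] = '[d n u, v] + '[b u, v].
  by rewrite /d vn_opB dotBl subrK.
have dd' n : vn_pos (d n - d n.+1).
  by rewrite /d opprB addrA subrK.
have dle n u : complex.Re '[d n u, u] <= complex.Re '[d 0%N u, u].
  by elim: n => // n; apply: le_trans; exact: (decreasing_le dd').
have /bounded_opP[_ [K K0 hK]] := vn_op_bounded (d 0%N).
have dn n u : nrm (d n u) <= K * nrm u.
  apply: pos_op_norm => //; first exact: pd.
  move=> w; apply: le_trans (dle n w) _; apply: le_trans (Re_dot_le _ _) _.
  by rewrite expr2 mulrA ler_wpM2r ?nrm_ge0.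
pose c k := nrm (xi k) ^+ 2 + nrm (eta k) ^+ 2.
have c0 k : 0 <= c k by rewrite addr_ge0 ?sqr_ge0.
have cc : cvgn (series c).
  have cv (w : nat -> vn_space N) l : @ncvg R C (series (fun k => `|w k| ^+ 2)) l ->
      cvgn (series (fun k => nrm (w k) ^+ 2)).
    move=> h; apply/cvg_ex; exists (complex.Re l).
    have -> : series (fun k => nrm (w k) ^+ 2) = fun n => complex.Re (series (fun k => `|w k| ^+ 2) n).
      apply/funext => n; rewrite /series /= Re_sum; apply: eq_bigr => k _.
      by rewrite nrmE -rmorphXn.
    exact: (ncvg_Re (u := series (fun k => `|w k| ^+ 2 : R[i]))) h.
  have -> : series c = series (fun k => nrm (xi k) ^+ 2) + series (fun k => nrm (eta k) ^+ 2).
    by apply/funext => n; rewrite /series /= /c big_split.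
  by apply: is_cvgD; [exact: cv hxi|exact: cv heta].
have bd (x : vn_space N -> vn_space N) L : 0 <= L -> (forall u, nrm (x u) <= L * nrm u) ->
    forall k, nrm '[x (xi k), eta k] <= L * c k.
  move=> L0 hx k; apply: le_trans (dot_le _ _) _.
  apply: le_trans (ler_wpM2r (nrm_ge0 _) (hx _)) _; rewrite -mulrA ler_wpM2l// /c.
  have := sqr_ge0 (nrm (xi k) - nrm (eta k)); rewrite sqrrB -mulr_natr.
  have := mulr_ge0 (nrm_ge0 (xi k)) (nrm_ge0 (eta k)); lra.
have cs (x : vn_space N -> vn_space N) L : 0 <= L -> (forall u, nrm (x u) <= L * nrm u) ->
    exists l : C, @ncvg R C (series (fun k => '[x (xi k), eta k])) l.
  move=> L0 hx; apply: complex_cauchy => e e0.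
  have p : 0 < L + 1 by rewrite ltr_wpDl.
  have /cvg_ex[B hB] := cc.
  have e1 : 0 < e / (L + 1) / 2 by rewrite !divr_gt0.
  have /cvgrPdist_lt/(_ _ e1)[N0 _ hN] := hB.
  exists N0 => n m; wlog mn : n m / (m <= n)%N.
    by move=> h; case/orP: (leq_total m n) => // ? ? ?; [exact: h|rewrite nrmB; exact: h].
  move=> Nn Nm.
  apply: (@le_lt_trans _ _ (L * (series c n - series c m))).
    rewrite !sub_series_geq// mulr_sumr.
    elim/big_rec2: _ => [|i y z _ h]; first by rewrite nrm0.
    by apply: le_trans (nrmD _ _) _; rewrite lerD// bd.
  have := hN _ Nn => /=; have := hN _ Nm => /=.
  rewrite !ltr_norml => /andP[h1 h2] /andP[h3 h4].
  have h5 : series c n - series c m <= e / (L + 1) by lra.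
  have q : 0 < e / (L + 1) by rewrite divr_gt0.
  apply: le_lt_trans (ler_wpM2l L0 h5) _.
  by rewrite mulrCA -[ltRHS]mulr1 ltr_pM2l// ltr_pdivrMr// mul1r ltrDl.
have /choice[S hS] : forall n, exists l : C, @ncvg R C (series (fun k => '[d n (xi k), eta k])) l.
  by move=> n; apply: cs K0 (dn n).
have /bounded_opP[_ [K' K'0 hK']] := vn_op_bounded b.
have [T hT] := cs b K' K'0 hK'.
have S0 : @ncvg R C S 0.
  apply: (dominated_series (b := c) K0 _ c0 cc _ hS).
    by move=> n k; exact: bd.
  by move=> k; exact: d0.
rewrite (ncvg_limn hT).
have -> : (fun n => limn (series (fun k => '[a n (xi k), eta k]))) = (fun n => S n + T).
  apply/funext => n; apply: ncvg_limn.
  apply: (ncvg_eq (u := fun m => series (fun k => '[d n (xi k), eta k]) m + series (fun k => '[b (xi k), eta k]) m)).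
    move=> m; rewrite /series /= -big_split; apply: eq_bigr => k _ /=.
    by rewrite aE.
  exact: ncvgD (hS n) hT.
apply/ncvg_topP; rewrite -[X in ncvg _ X]add0r; apply: ncvgD S0 _; exact: ncvg_cst.
Qed.

End Ultraweak.

(** * Decreasing sequences of CP maps *)

Section DecreasingCP.
Context {R : realType} {M N : vnAlgebra R} (L : standardForm N).
Local Notation C := R[i].
Local Notation rep := (@sf_rep R N L).
Local Notation cpf := (@cp_form R M N L).

Lemma CP_pos (D : M -> N) x : CP D -> vn_pos x -> vn_pos (D x).
Proof.
move=> [_ cD] px; split=> [|u]; first exact: vn_op_bounded.
have /cD/(_ (fun=> u)) : mx_pos (\matrix_(i < 1, j < 1) x).
  by move=> xi; rewrite !big_ord1 mxE; case: px.
by rewrite !big_ord1 !mxE.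
Qed.

Lemma cp_leB_pos (Phi Psi : M -> N) x : cp_le Phi Psi -> vn_pos x -> vn_pos (Psi x - Phi x).
Proof. by move=> h px; exact: CP_pos h px. Qed.

Section Sequence.
Variables (Phi_ : nat -> M -> N) (Phi : M -> N).
Hypotheses (cP_ : forall n, CP (Phi_ n)) (cP : CP Phi) (dP : cp_decreases_to Phi_ Phi).

Lemma cp_dec_weak x u v : ncvg (fun n => '[Phi_ n x u, v]) '[Phi x u, v].
Proof.
move: x u v; apply: square_ind => [w|c x y hx hy] u v.
  exact: weak_of_ultraweak (dP.2 _ (vn_pos_star w)) u v.
rewrite cP.1 vn_opD vn_opZ dotDl dotZl.
apply: (ncvg_eq (u := fun n => c * '[Phi_ n x u, v] + '[Phi_ n y u, v])).
  by move=> n; rewrite (cP_ n).1 vn_opD vn_opZ dotDl dotZl.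
by apply: ncvgD => //; apply: ncvgMl.
Qed.

Lemma cp_dec_le n m : cp_le (Phi_ (m + n)%N) (Phi_ n).
Proof.
apply/(cp_leP L) => // t; elim: m => // m; apply: le_trans.
by move/(cp_leP L (cP_ _) (cP_ _)): (dP.1 (m + n)%N); apply.
Qed.

Lemma cp_dec_lower n : cp_le Phi (Phi_ n).
Proof.
split.
  move=> c x y; transitivity (Phi_ n (c *: x + y) - Phi (c *: x + y)); first by [].
  transitivity (c *: (Phi_ n x - Phi x) + (Phi_ n y - Phi y)); last by [].
  by rewrite cP.1 (cP_ n).1 scalerBr opprD addrACA.
move=> k a pa xi.
apply: (ncvg_ge0 (u := fun m => \sum_(i < k) \sum_(j < k) '[(Phi_ n (a i j) - Phi_ (m + n)%N (a i j)) (xi j), xi i])).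
  move=> m; have := (cp_dec_le n m).2 _ _ pa xi.
  by congr (_ <= _); apply: eq_bigr => i _; apply: eq_bigr => j _; rewrite mxE.
have -> : \sum_(i < k) \sum_(j < k) '[map_mx (Phi_ n - Phi) a i j (xi j), xi i] =
   \sum_(i < k) \sum_(j < k) ('[Phi_ n (a i j) (xi j), xi i] - '[Phi (a i j) (xi j), xi i]).
  by apply: eq_bigr => i _; apply: eq_bigr => j _; rewrite mxE -dotBl -vn_opB.
apply: (@ncvg_sum R C _ _ (fun i m => \sum_(j < k) '[(Phi_ n (a i j) - Phi_ (m + n)%N (a i j)) (xi j), xi i])) => i.
apply: (@ncvg_sum R C _ _ (fun j m => '[(Phi_ n (a i j) - Phi_ (m + n)%N (a i j)) (xi j), xi i])) => j.
apply: (ncvg_eq (u := fun m => '[Phi_ n (a i j) (xi j), xi i] - '[Phi_ (m + n)%N (a i j) (xi j), xi i])).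
  by move=> m; rewrite vn_opB dotBl.
by apply: ncvgB; [exact: ncvg_cst|apply: (ncvg_shift (u := fun m => '[Phi_ m (a i j) (xi j), xi i])); exact: cp_dec_weak].
Qed.

(** Ultraweak convergence is assumed on [vn_space N]; it reaches the standard form
    through [rep_normal], on squares first and then by linearity. *)
Lemma cp_dec_rep x xi eta : ncvg (fun n => '[rep (Phi_ n x) xi, eta]) '[rep (Phi x) xi, eta].
Proof.
move: x xi eta; apply: square_ind => [w|c x y hx hy] xi eta.
  pose x := w^\* *v w; have px : vn_pos x := vn_pos_star w.
  have h : ncvg (fun n => '[rep (Phi_ n x - Phi x) xi, eta]) 0.
    apply: rep_normal => [n|n|u].
    - exact: cp_leB_pos (cp_dec_lower n) px.
    - rewrite opprB addrA subrK; exact: cp_leB_pos (dP.1 n) px.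
    - apply: (ncvg_eq (u := fun n => '[Phi_ n x u, u] - '[Phi x u, u])).
        by move=> n; rewrite vn_opB dotBl.
      rewrite -(subrr '[Phi x u, u]); apply: ncvgB; [exact: cp_dec_weak|exact: ncvg_cst].
  have := ncvgD h (ncvg_cst '[rep (Phi x) xi, eta]); rewrite add0r.
  by apply: ncvg_eq => n; rewrite repB dotBl subrK.
rewrite cP.1 repD repZ dotDl dotZl.
apply: (ncvg_eq (u := fun n => c * '[rep (Phi_ n x) xi, eta] + '[rep (Phi_ n y) xi, eta])).
  by move=> n; rewrite (cP_ n).1 repD repZ dotDl dotZl.
by apply: ncvgD => //; apply: ncvgMl.
Qed.

Lemma cp_dec_form t t' : ncvg (fun n => cpf (Phi_ n) t t') (cpf Phi t t').
Proof.
have [k [z [xi [eta [-> ->]]]]] := tensor_common t t'.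
rewrite cp_form_gram//.
apply: (ncvg_eq (u := fun n => rep_gram (Phi_ n) z xi eta)).
  by move=> n; rewrite cp_form_gram.
apply: (@ncvg_sum R C _ _ (fun i n => \sum_(j < k) '[rep (Phi_ n ((z i)^\* *v z j)) (xi j), eta i])) => i.
apply: (@ncvg_sum R C _ _ (fun j n => '[rep (Phi_ n ((z i)^\* *v z j)) (xi j), eta i])) => j.
exact: cp_dec_rep.
Qed.

End Sequence.

(** The forms of the means decrease to a positive form [g].  The block condition
    is closed under limits, so [g] lies below the form of [cp_gmean L Phi Psi] by
    maximality; it lies above it by monotonicity. *)
Lemma cp_gmean_decreasing (Phi_ Psi_ : nat -> M -> N) (Phi Psi : M -> N) :
  (forall n, CP (Phi_ n)) -> (forall n, CP (Psi_ n)) -> CP Phi -> CP Psi ->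
  cp_decreases_to Phi_ Phi -> cp_decreases_to Psi_ Psi ->
  cp_decreases_to (fun n => cp_gmean L (Phi_ n) (Psi_ n)) (cp_gmean L Phi Psi).
Proof.
move=> cP_ cQ_ cP cQ dP dQ.
pose G n := cp_gmean L (Phi_ n) (Psi_ n); pose G0 := cp_gmean L Phi Psi.
have cG n : CP (G n) by exact: cp_gmean_CP.
have cG0 : CP G0 by exact: cp_gmean_CP.
have dG n : cp_le (G n.+1) (G n).
  by apply: cp_gmean_mono; rewrite //; [exact: dP.1|exact: dQ.1].
have lG n : cp_le G0 (G n).
  apply: cp_gmean_mono => //; [exact: cp_dec_lower cP_ cP dP n|exact: cp_dec_lower cQ_ cQ dQ n].
split=> // x px.
have [g pg hg] : exists2 g, pos_form g & forall t t', ncvg (fun n => cpf (G n) t t') (g t t').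
  apply: decreasing_forms => [n|n t]; first exact: cp_form_pos.
  by move/(cp_leP L (cG _) (cG _)): (dG n); apply.
have bg : block_pos (cpf Phi) g (cpf Psi).
  move=> t t'.
  apply: (ncvg_ge0 (u := fun n => cpf (Phi_ n) t t + cpf (G n) t t' + cpf (G n) t' t + cpf (Psi_ n) t' t')).
    by move=> n; exact: cp_gmean_block.
  do 3 (try apply: ncvgD); do ?exact: hg.
    exact: (cp_dec_form cP_ cP dP t t).
  exact: (cp_dec_form cQ_ cQ dQ t' t').
have gG t : g t t = cpf G0 t t.
  have pG0 := cp_form_pos L cG0.
  apply: Cext; last first.
    by have /ge0C[-> _] := pos_form_ge0 t pg; have /ge0C[-> _] := pos_form_ge0 t pG0.
  apply/eqP; rewrite eq_le cp_gmean_max//=.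
  have l := ncvg_Re (hg t t); rewrite -(cvg_lim _ l)//; apply: limr_ge.
    by apply/cvg_ex; eexists; exact: l.
  by apply: nearW => n; move/(cp_leP L cG0 (cG n)): (lG n); apply.
have pd n : vn_pos (G n x - G0 x) by exact: cp_leB_pos (lG n) px.
have dd n : vn_pos (G n x - G n.+1 x) by exact: cp_leB_pos (dG n) px.
apply: ultraweak_of_weak => //.
apply: (rep_normal_inv (L := L)) => // [n|xi].
  by rewrite opprB addrA subrK; exact: dd.
have [c cE] := vn_pos_square px.
have := ncvgB (hg (c ⊗ xi) (c ⊗ xi)) (ncvg_cst (cpf G0 (c ⊗ xi) (c ⊗ xi))).
rewrite gG subrr; apply: ncvg_eq => n.
by rewrite !cp_formE// -cE repB dotBl.
Qed.

End DecreasingCP.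

Theorem theorem3p6 (R : realType) (M N : vnAlgebra R) (L2N : standardForm N) :
  (forall Phi1 Phi2 Psi1 Psi2 : M -> N,
     CP Phi1 -> CP Phi2 -> CP Psi1 -> CP Psi2 ->
     cp_le Phi1 Phi2 -> cp_le Psi1 Psi2 ->
     cp_le (cp_gmean L2N Phi1 Psi1) (cp_gmean L2N Phi2 Psi2)) /\
  (forall (P : vnAlgebra R) (L2P : standardForm P)
          (Phi Psi : M -> N) (Xi : N -> P),
     CP Phi -> CP Psi -> CP Xi ->
     cp_le (Xi \o cp_gmean L2N Phi Psi) (cp_gmean L2P (Xi \o Phi) (Xi \o Psi))) /\
  (forall (L : vnAlgebra R) (Phi Psi : M -> N) (Xi : L -> M),
     CP Phi -> CP Psi -> CP Xi ->
     cp_le (cp_gmean L2N Phi Psi \o Xi) (cp_gmean L2N (Phi \o Xi) (Psi \o Xi))) /\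
  (forall (Phi_ Psi_ : nat -> M -> N) (Phi Psi : M -> N),
     (forall n, CP (Phi_ n)) -> (forall n, CP (Psi_ n)) -> CP Phi -> CP Psi ->
     cp_decreases_to Phi_ Phi -> cp_decreases_to Psi_ Psi ->
     cp_decreases_to (fun n => cp_gmean L2N (Phi_ n) (Psi_ n))
                     (cp_gmean L2N Phi Psi)).
Proof.
split; first by move=> *; exact: cp_gmean_mono.
split; first by move=> *; exact: cp_gmean_comp_left.
split; first by move=> *; exact: cp_gmean_comp_right.
exact: cp_gmean_decreasing.
Qed.
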